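(* Let $(M,L)$ be a Finsler manifold admitting a concurrent $\pi$-vector field $\overline{\zeta}$, and let $(M,\widetilde{L})$ be the Finsler manifold obtained from it by the energy $\beta$-change $\widetilde{L}^{2}=L^{2}+B^{2}$, where $B:=g(\overline{\zeta},\overline{\eta})$. Put $p^{2}:=g(\overline{\zeta},\overline{\zeta})$. Then the curvature tensors of the associated Hashiguchi connections $D^{*}$ and $\widetilde{D^{*}}$ are related, for all vector fields $X,Y$ on $\mathcal{T}M$ and all $\overline{Z}\in\mathfrak{X}(\pi(M))$, by $$\widetilde{\mathbf{K}^{*}}(X,Y)\overline{Z}=\mathbf{K}^{*}(X,Y)\overline{Z}+\frac{g(\mathbf{T}(X,Y),\overline{Z})}{1+p^2}\,\overline{\zeta}+H^{*}(\rho X,\rho Y)\overline{Z},$$ where $H^{*}$ is the $\pi$-tensor field defined by $$H^{*}(\rho X,\rho Y)\overline{Z}=\mathfrak{U}_{X,Y}\left\{\frac{g(\rho X,\overline{Z})}{1+p^2}\,\rho Y+\frac{g(\rho Y,\overline{Z})\,g(\rho X,\overline{\zeta})}{(1+p^2)^2}\,\overline{\zeta}\right\}.$$ In particular, for all $\overline{X},\overline{Y},\overline{Z}\in\mathfrak{X}(\pi(M))$: (a) $\widetilde{S^{*}}(\overline{X},\overline{Y})\overline{Z}=S^{*}(\overline{X},\overline{Y})\overline{Z}$; (b) $\widetilde{P^{*}}(\overline{X},\overline{Y})\overline{Z}=P^{*}(\overline{X},\overline{Y})\overline{Z}-\dfrac{g(T(\overline{Y},\overline{X}),\overline{Z})}{1+p^2}\,\overline{\zeta}$;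 (c) $\widetilde{R^{*}}(\overline{X},\overline{Y})\overline{Z}=R^{*}(\overline{X},\overline{Y})\overline{Z}+H^{*}(\overline{X},\overline{Y})\overline{Z}$.
   Context: $M$ is a real paracompact smooth manifold of finite dimension $n$; all objects are $C^\infty$. $\pi:\mathcal{T}M\to M$ is the bundle of nonzero tangent vectors, $\pi^{-1}(TM)\to\mathcal{T}M$ the pullback of $TM$ by $\pi$. Sections of $\pi^{-1}(TM)$ are called $\pi$-vector fields, are written with bars, and form the module $\mathfrak{X}(\pi(M))$; tensor fields on $\pi^{-1}(TM)$ are called $\pi$-tensor fields. The fundamental $\pi$-vector field is $\overline{\eta}(u)=(u,u)$. $\rho:T(\mathcal{T}M)\to\pi^{-1}(TM)$ is $\rho=(\pi_{\mathcal{T}M},d\pi)$, and $\gamma:\pi^{-1}(TM)\to T(\mathcal{T}M)$ is the vertical lift $\gamma(u,v)=j_u(v)$, with $j_u:T_{\pi(u)}M\to T_u(T_{\pi(u)}M)$ the natural isomorphism. $(M,L)$ is a Finsler manifold with Finsler metric $g$ on $\pi^{-1}(TM)$ (locally $g_{ij}=\frac12\partial^2L^2/\partial y^i\partial y^j$). For a linear connection $D$ on $\pi^{-1}(TM)$ its connection map is $K(X)=D_X\overline{\eta}$; $D$ is regular if $T_u(\mathcal{T}M)=V_u(\mathcal{T}M)\oplus\ker K_u$ for all $u$ ($V$ the vertical bundle), and then its horizontal map is $\beta:=(\rho|_{\ker K})^{-1}$. The torsion is $\mathbf{T}(X,Y)=D_X\rho Y-D_Y\rho X-\rho[X,Y]$,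 with $Q(\overline{X},\overline{Y})=\mathbf{T}(\beta\overline{X},\beta\overline{Y})$ and $(h)hv$-torsion $T(\overline{X},\overline{Y})=\mathbf{T}(\gamma\overline{X},\beta\overline{Y})$. The curvature is $\mathbf{K}(X,Y)\rho Z=-D_XD_Y\rho Z+D_YD_X\rho Z+D_{[X,Y]}\rho Z$, with $h$-, $hv$-, $v$-curvatures $R(\overline{X},\overline{Y})\overline{Z}=\mathbf{K}(\beta\overline{X},\beta\overline{Y})\overline{Z}$, $P(\overline{X},\overline{Y})\overline{Z}=\mathbf{K}(\beta\overline{X},\gamma\overline{Y})\overline{Z}$, $S(\overline{X},\overline{Y})\overline{Z}=\mathbf{K}(\gamma\overline{X},\gamma\overline{Y})\overline{Z}$, and $\widehat{P}(\overline{X},\overline{Y})=P(\overline{X},\overline{Y})\overline{\eta}$. The Cartan connection $\nabla$ is the unique regular connection on $\pi^{-1}(TM)$ with $\nabla g=0$, $Q=0$ and $g(T(\overline{X},\overline{Y}),\overline{Z})=g(T(\overline{X},\overline{Z}),\overline{Y})$. A $\pi$-vector field $\overline{\zeta}$ is concurrent if $\nabla_{\beta\overline{X}}\overline{\zeta}=-\overline{X}$ and $\nabla_{\gamma\overline{X}}\overline{\zeta}=0$ for all $\overline{X}$. The Hashiguchi connection of $(M,L)$ is $D^{*}_X\overline{Y}=\nabla_X\overline{Y}+\widehat{P}(\rho X,\overline{Y})$, with $\widehat{P}$ that of $\nabla$; it has the same horizontal map as $\nabla$. Its curvature and $h$-, $hv$-, $v$-curvature tensors are $\mathbf{K}^{*},R^{*},P^{*},S^{*}$.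 The undecorated $\mathbf{T},T,\beta$ are those of the Cartan connection $\nabla$ of $L$. Tilded objects are those of $\widetilde{L}$ (defined with its own horizontal map). $\mathfrak{U}_{X,Y}\{A(X,Y)\}:=A(X,Y)-A(Y,X)$. *)

(* Defs.v *)
(* MathComp / MathComp-Analysis, over an arbitrary [R : realType]. *)
From HB Require Import structures.
From mathcomp Require Import all_boot all_order all_algebra.
From mathcomp Require Import all_classical all_reals all_analysis.
Set Implicit Arguments.
Unset Strict Implicit.
Unset Printing Implicit Defensive.
Import Order.TTheory GRing.Theory Num.Theory numFieldNormedType.Exports.
Local Open Scope classical_set_scope.
Local Open Scope ring_scope.

Fixpoint Ck_on (R : realType) (V W : normedModType R) (k : nat)
    (U : set V) (f : V -> W) : Prop :=
  match k with
  | 0 => forall x, U x -> {for x, continuous f}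
  | k'.+1 => (forall x, U x -> differentiable f x) /\
             (forall v, Ck_on k' U (fun x => 'd f x v))
  end.

(* Used for open [U] in a finite-dimensional [V] only. *)
Definition smooth_on (R : realType) (V W : normedModType R)
    (U : set V) (f : V -> W) : Prop := forall k, Ck_on k U f.

(* An atlas modelled on [E], with charts indexed by [I], on the set
   [carrier] (below) of those points of [P] that lie in some chart domain.
   [param i] is the inverse of [coord i]; its values off the range of the
   chart are irrelevant. *)
Record atlas (R : realType) (E : normedModType R) (P I : Type) := Atlas {
  domain : I -> set P ;
  coord : I -> P -> E ;
  param : I -> E -> P }.

Section Atlas.
Variables (R : realType) (E : normedModType R) (P I : Type).
Variable A : atlas E P I.

Definition carrier : set P := \bigcup_i domain A i.

Definition chart_range (i : I) : set E := coord A i @` domain A i.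

(* A tangent vector at [p] is the family of its component vectors in the
   charts around [p] (and 0 at the other indices), related by the
   derivatives of the transition maps. *)
Definition tangent (p : P) : set (I -> E) := [set v |
  (forall i, ~ domain A i p -> v i = 0) /\
  (forall i j, domain A i p -> domain A j p ->
     v j = 'd (coord A j \o param A i) (coord A i p) (v i))].

Definition smooth_fun (f : P -> R) : Prop :=
  forall i, smooth_on (chart_range i) (f \o param A i).

(* Smooth sections of a bundle with fibres [fib p], whose elements are
   families of component vectors indexed by the charts. *)
Definition smooth_section (F : normedModType R) (fib : P -> set (I -> F)) :
    set (P -> I -> F) := [set s |
  (forall p, carrier p -> fib p (s p)) /\
  (forall i, smooth_on (chart_range i) (fun z => s (param A i z) i))].

Definition vfield : set (P -> I -> E) := smooth_section tangent.

(* The derivative at [p] of [f] along the tangent vector [v], computed in a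
   chart [i] around [p]. *)
Definition along (i : I) (p : P) (v : I -> E) (f : P -> R) : R :=
  'd (f \o param A i) (coord A i p) (v i).

(* [X, Y]^a = X^b d_b Y^a - Y^b d_b X^a in each chart. *)
Definition lie (X Y : P -> I -> E) : P -> I -> E := fun p i =>
  if `[< domain A i p >] then
    'd (fun z => Y (param A i z) i) (coord A i p) (X p i)
    - 'd (fun z => X (param A i z) i) (coord A i p) (Y p i)
  else 0.

End Atlas.

Definition paracompact (T : topologicalType) : Prop :=
  forall C : set (set T), (forall U, C U -> open U) ->
    \bigcup_(U in C) U = setT ->
  exists C' : set (set T),
    [/\ forall U, C' U -> open U,
        \bigcup_(U in C') U = setT,
        forall U, C' U -> exists2 U', C U' & U `<=` U' &
        forall x : T, exists2 W, nbhs x W &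
          finite_set [set U | C' U /\ U `&` W !=set0]].

Record smooth_manifold (R : realType) (n : nat) (M : topologicalType)
    (I : Type) (A : atlas 'rV[R]_n M I) : Prop := SmoothManifold {
  manifold_hausdorff : hausdorff_space M ;
  manifold_paracompact : paracompact M ;
  manifold_cover : carrier A = setT ;
  manifold_open_domain : forall i, open (domain A i) ;
  manifold_open_range : forall i, open (chart_range A i) ;
  manifold_coordK : forall i p, domain A i p -> param A i (coord A i p) = p ;
  manifold_coord_cont : forall i p, domain A i p ->
    {for p, continuous (coord A i)} ;
  manifold_param_cont : forall i z, chart_range A i z ->
    {for z, continuous (param A i)} ;
  manifold_transition : forall i j,
    smooth_on (coord A i @` (domain A i `&` domain A j))
              (coord A j \o param A i) }.

(* The atlas of the bundle TM\0 of nonzero tangent vectors induced by an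
   atlas of M, with the natural coordinates (x, y): the point [u] is the
   tangent vector [u.2] at [u.1], and the carrier is TM\0. *)
Definition slit_tangent (R : realType) (n : nat) (M I : Type)
    (A : atlas 'rV[R]_n M I) :
    atlas ('rV[R]_n * 'rV[R]_n)%type (M * (I -> 'rV[R]_n))%type I :=
  Atlas
    (fun i => [set u | [/\ domain A i u.1, tangent A u.1 u.2 & u.2 != 0]])
    (fun i u => (coord A i u.1, u.2 i))
    (fun i (z : 'rV[R]_n * 'rV[R]_n) => (param A i z.1, fun j =>
       if `[< domain A j (param A i z.1) >]
       then 'd (coord A j \o param A i) (z.1 : 'rV[R]_n) z.2 else 0)).

Section Finsler.
Variables (R : realType) (n : nat) (M : topologicalType) (I : Type).
Variable A : atlas 'rV[R]_n M I.

Local Notation V := 'rV[R]_n.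
Local Notation TM := (M * (I -> V))%type.
Local Notation TM0 := (slit_tangent A).

(* The module of pi-vector fields, i.e. sections of the pullback of TM by
   pi : TM\0 -> M. *)
Definition pi_vfield : set (TM -> I -> V) :=
  smooth_section TM0 (fun u => tangent A u.1).

Definition eta : TM -> I -> V := fun u => u.2.

(* In natural coordinates d pi is (a, b) |-> a and the vertical lift is
   v |-> (0, v). *)
Definition rho (w : I -> V * V) : I -> V := fun i => (w i).1.
Definition gamma (v : I -> V) : I -> V * V := fun i => (0, v i).

Definition rho_field (X : TM -> I -> V * V) : TM -> I -> V :=
  fun u => rho (X u).
Definition gamma_field (X : TM -> I -> V) : TM -> I -> V * V :=
  fun u => gamma (X u).

(* g_u(v, w) = (1/2) d^2/ds dt L^2(u + s v + t w) at s = t = 0, the sum being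
   taken in the tangent space at pi(u); in coordinates
   g_ij = (1/2) d^2 L^2 / dy^i dy^j. *)
Definition finsler_metric (L : TM -> R) (u : TM) (v w : I -> V) : R :=
  2^-1 * derive1 (fun s : R =>
    derive1 (fun t : R => L (u.1, u.2 + s *: v + t *: w) ^+ 2) 0) 0.

(* Only the values of [L] on TM\0 are used; the extension by 0 to the zero
   section is automatically continuous. *)
Record finsler (L : TM -> R) : Prop := Finsler {
  finsler_smooth : smooth_fun TM0 L ;
  finsler_gt0 : forall u, carrier TM0 u -> 0 < L u ;
  finsler_homogeneous : forall u (t : R), carrier TM0 u -> 0 < t ->
    L (u.1, t *: u.2) = t * L u ;
  finsler_posdef : forall u v, carrier TM0 u -> tangent A u.1 v -> v != 0 ->
    0 < finsler_metric L u v v }.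

(* [D X Y] is D_X Y for X a vector field on TM\0 and Y a pi-vector field.
   Fields are total functions whose values off TM\0 are irrelevant. *)
Record linear_connection
    (D : (TM -> I -> V * V) -> (TM -> I -> V) -> (TM -> I -> V)) : Prop :=
  LinearConnection {
  connection_section : forall X Y, vfield TM0 X -> pi_vfield Y ->
    pi_vfield (D X Y) ;
  connection_addl : forall X X' Y u, vfield TM0 X -> vfield TM0 X' ->
    pi_vfield Y -> carrier TM0 u ->
    D (fun a => X a + X' a) Y u = D X Y u + D X' Y u ;
  connection_scalel : forall f X Y u, smooth_fun TM0 f -> vfield TM0 X ->
    pi_vfield Y -> carrier TM0 u ->
    D (fun a => f a *: X a) Y u = f u *: D X Y u ;
  connection_addr : forall X Y Y' u, vfield TM0 X -> pi_vfield Y ->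
    pi_vfield Y' -> carrier TM0 u ->
    D X (fun a => Y a + Y' a) u = D X Y u + D X Y' u ;
  connection_leibniz : forall f X Y u i, smooth_fun TM0 f -> vfield TM0 X ->
    pi_vfield Y -> domain TM0 i u ->
    D X (fun a => f a *: Y a) u
      = along TM0 i u (X u) f *: Y u + f u *: D X Y u }.

Section Connection.
Variable D : (TM -> I -> V * V) -> (TM -> I -> V) -> (TM -> I -> V).

Definition vertical (u : TM) : set (I -> V * V) :=
  [set w | tangent TM0 u w /\ rho w = 0].

(* The kernel of the connection map K at [u]; K(X) = D_X eta at [u] depends on
   the value of X at [u] only. *)
Definition ker_connection (u : TM) : set (I -> V * V) :=
  [set w | exists X, [/\ vfield TM0 X, X u = w & D X eta u = 0]].

Definition regular_connection : Prop := forall u, carrier TM0 u ->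
  (forall w, tangent TM0 u w -> exists v h,
     [/\ vertical u v, ker_connection u h & w = v + h]) /\
  vertical u `&` ker_connection u `<=` [set 0].

(* The horizontal map beta = (rho restricted to ker K)^-1, on fields; [xget]
   returns the unique such vector when the connection is regular. *)
Definition horizontal (X : TM -> I -> V) : TM -> I -> V * V := fun u =>
  xget 0 [set w | ker_connection u w /\ rho w = X u].

Definition torsion (X Y : TM -> I -> V * V) : TM -> I -> V := fun u =>
  D X (rho_field Y) u - D Y (rho_field X) u - rho (lie TM0 X Y u).

Definition h_torsion (X Y : TM -> I -> V) : TM -> I -> V :=
  torsion (horizontal X) (horizontal Y).

Definition hv_torsion (X Y : TM -> I -> V) : TM -> I -> V :=
  torsion (gamma_field X) (horizontal Y).

Definition curvature (X Y : TM -> I -> V * V) (Z : TM -> I -> V) :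
    TM -> I -> V := fun u =>
  - D X (D Y Z) u + D Y (D X Z) u + D (lie TM0 X Y) Z u.

Definition h_curvature (X Y : TM -> I -> V) : (TM -> I -> V) -> TM -> I -> V :=
  curvature (horizontal X) (horizontal Y).

Definition hv_curvature (X Y : TM -> I -> V) : (TM -> I -> V) -> TM -> I -> V :=
  curvature (horizontal X) (gamma_field Y).

Definition v_curvature (X Y : TM -> I -> V) : (TM -> I -> V) -> TM -> I -> V :=
  curvature (gamma_field X) (gamma_field Y).

Definition P_hat (X Y : TM -> I -> V) : TM -> I -> V := hv_curvature X Y eta.

Definition hashiguchi (X : TM -> I -> V * V) (Y : TM -> I -> V) :
    TM -> I -> V := fun u =>
  D X Y u + P_hat (rho_field X) Y u.

Definition metric_connection (L : TM -> R) : Prop :=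
  forall X Y Z u i, vfield TM0 X -> pi_vfield Y -> pi_vfield Z ->
    domain TM0 i u ->
    along TM0 i u (X u) (fun a => finsler_metric L a (Y a) (Z a))
      = finsler_metric L u (D X Y u) (Z u)
        + finsler_metric L u (Y u) (D X Z u).

Record cartan_connection (L : TM -> R) : Prop := CartanConnection {
  cartan_linear : linear_connection D ;
  cartan_regular : regular_connection ;
  cartan_metric : metric_connection L ;
  cartan_h_torsion : forall X Y u, pi_vfield X -> pi_vfield Y ->
    carrier TM0 u -> h_torsion X Y u = 0 ;
  cartan_hv_torsion : forall X Y Z u, pi_vfield X -> pi_vfield Y ->
    pi_vfield Z -> carrier TM0 u ->
    finsler_metric L u (hv_torsion X Y u) (Z u)
      = finsler_metric L u (hv_torsion X Z u) (Y u) }.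

Definition concurrent (zeta : TM -> I -> V) : Prop :=
  pi_vfield zeta /\
  forall X u, pi_vfield X -> carrier TM0 u ->
    D (horizontal X) zeta u = - X u /\ D (gamma_field X) zeta u = 0.

End Connection.

Definition energy_beta_change (L : TM -> R) (zeta : TM -> I -> V) : TM -> R :=
  fun u => Num.sqrt (L u ^+ 2 + finsler_metric L u (zeta u) (eta u) ^+ 2).

Definition alternate (T : Type) (F : T -> T -> TM -> I -> V) (X Y : T) :
    TM -> I -> V := fun u => F X Y u - F Y X u.

Definition H_star (L : TM -> R) (zeta X Y Z : TM -> I -> V) : TM -> I -> V :=
  let g := finsler_metric L in
  let p2 u := g u (zeta u) (zeta u) in
  alternate (fun X Y u =>
    (g u (X u) (Z u) / (1 + p2 u)) *: Y u
    + (g u (Y u) (Z u) * g u (X u) (zeta u) / (1 + p2 u) ^+ 2) *: zeta u) X Y.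

End Finsler.

(* Main.v *)
Require Import Defs.
From HB Require Import structures.
From mathcomp Require Import all_boot all_order all_algebra.
From mathcomp Require Import all_classical all_reals all_analysis.
From mathcomp Require Import ring lra.
Import Order.TTheory GRing.Theory Num.Theory numFieldNormedType.Exports.
Import Defs.
Set Implicit Arguments.
Unset Strict Implicit.
Unset Printing Implicit Defensive.
Local Open Scope classical_set_scope.
Local Open Scope ring_scope.

(** A concurrent field on the whole slit tangent bundle forces the Finsler metric
    to be Riemannian, and both sides of the formulas become expressions in
    torsion-free metric connections.

    Since [zeta] is concurrent, [D_W zeta = - rho W] for every [W], whence
    [d(g(zeta, zeta)) = - 2 g(rho ., zeta)]. This differential vanishes on
    vertical vectors, and by symmetry of second derivatives the 1-form dual to
    [zeta] does not depend on the direction [y] ([dual_form_vertical]). It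
    follows that the Cartan tensor [C] vanishes on [zeta] ([hv_torsion_zeta]) and
    that [zeta] does not depend on [y] either. In a fibre, [C] is therefore
    constant along [zeta]; as it is also homogeneous of degree -1, [r C] is
    constant on a segment from [zeta] or [- zeta] to [y], parametrized by
    [0 <= r <= 1], and [C = 0]. Where [zeta] vanishes, a horizontal derivative of
    [g(T(X, Y), zeta) = 0] gives the same conclusion ([torsion_at_zero]). This is
    [concurrent_flat].

    The metric of the energy beta-change is then [g + zeta^* (x) zeta^*], where
    [zeta^*] is the dual 1-form ([changed_chart_metric]), and it is independent
    of [y] as well. For both metrics the whole torsion vanishes
    ([flat_torsion]). The first Bianchi identity and the skewness of the
    curvature endomorphisms, by the usual Koszul argument
    ([symmetric_skew_zero]), show that the curvature vanishes as soon as one of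
    its arguments is vertical ([vertical_curvature]). In particular [P_hat] is 0, so
    that each Hashiguchi connection coincides with its Cartan connection
    ([hashiguchiE]).

    The Koszul argument also identifies the new Cartan connection as
    [D_X Y - g(rho X, Y) / (1 + p^2) zeta] ([changed_connection]), and the
    general formula is a computation ([changed_curvature]). In (a) and (b) both
    curvatures are 0. In (c) the horizontal lifts for the two metrics differ,
    but by vertical fields, which the curvature ignores
    ([curvature_horizontal_part]).

    Global sections through given vectors are needed throughout. They do not come
    from bump functions but from the regularity of the connection, which by
    definition provides a horizontal field through every horizontal vector
    ([horizontal_extension]); the smoothness of horizontal lifts is a matter of
    solving linear systems in a local frame ([horizontal_vfield]). *)

(** * Differentials *)

Section Differentials.
Variable R : realType.
Implicit Types E F V W : normedModType R.

(** The differential only depends on the germ of a map. This is read off the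
    first-order expansion in the form of an explicit estimate, which a
    modification away from the point does not affect. *)
Lemma diff_near_o V W (f : V -> W) x : differentiable f x ->
  forall e, 0 < e ->
  \forall h \near 0, `|f (h + x) - f x - 'd f x h| <= e * `|h|.
Proof.
move=> /diff_locally /eqaddoP + e e0 => /(_ e e0).
apply: filterS => h /=.
rewrite -[(_ - _) h]/(f (h + x) - (f x + 'd f x h)) opprD addrA.
exact.
Qed.

Lemma near_o_is_diff V W (f : V -> W) (df : {linear V -> W}) x :
  continuous df ->
  (forall e, 0 < e ->
    \forall h \near 0, `|f (h + x) - f x - df h| <= e * `|h|) ->
  is_diff x f df.
Proof.
move=> dfc H.
have E : f \o shift x = cst (f x) + df +o_ 0 id.
  apply/eqaddoP => e e0; have := H e e0.
  apply: filterS => h /=.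
  rewrite -[((f \o _) - _) h]/(f (h + x) - (f x + df h)) opprD addrA.
  exact.
have dE := diff_unique dfc E.
by apply: DiffDef => //; apply/diff_locallyP; rewrite dE.
Qed.

Lemma is_diff_near V W (f g : V -> W) x df :
  (\forall z \near x, f z = g z) -> is_diff x f df -> is_diff x g df.
Proof.
move=> fg [dif <-]; apply: near_o_is_diff; first exact: diff_continuous.
move=> e e0; have := diff_near_o dif e0.
have fgx : f x = g x := nbhs_singleton fg.
have : \forall h \near 0, f (h + x) = g (h + x).
  have := fg; rewrite (near_shift 0 x) => /=; apply: filterS => h /=.
  by rewrite subr0.
by apply: filterS2 => h fgh; rewrite fgh fgx.
Qed.

Lemma diff_near V W (f g : V -> W) x :
  (\forall z \near x, f z = g z) -> differentiable f x ->
  differentiable g x /\ 'd g x = 'd f x :> (V -> W).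
Proof.
move=> fg /differentiableP df.
by have [] := is_diff_near fg df.
Qed.

Lemma diff_val_at V W (f df : V -> W) x v : is_diff x f df -> 'd f x v = df v.
Proof. by move=> [_ ->]. Qed.

Lemma is_diff_chain E F W (p dp : E -> F) (f df : F -> W) x :
  is_diff x p dp -> is_diff (p x) f df ->
  is_diff x (fun z => f (p z)) (fun v => df (dp v)).
Proof. by move=> dpx dfx; exact: (@is_diff_comp _ _ _ _ _ _ _ _ _ dpx dfx). Qed.

Lemma is_diff_const V W (c : W) (x : V) :
  is_diff x (fun _ : V => c) (fun _ => 0).
Proof. exact: (@is_diff_cst _ _ _ c x). Qed.

Lemma is_diff_linear V W (f : {linear V -> W}) x :
  continuous f -> is_diff x f f.
Proof.
by move=> fc; apply: DiffDef; [exact: linear_differentiable|exact: diff_lin].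
Qed.

Fact scale_bilinear V :
  bilinear_for
    (GRing.Scale.Law.clone _ _ *:%R _) (GRing.Scale.Law.clone _ _ *:%R _)
    (fun (a : R) (v : V) => a *: v).
Proof.
split=> [u'|u] a x y /=; first by rewrite scalerDl scalerA.
by rewrite scalerDr !scalerA mulrC.
Qed.

Lemma is_diff_scale V W (f df : V -> R) (g dg : V -> W) x :
  is_diff x f df -> is_diff x g dg ->
  is_diff x (fun z => f z *: g z) (fun v => df v *: g x + f x *: dg v).
Proof.
move=> dfx dgx.
pose bM := bilinear_isBilinear.Build R R W W _ _ _ (@scale_bilinear W).
pose b : {bilinear R -> W -> W} := HB.pack (fun (a : R) (v : W) => a *: v) bM.
have bc : continuous (fun p => b p.1 p.2) by exact: scale_continuous.
have db : is_diff (f x, g x) (fun p => b p.1 p.2)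
    (fun p => b (f x) p.2 + b p.1 (g x)).
  apply: DiffDef; first exact: differentiable_bilin.
  by rewrite diff_bilin.
have dp := is_diff_pair dfx dgx.
have H := @is_diff_comp _ _ _ _ _ _ _ _ _ dp db.
apply: (is_diff_eq (f := fun z => f z *: g z) H).
by apply/funext => v /=; rewrite addrC.
Qed.

End Differentials.

(** * Smooth maps on open sets *)

Section Smooth.
Variable R : realType.
Implicit Types V W E F : normedModType R.

Lemma is_diff_linear_comp E V W (l : {linear V -> W}) (f df : E -> V) x :
  continuous l -> is_diff x f df ->
  is_diff x (fun z => l (f z)) (fun v => l (df v)).
Proof.
move=> lc dfx; have dl := @is_diff_linear R V W l (f x) lc.
exact: is_diff_chain dfx dl.
Qed.

Lemma is_diff_add V W (f df g dg : V -> W) x :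
  is_diff x f df -> is_diff x g dg ->
  is_diff x (fun z => f z + g z) (fun v => df v + dg v).
Proof. by move=> dfx dgx; exact: is_diffD. Qed.

Lemma is_diff_sum_seq V W (K : Type) (r : seq K) (f df : K -> V -> W) x :
  (forall k, is_diff x (f k) (df k)) ->
  is_diff x (fun z => \sum_(k <- r) f k z) (fun v => \sum_(k <- r) df k v).
Proof.
move=> H; elim: r => [|k r IH].
  rewrite [X in is_diff_def _ X](_ : _ = cst 0); last first.
    by apply/funext => z; rewrite big_nil.
  apply: (is_diff_eq (is_diff_cst _ _)).
  by apply/funext => v; rewrite big_nil.
rewrite [X in is_diff_def _ X](_ : _ =
    fun z => f k z + \sum_(k <- r) f k z); last first.
  by apply/funext => z; rewrite big_cons.
apply: (is_diff_eq (is_diff_add (H k) IH)).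
by apply/funext => v; rewrite big_cons.
Qed.

(** [Ck_on] is a pointwise condition: the derivatives that it speaks of are
    taken in the whole space, so that it can be tested at one point at a time. *)
Lemma Ck_mem k V W (U : set V) (f : V -> W) :
  Ck_on k U f <-> forall x, U x -> Ck_on k [set x] f.
Proof.
elim: k f => [|k IH] f /=.
  by split=> [H x Ux _ ->|H x Ux]; [exact: H|exact: (H x Ux x)].
split=> [[H1 H2] x Ux|H].
  split=> [_ ->|v]; first exact: H1.
  by move/IH: (H2 v); apply.
split=> [x Ux|v]; first by have [+ _] := H _ Ux; apply.
by apply/IH => x Ux; have [_ +] := H _ Ux; apply.
Qed.

Lemma Ck_sub k V W (U U' : set V) (f : V -> W) :
  U' `<=` U -> Ck_on k U f -> Ck_on k U' f.
Proof. by move=> sU /Ck_mem H; apply/Ck_mem => x /sU; exact: H. Qed.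

Lemma Ck_local k V W (U : set V) (f : V -> W) :
  (forall x, U x -> exists2 U', U' x & Ck_on k U' f) -> Ck_on k U f.
Proof.
move=> H; apply/Ck_mem => x /H[U' U'x].
by apply: Ck_sub => _ ->.
Qed.

Lemma Ck_congr k V W (U : set V) (f g : V -> W) :
  open U -> (forall x, U x -> f x = g x) -> Ck_on k U f -> Ck_on k U g.
Proof.
move=> oU; elim: k f g => [|k IH] f g fg /=.
  move=> H x Ux; rewrite /prop_for /continuous_at -(fg _ Ux).
  apply: cvg_trans (H _ Ux); apply: near_eq_cvg.
  by apply: filterS fg _; exact: open_nbhs_nbhs.
move=> [H1 H2].
have near_fg x : U x -> \forall z \near x, f z = g z.
  by move=> Ux; apply: filterS fg _; exact: open_nbhs_nbhs.
split=> [x Ux|v]; first by have [] := diff_near (near_fg _ Ux) (H1 _ Ux).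
apply: IH (H2 v) => x Ux.
exact: esym (diff_val_at v (is_diff_near (near_fg _ Ux) (differentiableP (H1 _ Ux)))).
Qed.

Lemma Ck_pred k V W (U : set V) (f : V -> W) :
  Ck_on k.+1 U f -> Ck_on k U f.
Proof.
elim: k f => [|k IH] f [H1 H2].
  by move=> x /H1; exact: differentiable_continuous.
by split => // v; apply: IH.
Qed.

Lemma CkD k V W (U : set V) (f g : V -> W) : open U ->
  Ck_on k U f -> Ck_on k U g -> Ck_on k U (fun x => f x + g x).
Proof.
move=> oU; elim: k f g => [|k IH] f g /=.
  by move=> H1 H2 x Ux; apply: continuousD; [exact: H1|exact: H2].
move=> [f1 f2] [g1 g2].
have D x : U x -> is_diff x (fun z => f z + g z) (fun v => 'd f x v + 'd g x v).
  by move=> Ux; apply: is_diff_add; apply: differentiableP; auto.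
split=> [x /D[]//|v].
apply: (Ck_congr oU _ (IH _ _ (f2 v) (g2 v))) => x Ux.
exact: esym (diff_val_at v (D x Ux)).
Qed.

Lemma Ck_cst k V W (U : set V) (c : W) : open U -> Ck_on k U (fun _ : V => c).
Proof.
move=> oU; elim: k c => [|k IH] c /=; first by move=> x Ux; exact: cvg_cst.
split=> [x _|v]; first exact: differentiable_cst.
apply: (Ck_congr oU _ (IH 0)) => x _.
exact: esym (diff_val_at v (is_diff_const c x)).
Qed.

Lemma Ck_lin_comp k E V W (U : set E) (l : {linear V -> W}) (f : E -> V) :
  open U -> continuous l -> Ck_on k U f -> Ck_on k U (fun x => l (f x)).
Proof.
move=> oU lc; elim: k f => [|k IH] f /=.
  by move=> H x Ux; apply: continuous_comp; [exact: H|exact: lc].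
move=> [f1 f2].
have D x : U x -> is_diff x (fun z => l (f z)) (fun v => l ('d f x v)).
  by move=> Ux; apply: is_diff_linear_comp => //; apply: differentiableP; auto.
split=> [x /D[]//|v].
apply: (Ck_congr oU _ (IH _ (f2 v))) => x Ux.
exact: esym (diff_val_at v (D x Ux)).
Qed.

Lemma Ck_linear k V W (U : set V) (l : {linear V -> W}) :
  open U -> continuous l -> Ck_on k U l.
Proof.
move=> oU lc; case: k => [|k] /=; first by move=> x _; exact: lc.
split=> [x _|v]; first exact: linear_differentiable.
apply: (Ck_congr oU _ (@Ck_cst k V W U (l v) oU)) => x _.
by rewrite diff_lin.
Qed.

Lemma CkZ k V W (U : set V) (f : V -> R) (g : V -> W) : open U ->
  Ck_on k U f -> Ck_on k U g -> Ck_on k U (fun x => f x *: g x).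
Proof.
move=> oU; elim: k f g => [|k IH] f g.
  by move=> H1 H2 x Ux; apply: cvgZ; [exact: H1|exact: H2].
move=> Cf Cg; have [f1 f2] := Cf; have [g1 g2] := Cg.
have D x : U x -> is_diff x (fun z => f z *: g z)
    (fun v => 'd f x v *: g x + f x *: 'd g x v).
  by move=> Ux; apply: is_diff_scale; apply: differentiableP; auto.
split=> [x /D[]//|v].
have H := CkD oU (IH _ _ (f2 v) (Ck_pred Cg)) (IH _ _ (Ck_pred Cf) (g2 v)).
apply: (Ck_congr oU _ H) => x Ux.
exact: esym (diff_val_at v (D x Ux)).
Qed.

Lemma Ck_sum k V W (U : set V) (K : Type) (r : seq K) (f : K -> V -> W) :
  open U -> (forall i, Ck_on k U (f i)) ->
  Ck_on k U (fun x => \sum_(i <- r) f i x).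
Proof.
move=> oU H; elim: r => [|i r IH].
  by apply: (Ck_congr oU _ (Ck_cst k (0 : W) oU)) => x _; rewrite big_nil.
by apply: (Ck_congr oU _ (CkD oU (H i) IH)) => x _; rewrite big_cons.
Qed.

(** The derivative of [1 / f] is [- f' / f^2], again an inverse up to factors
    already known to be of class [C^k]: hence an induction on [k]. *)
Lemma Ck_inv k V (U : set V) (f : V -> R) : open U ->
  (forall x, U x -> f x != 0) -> Ck_on k U f -> Ck_on k U (fun x => (f x)^-1).
Proof.
move=> oU fN0; elim: k => [|k IH].
  by move=> H x Ux; apply: cvgV; [exact: fN0|exact: H].
move=> Cf; have [f1 f2] := Cf.
have D x : U x -> is_diff x (fun z => (f z)^-1) (fun v => - (f x) ^- 2 * 'd f x v).
  move=> Ux; have dv := diffV (f1 _ Ux) (fN0 _ Ux).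
  by apply: DiffDef; [exact: differentiableV (f1 _ Ux) (fN0 _ Ux)|exact: dv].
split=> [x /D[]//|v].
have Ci := IH (Ck_pred Cf).
have H := CkZ oU (CkZ oU (Ck_cst k (-1 : R) oU) (CkZ oU Ci Ci)) (f2 v).
apply: (Ck_congr oU _ H) => x Ux.
apply: etrans _ (esym (diff_val_at v (D x Ux))).
by rewrite /GRing.scale /= mulN1r -expr2 exprVn.
Qed.

Lemma smoothD V W (U : set V) (f g : V -> W) : open U ->
  smooth_on U f -> smooth_on U g -> smooth_on U (fun x => f x + g x).
Proof. by move=> oU Hf Hg k; exact: CkD. Qed.

Lemma smoothZ V W (U : set V) (f : V -> R) (g : V -> W) : open U ->
  smooth_on U f -> smooth_on U g -> smooth_on U (fun x => f x *: g x).
Proof. by move=> oU Hf Hg k; exact: CkZ. Qed.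

Lemma smooth_cst V W (U : set V) (c : W) : open U ->
  smooth_on U (fun _ : V => c).
Proof. by move=> oU k; exact: Ck_cst. Qed.

Lemma smoothM V (U : set V) (f g : V -> R) : open U ->
  smooth_on U f -> smooth_on U g -> smooth_on U (fun x => f x * g x).
Proof. by move=> oU Hf Hg; exact: smoothZ. Qed.

Lemma smoothN V W (U : set V) (f : V -> W) : open U ->
  smooth_on U f -> smooth_on U (fun x => - f x).
Proof.
move=> oU Hf k; apply: (Ck_congr oU _ (CkZ oU (Ck_cst k (-1 : R) oU) (Hf k))).
by move=> x _; rewrite scaleN1r.
Qed.

Lemma smoothB V W (U : set V) (f g : V -> W) : open U ->
  smooth_on U f -> smooth_on U g -> smooth_on U (fun x => f x - g x).
Proof. by move=> oU Hf Hg; apply: smoothD => //; exact: smoothN. Qed.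

Lemma smooth_sum V W (U : set V) (K : Type) (r : seq K) (f : K -> V -> W) :
  open U -> (forall i, smooth_on U (f i)) ->
  smooth_on U (fun x => \sum_(i <- r) f i x).
Proof. by move=> oU H k; apply: Ck_sum => // i; exact: H. Qed.

Lemma smooth_prod V (U : set V) (K : Type) (r : seq K) (f : K -> V -> R) :
  open U -> (forall i, smooth_on U (f i)) ->
  smooth_on U (fun x => \prod_(i <- r) f i x).
Proof.
move=> oU H; elim: r => [|i r IH] k.
  by apply: (Ck_congr oU _ (Ck_cst k (1 : R) oU)) => x _; rewrite big_nil.
by apply: (Ck_congr oU _ (smoothM oU (H i) IH k)) => x _; rewrite big_cons.
Qed.

Lemma smoothV V (U : set V) (f : V -> R) : open U ->
  (forall x, U x -> f x != 0) -> smooth_on U f ->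
  smooth_on U (fun x => (f x)^-1).
Proof. by move=> oU f0 H k; exact: Ck_inv. Qed.

Lemma smooth_congr V W (U : set V) (f g : V -> W) : open U ->
  (forall x, U x -> f x = g x) -> smooth_on U f -> smooth_on U g.
Proof. by move=> oU fg H k; exact: (Ck_congr oU fg). Qed.

Lemma smooth_sub V W (U U' : set V) (f : V -> W) :
  U' `<=` U -> smooth_on U f -> smooth_on U' f.
Proof. by move=> sU H k; exact: Ck_sub sU (H k). Qed.

Lemma smooth_local V W (U : set V) (f : V -> W) :
  (forall x, U x -> exists2 U', U' x & smooth_on U' f) -> smooth_on U f.
Proof.
move=> H k; apply: Ck_local => x /H[U' ? ?]; exists U' => //; auto.
Qed.

Lemma smooth_lin_comp E V W (U : set E) (l : {linear V -> W}) (f : E -> V) :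
  open U -> continuous l -> smooth_on U f -> smooth_on U (fun x => l (f x)).
Proof. by move=> oU lc H k; exact: Ck_lin_comp. Qed.

Lemma smooth_linear V W (U : set V) (l : {linear V -> W}) :
  open U -> continuous l -> smooth_on U l.
Proof. by move=> oU lc k; exact: Ck_linear. Qed.

Lemma smooth_id V (U : set V) : open U -> smooth_on U (fun x => x).
Proof. by move=> oU; apply: (@smooth_linear V V U idfun) => // x; exact: cvg_id. Qed.

Lemma smooth_differentiable V W (U : set V) (f : V -> W) x :
  smooth_on U f -> U x -> differentiable f x.
Proof. by move=> H Ux; have [H1 _] := H 1%N; exact: H1. Qed.

Lemma smooth_is_diff V W (U : set V) (f : V -> W) x :
  smooth_on U f -> U x -> is_diff x f ('d f x).
Proof. by move=> H Ux; apply: differentiableP; exact: smooth_differentiable H Ux. Qed.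

Lemma smooth_diff V W (U : set V) (f : V -> W) v :
  smooth_on U f -> smooth_on U (fun x => 'd f x v).
Proof. by move=> H k; have [_ H1] := H k.+1; exact: H1. Qed.

Lemma smooth_on_continuous V W (U : set V) (f : V -> W) x :
  smooth_on U f -> U x -> {for x, continuous f}.
Proof. by move=> H; exact: (H 0%N). Qed.

(** A finite family of vectors together with continuous coordinate forms: what
    is needed to write [df(w)] as a combination of the [df(e_k)] when [w] varies
    with the point. *)
Definition findim E := exists n (e : 'I_n -> E) (l : 'I_n -> {linear E -> R}),
  (forall k, continuous (l k)) /\ forall x, x = \sum_k l k x *: e k.

(** The chain rule gives [sum_k l_k(dp(v)) df(e_k)] for the derivative of
    [f o p] in the direction [v]; its terms are products of a derivative of [p]
    and a derivative of [f] composed with [p], of class [C^k] by induction. *)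
Lemma Ck_comp k E F W (U : set E) (U' : set F) (p : E -> F) (f : F -> W) :
  findim F -> open U -> (forall x, U x -> U' (p x)) ->
  Ck_on k U p -> Ck_on k U' f -> Ck_on k U (fun x => f (p x)).
Proof.
move=> [n [e [l [lc lE]]]] oU pU; elim: k f => [|k IH] f.
  move=> Hp Hf x Ux; apply: continuous_comp; first exact: Hp.
  by apply: Hf; exact: pU.
move=> Cp Cf; have [p1 p2] := Cp; have [f1 f2] := Cf.
have D x : U x -> is_diff x (fun z => f (p z)) (fun v => 'd f (p x) ('d p x v)).
  move=> Ux; have dp := differentiableP (p1 _ Ux).
  have df := differentiableP (f1 _ (pU _ Ux)).
  exact: is_diff_chain dp df.
split=> [x /D[]//|v].
have H : Ck_on k U (fun x => \sum_i l i ('d p x v) *: 'd f (p x) (e i)).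
  apply: Ck_sum => // i; apply: CkZ => //.
    exact: (Ck_lin_comp oU (lc i) (p2 v)).
  by apply: IH (Ck_pred Cp) (f2 _).
apply: (Ck_congr oU _ H) => x Ux.
apply: etrans _ (esym (diff_val_at v (D x Ux))).
by rewrite [in RHS](lE ('d p x v)) linear_sum; apply: eq_bigr => i _; rewrite linearZ.
Qed.

Lemma smooth_comp E F W (U : set E) (U' : set F) (p : E -> F) (f : F -> W) :
  findim F -> open U -> (forall x, U x -> U' (p x)) ->
  smooth_on U p -> smooth_on U' f -> smooth_on U (fun x => f (p x)).
Proof. by move=> fE oU pU Hp Hf k; exact: (Ck_comp fE oU pU). Qed.

Lemma smooth_diff_along E F W (U : set E) (U' : set F) (f : F -> W)
    (p w : E -> F) : findim F -> open U -> (forall z, U z -> U' (p z)) ->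
  smooth_on U' f -> smooth_on U p -> smooth_on U w ->
  smooth_on U (fun z => 'd f (p z) (w z)).
Proof.
move=> fF oU pU Hf Hp Hw; have [n [e [l [lc lE]]]] := fF.
apply: (@smooth_congr _ _ _ (fun z => \sum_i l i (w z) *: 'd f (p z) (e i))) => //.
  move=> x _; rewrite [in RHS](lE (w x)) linear_sum.
  by apply: eq_bigr => i _; rewrite linearZ.
apply: smooth_sum => // i; apply: smoothZ => //.
  exact: (smooth_lin_comp oU (lc i) Hw).
exact: (smooth_comp fF oU pU Hp (smooth_diff (e i) Hf)).
Qed.

Lemma is_diff_along E F W (U : set F) (f : F -> W) (p dp w dw : E -> F) x :
  findim F -> smooth_on U f -> U (p x) -> is_diff x p dp -> is_diff x w dw ->
  is_diff x (fun z => 'd f (p z) (w z))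
    (fun v => 'd (fun t => 'd f t (w x)) (p x) (dp v) + 'd f (p x) (dw v)).
Proof.
move=> [n [e [l [lc lE]]]] Hf Ux dpx dwx.
have Df i : is_diff (p x) (fun t => 'd f t (e i)) ('d (fun t => 'd f t (e i)) (p x)).
  exact: smooth_is_diff (smooth_diff _ Hf) Ux.
have D i : is_diff x (fun z => l i (w z) *: 'd f (p z) (e i))
  (fun v => l i (dw v) *: 'd f (p x) (e i)
          + l i (w x) *: 'd (fun t => 'd f t (e i)) (p x) (dp v)).
  apply: is_diff_scale; first exact: is_diff_linear_comp.
  exact: is_diff_chain dpx (Df i).
have S z u : 'd f z u = \sum_i l i u *: 'd f z (e i).
  rewrite [in LHS](lE u) linear_sum.
  by apply: eq_bigr => i _; rewrite linearZ.
rewrite (_ : (fun z => 'd f (p z) (w z)) =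
    fun z => \sum_i l i (w z) *: 'd f (p z) (e i)); last first.
  by apply/funext => z; rewrite S.
apply: (is_diff_eq (is_diff_sum_seq _ D)).
apply/funext => v; rewrite big_split /= addrC -S; congr (_ + _).
have C i : is_diff (p x) (fun t => l i (w x) *: 'd f t (e i))
   (fun v => 0 *: 'd f (p x) (e i)
      + l i (w x) *: 'd (fun t => 'd f t (e i)) (p x) v).
  exact: (is_diff_scale (is_diff_const _ _) (Df i)).
have H := is_diff_sum_seq (index_enum 'I_n) C.
rewrite [in RHS](_ : (fun t => 'd f t (w x)) =
    fun t => \sum_i l i (w x) *: 'd f t (e i)); last first.
  by apply/funext => z; rewrite S.
apply: etrans _ (esym (diff_val_at (dp v) H)).
by apply: eq_bigr => i _; rewrite scale0r add0r.
Qed.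

End Smooth.

(** * Lines, segments and symmetry of second derivatives *)

Lemma increment_arith (R : realType) (g1 g2 g A B s c : R) :
  (g1 - g2) * s - s ^+ 2 * A
  = s * ((g1 - g - (s * A + c * B)) - (g2 - g - c * B)).
Proof. by ring. Qed.

Lemma difference_quotient_arith (R : realType) (f1 f2 f3 f A B s : R) :
  s ^+ 2 * (A - B) = (f1 - f2 - (f3 - f) - s ^+ 2 * B)
    - (f1 - f3 - (f2 - f) - s ^+ 2 * A).
Proof. by ring. Qed.

Section Lines.
Variable R : realType.
Implicit Types V W E F : normedModType R.

Lemma is_derive_line E W (f : E -> W) (x v : E) (r : R) :
  differentiable f (x + r *: v) ->
  is_derive r 1 (fun r : R => f (x + r *: v)) ('d f (x + r *: v) v).
Proof.
move=> df.
have dl : is_diff r (fun t : R => x + t *: v) (fun t : R => 0 + t *: v).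
  by apply: is_diff_add; exact: is_diff_const.
have [D1 D2] := is_diff_chain dl (differentiableP df).
apply: DeriveDef; first exact: diff_derivable.
have := @deriveE R R W _ r (1 : R) D1; rewrite D2 /= add0r scale1r.
exact.
Qed.

Lemma derive1_line E W (f : E -> W) (x v : E) : differentiable f x ->
  derive1 (fun t : R => f (x + t *: v)) 0 = 'd f x v.
Proof.
move=> df; have := @is_derive_line E W f x v 0.
rewrite scale0r addr0 => /(_ df) [_].
by rewrite derive1E.
Qed.

Lemma cst_on01 (f : R -> R) :
  (forall r : R, 0 <= r <= 1 -> is_derive r 1 f 0) -> f 1 = f 0.
Proof.
move=> H.
have [r r01||c _] := @MVT_segment R f (fun=> 0) 0 1 ler01.
- apply: H; move: r01; rewrite in_itv /= => /andP[r0 r1].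
  by rewrite !ltW.
- apply: derivable_within_continuous => r; rewrite in_itv /= => /H[+ _].
  exact.
by rewrite mul0r => /eqP; rewrite subr_eq0 => /eqP.
Qed.

Lemma segment_cst_real E (f : E -> R) (x v : E) :
  (forall r : R, 0 <= r <= 1 ->
     differentiable f (x + r *: v) /\ 'd f (x + r *: v) v = 0) ->
  f (x + v) = f x.
Proof.
move=> H; have := @cst_on01 (fun r => f (x + r *: v)).
rewrite scale1r scale0r addr0; apply => r /H[df <-].
exact: is_derive_line.
Qed.

Lemma segment_cst E W (f : E -> W) (x v : E) : findim W ->
  (forall r : R, 0 <= r <= 1 ->
     differentiable f (x + r *: v) /\ 'd f (x + r *: v) v = 0) ->
  f (x + v) = f x.
Proof.
move=> [n [e [l [lc lE]]]] H.
rewrite (lE (f x)) (lE (f (x + v))); apply: eq_bigr => k _; congr (_ *: _).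
apply: (@segment_cst_real _ (fun z => l k (f z))) => r /H[df d0].
have [D ->] := is_diff_linear_comp (lc k) (differentiableP df).
by split => //=; rewrite d0 linear0.
Qed.

(** The hypothesis says that the function [r c(x + r v)] of [r] has zero
    derivative; it therefore keeps at [r = 1] its value 0 at [r = 0]. *)
Lemma radial_zero E (c : E -> R) (x v : E) :
  (forall r : R, 0 <= r <= 1 -> differentiable c (x + r *: v) /\
     c (x + r *: v) + r * 'd c (x + r *: v) v = 0) ->
  c (x + v) = 0.
Proof.
move=> H; have := @cst_on01 (fun r => r * c (x + r *: v)).
rewrite mul0r mul1r scale1r; apply => r /H[dc d0].
have D := @is_deriveM _ _ (@idfun R) (fun r : R => c (x + r *: v)) r 1 _ _
  (is_derive_id _ _) (is_derive_line dc).
apply: (@is_derive_eq _ _ _ (fun r : R => r * c (x + r *: v)) r 1 _ _ D).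
by rewrite /GRing.scale /= mulr1 addrC.
Qed.

(** By the mean value theorem along [v], the second difference is
    [s (g(x + s w + c v) - g(x + c v))] for some [c] in [[0, s]], where [g] is
    the derivative of [f] along [v]; both values of [g] are then compared with
    the first-order expansion of [g] at [x]. *)
Lemma second_difference E (f : E -> R) (U : set E) (x v w : E) (e : R) :
  open U -> U x -> (forall z, U z -> differentiable f z) ->
  differentiable (fun z => 'd f z v) x -> 0 < e ->
  exists2 d : R, 0 < d & forall s, 0 < s < d ->
   `|f (x + s *: w + s *: v) - f (x + s *: w) - (f (x + s *: v) - f x)
     - s ^+ 2 * 'd (fun z => 'd f z v) x w| <= e * s ^+ 2.
Proof.
move=> oU Ux df dg e0; set g := fun z => 'd f z v.
pose N := `|v| + `|v| + `|w| + 1.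
have v0 := normr_ge0 v; have w0 := normr_ge0 w.
have N0 : 0 < N by rewrite /N; lra.
have eN0 : 0 < e / N by rewrite divr_gt0.
have H1 := diff_near_o dg eN0.
have H2 : \forall h \near 0, U (h + x).
  have : \forall z \near x, U z by exact: open_nbhs_nbhs.
  rewrite (near_shift 0 x) => /=; apply: filterS => h /=.
  by rewrite subr0.
have : \forall h \near 0, `|g (h + x) - g x - 'd g x h| <= e / N * `|h| /\
    U (h + x) by apply: filterS2 H1 H2.
move=> /nbhs_ballP[d /= d0 Hd].
have {Hd}[Hg HU] : (forall h, `|h| < d ->
    `|g (x + h) - g x - 'd g x h| <= e / N * `|h|) /\
    (forall h, `|h| < d -> U (x + h)).
  by split=> h hd; rewrite (addrC x h);
    have [] // : _ := Hd h _; rewrite -ball_normE /= sub0r normrN.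
exists (d / N); first exact: divr_gt0.
move=> s /andP[s0 sd].
have sNd : s * N < d by rewrite -ltr_pdivlMr.
have small r t : 0 <= r <= s -> 0 <= t <= s ->
    `|t *: w + r *: v| <= s * (`|v| + `|w|).
  move=> /andP[r0 rs] /andP[t0 ts]; apply: le_trans (ler_normD _ _) _.
  rewrite !normrZ (ger0_norm r0) (ger0_norm t0).
  have := ler_wpM2r v0 rs; have := ler_wpM2r w0 ts; lra.
have smalld r t : 0 <= r <= s -> 0 <= t <= s -> `|t *: w + r *: v| < d.
  move=> hr ht; apply: le_lt_trans (small _ _ hr ht) _.
  apply: le_lt_trans sNd; rewrite /N.
  have := mulr_ge0 (ltW s0) v0; lra.
have s_s : 0 <= s <= s by rewrite (ltW s0) lexx.
have z_s : (0 : R) <= 0 <= s by rewrite lexx ltW.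
pose phi r := f (x + s *: w + r *: v) - f (x + r *: v).
have dphi r : 0 <= r <= s ->
    is_derive r 1 phi (g (x + s *: w + r *: v) - g (x + r *: v)).
  move=> rs; apply: is_deriveB; apply: is_derive_line; apply: df.
    by rewrite -addrA; apply: HU; exact: smalld.
  by apply: HU; have := smalld _ _ rs z_s; rewrite scale0r add0r.
have [r|r|c cs E1] := @MVT_segment R phi
    (fun r => g (x + s *: w + r *: v) - g (x + r *: v)) 0 s (ltW s0).
- by rewrite in_itv /= => /andP[r0 r1]; apply: dphi; rewrite !ltW.
- move: r; apply: derivable_within_continuous => r.
  by rewrite in_itv /= => /dphi[].
move: cs; rewrite in_itv /= => cs.
have -> : f (x + s *: w + s *: v) - f (x + s *: w) - (f (x + s *: v) - f x)
   = phi s - phi 0.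
  by rewrite /phi scale0r !addr0; ring.
rewrite E1 subr0.
have G1 := Hg _ (smalld c s cs s_s).
have G2 := Hg _ (smalld c 0 cs z_s).
have B1 := small _ _ cs s_s.
have B2 := small _ _ cs z_s.
set A := 'd g x w; set B := 'd g x v.
have L t : 'd g x (t *: w + c *: v) = t * A + c * B.
  by rewrite linearD !linearZ.
move: G1 G2 B1 B2; rewrite !L scale0r mul0r !add0r addrA.
set g1 := g (_ + _ + _); set g2 := g (x + _).
set n1 := `|s *: w + _|; set n2 := `|c *: v| => G1 G2 B1 B2.
rewrite (increment_arith g1 g2 (g x) A B s c) normrM (gtr0_norm s0).
have K0 : 0 <= e / N by exact: ltW.
have X1 : `|(g1 - g x - (s * A + c * B)) - (g2 - g x - c * B)|
    <= e / N * n1 + e / N * n2.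
  by apply: le_trans (ler_normB _ _) _; apply: lerD.
have B2' : n2 <= s * `|v|.
  rewrite /n2 normrZ ger0_norm; last by case/andP: cs.
  by apply: ler_wpM2r => //; case/andP: cs.
have X2 : e / N * n1 + e / N * n2 <= e / N * (s * N).
  rewrite -mulrDr; apply: ler_wpM2l => //.
  rewrite /N; move: B1 B2' s0; lra.
have X3 : e / N * (s * N) = e * s.
  by field; rewrite gt_eqF.
rewrite X3 in X2.
have := ler_wpM2l (ltW s0) (le_trans X1 X2).
by rewrite expr2 mulrCA.
Qed.

(** The second difference of [f] is symmetric in [v] and [w]. *)
Lemma Schwarz_real E (f : E -> R) (U : set E) (x v w : E) :
  open U -> U x -> smooth_on U f ->
  'd (fun z => 'd f z v) x w = 'd (fun z => 'd f z w) x v.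
Proof.
move=> oU Ux sf.
have df z : U z -> differentiable f z by exact: smooth_differentiable.
have dv u : differentiable (fun z => 'd f z u) x.
  by apply: (smooth_differentiable _ Ux); exact: smooth_diff.
apply/eqP; rewrite -subr_eq0 -normr_le0; apply/ler_addgt0Pr => e e0.
rewrite add0r.
have e20 : 0 < e / 2 by rewrite divr_gt0.
have [d1 d10 H1] := second_difference w oU Ux df (dv v) e20.
have [d2 d20 H2] := second_difference v oU Ux df (dv w) e20.
pose s := Num.min d1 d2 / 2.
have m0 : 0 < Num.min d1 d2 by rewrite lt_min d10.
have s0 : 0 < s by rewrite /s; lra.
have sm : s < Num.min d1 d2 by rewrite /s; lra.
move: (sm); rewrite lt_min => /andP[sd1 sd2].
have {}H1 := H1 s; have {}H2 := H2 s.
rewrite s0 sd1 in H1; rewrite s0 sd2 in H2.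
have {H1}/(_ isT) := H1; have {H2}/(_ isT) := H2.
rewrite (addrAC x (s *: v)).
set A := 'd _ x w; set B := 'd _ x v.
set f1 := f (_ + _ + _); set f2 := f (_ + _); set f3 := f (_ + _).
move=> H2 H1.
have s20 : 0 < s ^+ 2 by exact: exprn_gt0.
rewrite -(ler_pM2l s20) -[X in X * `|_|](gtr0_norm s20) -normrM.
rewrite (difference_quotient_arith f1 f2 f3 (f x)).
apply: le_trans (ler_normB _ _) _.
by apply: le_trans (lerD H2 H1) _; lra.
Qed.

(** The coordinate forms reduce the statement to real functions. *)
Lemma Schwarz E W (f : E -> W) (U : set E) (x v w : E) : findim W ->
  open U -> U x -> smooth_on U f ->
  'd (fun z => 'd f z v) x w = 'd (fun z => 'd f z w) x v.
Proof.
move=> [n [e [l [lc lE]]]] oU Ux sf.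
have S u : smooth_on U (fun z => 'd f z u) by exact: smooth_diff.
have D k u t : l k ('d (fun z => 'd f z u) x t) =
    'd (fun z => 'd (fun z => l k (f z)) z u) x t.
  have Dl := is_diff_linear_comp (lc k) (smooth_is_diff (S u) Ux).
  apply: etrans (esym (diff_val_at t Dl)) _.
  have E1 z : U z -> l k ('d f z u) = 'd (fun z => l k (f z)) z u.
    move=> Uz; have Df := is_diff_linear_comp (lc k) (smooth_is_diff sf Uz).
    exact: esym (diff_val_at u Df).
  have N : \forall z \near x, l k ('d f z u) = 'd (fun z => l k (f z)) z u.
    by apply: filterS E1 _; exact: open_nbhs_nbhs.
  have [Dd _] := Dl.
  exact: esym (diff_val_at t (is_diff_near N (differentiableP Dd))).
rewrite [LHS]lE [RHS]lE; apply: eq_bigr => k _; congr (_ *: _).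
rewrite !D; apply: (@Schwarz_real _ _ U) => //.
exact: smooth_lin_comp.
Qed.

End Lines.

(** * Finite-dimensional spaces and matrices *)

Section LinearMaps.
Variable R : realType.
Implicit Types V W E F : normedModType R.

Lemma linear_fun V W (f : V -> W) : (forall a u v, f (a *: u + v) = a *: f u + f v) ->
  exists l : {linear V -> W}, l = f :> (V -> W).
Proof.
move=> lf; pose fM := GRing.isLinear.Build _ _ _ _ f lf.
by exists (HB.pack f fM : {linear V -> W}).
Qed.

Lemma fst_linear V W :
  exists2 l : {linear (V * W)%type -> V}, continuous l & l = fst :> (V * W -> V).
Proof.
have [//|l lE] := @linear_fun (V * W)%type V fst.
by exists l => //; rewrite lE => x; exact: cvg_fst.
Qed.

Lemma snd_linear V W :
  exists2 l : {linear (V * W)%type -> W}, continuous l & l = snd :> (V * W -> W).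
Proof.
have [//|l lE] := @linear_fun (V * W)%type W snd.
by exists l => //; rewrite lE => x; exact: cvg_snd.
Qed.

Lemma inl_linear V W : exists2 l : {linear V -> (V * W)%type}, continuous l
  & l = (fun x => (x, 0)) :> (V -> V * W).
Proof.
have [a u v|l lE] := @linear_fun V (V * W)%type (fun x => (x, 0)).
  by apply: injective_projections; rewrite //= scaler0 addr0.
exists l => //; rewrite lE => x.
by apply: cvg_pair; [exact: cvg_id|exact: cvg_cst].
Qed.

Lemma inr_linear V W : exists2 l : {linear W -> (V * W)%type}, continuous l
  & l = (fun x => (0, x)) :> (W -> V * W).
Proof.
have [a u v|l lE] := @linear_fun W (V * W)%type (fun x => (0, x)).
  by apply: injective_projections; rewrite //= scaler0 addr0.
exists l => //; rewrite lE => x.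
by apply: cvg_pair; [exact: cvg_cst|exact: cvg_id].
Qed.

Lemma coord_linear n (k : 'I_n) :
  exists2 l : {linear 'rV[R]_n -> R}, continuous l & forall x, l x = x 0 k.
Proof.
have [a u v|l lE] := @linear_fun 'rV[R]_n R (fun x => x 0 k).
  by rewrite !mxE.
by exists l; [rewrite lE; exact: coord_continuous|rewrite lE].
Qed.

Lemma findim_rV n : findim 'rV[R]_n.
Proof.
have /choice[l lP] : forall k : 'I_n, exists l : {linear 'rV[R]_n -> R},
    continuous l /\ forall x, l x = x 0 k.
  by move=> k; have [l] := coord_linear k; exists l.
exists n, (delta_mx 0), l; split=> [k|x]; first by have [] := lP k.
rewrite [LHS]row_sum_delta; apply: eq_bigr => k _.
by have [_ ->] := lP k.
Qed.

Lemma findim_prod E F : findim E -> findim F -> findim (E * F)%type.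
Proof.
move=> [n [e [l [lc lE]]]] [m [f [k [kc kE]]]].
have [p1 p1c p1E] := fst_linear E F; have [p2 p2c p2E] := snd_linear E F.
exists (n + m)%N, (fun i : 'I_(n + m) => match fintype.split i with
    inl i => (e i, 0) | inr j => (0, f j) end).
have /choice[h hP] : forall i : 'I_(n + m), exists h : {linear (E * F)%type -> R},
   continuous h /\ forall z, h z = match fintype.split i with
    inl i => l i z.1 | inr j => k j z.2 end.
  move=> i; case: (fintype.split i) => j.
    have [a u v|h hE] := @linear_fun (E * F)%type R (fun z => l j z.1).
      by rewrite linearP.
    exists h; rewrite hE; split => // x.
    by apply: continuous_comp; [exact: cvg_fst|exact: lc].
  have [a u v|h hE] := @linear_fun (E * F)%type R (fun z => k j z.2).
    by rewrite linearP.
  exists h; rewrite hE; split => // x.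
  by apply: continuous_comp; [exact: cvg_snd|exact: kc].
exists h; split=> [i|[x y]]; first by have [] := hP i.
rewrite big_split_ord /=.
rewrite [X in X + _](_ : _ = (x, 0)); last first.
  have [i1 i1c i1E] := inl_linear E F.
  rewrite -[(x, 0)]/((fun x => (x, 0)) x) -i1E [in RHS](lE x) linear_sum.
  apply: eq_bigr => i _; rewrite linearZ (hP _).2.
  by rewrite i1E (unsplitK (inl i)).
rewrite [X in _ + X](_ : _ = (0, y)); last first.
  have [i1 i1c i1E] := inr_linear E F.
  rewrite -[(0, y)]/((fun x => (0, x)) y) -i1E [in RHS](kE y) linear_sum.
  apply: eq_bigr => i _; rewrite linearZ (hP _).2.
  by rewrite i1E (unsplitK (inr i)).
by apply: injective_projections; rewrite /= ?addr0 ?add0r.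
Qed.

Lemma is_diff_fst V W (x : V * W) :
  is_diff x (fun z : V * W => z.1) (fun z => z.1).
Proof.
by have [l lc lE] := fst_linear V W; have := is_diff_linear x lc; rewrite lE.
Qed.

Lemma is_diff_snd V W (x : V * W) :
  is_diff x (fun z : V * W => z.2) (fun z => z.2).
Proof.
by have [l lc lE] := snd_linear V W; have := is_diff_linear x lc; rewrite lE.
Qed.

Section Smooth.
Variables (E : normedModType R) (U : set E).
Hypothesis oU : open U.

Lemma smooth_fst V W (f : E -> V * W) :
  smooth_on U f -> smooth_on U (fun z => (f z).1).
Proof.
by have [l lc lE] := fst_linear V W => /(smooth_lin_comp oU lc); rewrite lE.
Qed.

Lemma smooth_snd V W (f : E -> V * W) :
  smooth_on U f -> smooth_on U (fun z => (f z).2).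
Proof.
by have [l lc lE] := snd_linear V W => /(smooth_lin_comp oU lc); rewrite lE.
Qed.

Lemma smooth_pair V W (f : E -> V) (g : E -> W) :
  smooth_on U f -> smooth_on U g -> smooth_on U (fun z => (f z, g z)).
Proof.
have [l lc lE] := inl_linear V W => /(smooth_lin_comp oU lc) sf.
have [k kc kE] := inr_linear V W => /(smooth_lin_comp oU kc) sg.
apply: smooth_congr (smoothD oU sf sg) => // x _.
by rewrite lE kE; congr pair => /=; rewrite ?addr0 ?add0r.
Qed.

Lemma smooth_coord n (f : E -> 'rV[R]_n) k :
  smooth_on U f -> smooth_on U (fun z => f z 0 k).
Proof.
have [l lc lE] := coord_linear k => /(smooth_lin_comp oU lc).
by apply: smooth_congr.
Qed.

Lemma smooth_rV n (f : E -> 'rV[R]_n) :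
  (forall k, smooth_on U (fun z => f z 0 k)) -> smooth_on U f.
Proof.
move=> sf.
apply: (@smooth_congr _ _ _ _ (fun z => \sum_k f z 0 k *: delta_mx 0 k)) => //.
  by move=> x _; rewrite [RHS]row_sum_delta.
by apply: smooth_sum => // k; apply: smoothZ => //; exact: smooth_cst.
Qed.

Lemma smooth_det n (f : E -> 'M[R]_n) :
  (forall i j, smooth_on U (fun z => f z i j)) ->
  smooth_on U (fun z => \det (f z)).
Proof.
move=> sf; rewrite /determinant; apply: smooth_sum => // s.
by apply: smoothM => //; [exact: smooth_cst|exact: smooth_prod].
Qed.

(** Cramer's rule. *)
Lemma smooth_solve n (f : E -> 'M[R]_n) (g : E -> 'rV[R]_n) :
  (forall i j, smooth_on U (fun z => f z i j)) ->
  (forall z, U z -> f z \in unitmx) -> smooth_on U g ->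
  smooth_on U (fun z => g z *m invmx (f z)).
Proof.
move=> sf uf sg.
have sd := smooth_det sf.
have sV : smooth_on U (fun z => (\det (f z))^-1).
  by apply: smoothV => // z /uf; rewrite unitmxE unitfE.
apply: (@smooth_congr _ _ _ _
  (fun z => (\det (f z))^-1 *: (g z *m \adj (f z)))) => //.
  by move=> z /uf uz; rewrite /invmx uz -scalemxAr.
apply: smoothZ => //; apply: smooth_rV => k.
apply: (@smooth_congr _ _ _ _
  (fun z => \sum_j g z 0 j * cofactor (f z) k j)) => //.
  by move=> z _; rewrite !mxE; apply: eq_bigr => j _; rewrite mxE.
apply: smooth_sum => // j; apply: smoothM => //; first exact: smooth_coord.
rewrite /cofactor; apply: smoothM => //; first exact: smooth_cst.
apply: smooth_det => a b.
by apply: (smooth_congr oU _ (sf (lift k a) (lift j b))) => z _; rewrite !mxE.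
Qed.

Lemma open_unitmx n (f : E -> 'M[R]_n) x :
  (forall i j, smooth_on U (fun z => f z i j)) -> U x -> f x \in unitmx ->
  exists U', [/\ open U', U' x, U' `<=` U & forall z, U' z -> f z \in unitmx].
Proof.
move=> sf Ux; rewrite unitmxE unitfE => d0.
have dc := smooth_on_continuous (smooth_det sf) Ux.
have : nbhs x (U `&` [set z | \det (f z) != 0]).
  apply: filterI; first exact: open_nbhs_nbhs.
  by apply: (dc [set t | t != 0]); apply: open_nbhs_nbhs; split=> //; exact: open_neq.
rewrite nbhsE => -[U' [oU' U'x] sU].
by exists U'; split=> // z /sU[] // _; rewrite unitmxE unitfE.
Qed.

End Smooth.
End LinearMaps.

(** * Vector fields and brackets on a manifold *)

Lemma is_diff_along_field (R : realType) (E W : normedModType R) (U : set E)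
    (f : E -> W) (w dw : E -> E) x :
  findim E -> smooth_on U f -> U x -> is_diff x w dw ->
  is_diff x (fun z => 'd f z (w z))
    (fun v => 'd (fun t => 'd f t (w x)) x v + 'd f x (dw v)).
Proof.
by move=> fE sf Ux dwx; exact: (is_diff_along fE sf Ux (is_diff_id x) dwx).
Qed.

Lemma subrDD (V : zmodType) (a b c d : V) : c = d -> (c + a) - (d + b) = a - b.
Proof. by move=> ->; rewrite (addrC d a) addrKA. Qed.

Lemma findim_eq (R : realType) (E : normedModType R) (x y : E) : findim E ->
  (forall l : {linear E -> R}, l x = l y) -> x = y.
Proof.
move=> [n [e [l [_ lE]]]] H; rewrite (lE x) (lE y).
by apply: eq_bigr => k _; rewrite H.
Qed.

Section Atlas.
Variables (R : realType) (E : normedModType R) (P I : Type).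
Hypothesis findimE : findim E.
Variable S : atlas E P I.

Definition overlap i j : set E := coord S i @` (domain S i `&` domain S j).

Definition transition i j : E -> E := coord S j \o param S i.

Record smooth_atlas : Prop := SmoothAtlas {
  atlas_open_range : forall i, open (chart_range S i) ;
  atlas_open_overlap : forall i j, open (overlap i j) ;
  atlas_coordK : forall i p, domain S i p -> param S i (coord S i p) = p ;
  atlas_transition : forall i j, smooth_on (overlap i j) (transition i j) }.

Hypothesis hS : smooth_atlas.

Lemma param_range i z : chart_range S i z ->
  domain S i (param S i z) /\ coord S i (param S i z) = z.
Proof. by move=> [p Dp <-]; rewrite (atlas_coordK hS Dp). Qed.

Lemma overlapP i j z : overlap i j z <->
  chart_range S i z /\ domain S j (param S i z).
Proof.
split=> [[p [Di Dj] <-]|[[p Dp <-]]].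
  by rewrite (atlas_coordK hS Di); split => //; exists p.
by rewrite (atlas_coordK hS Dp) => Dj; exists p.
Qed.

Lemma near_overlap i j p : domain S i p -> domain S j p ->
  \forall z \near coord S i p, overlap i j z.
Proof.
move=> Di Dj; apply: open_nbhs_nbhs; split; first exact: atlas_open_overlap.
by exists p.
Qed.

Lemma mem_overlap i j p : domain S i p -> domain S j p ->
  overlap i j (coord S i p).
Proof. by move=> Di Dj; exists p. Qed.

Lemma transition_diff i j p : domain S i p -> domain S j p ->
  is_diff (coord S i p) (transition i j) ('d (transition i j) (coord S i p)).
Proof.
by move=> Di Dj; exact: smooth_is_diff (atlas_transition hS i j) (mem_overlap Di Dj).
Qed.

Lemma transition_coord i j p : domain S i p ->
  transition i j (coord S i p) = coord S j p.
Proof. by move=> Di; rewrite /transition /= (atlas_coordK hS Di). Qed.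

Lemma d_transition_id i p v : domain S i p ->
  'd (transition i i) (coord S i p) v = v.
Proof.
move=> Di.
have N : \forall z \near coord S i p, z = transition i i z.
  have := near_overlap Di Di; apply: filterS => z /overlapP[rz _].
  by rewrite /transition /= (param_range rz).2.
by rewrite (diff_val_at v (is_diff_near N (is_diff_id _))).
Qed.

Lemma d_transition_comp i j k p v :
  domain S i p -> domain S j p -> domain S k p ->
  'd (transition j k) (coord S j p) ('d (transition i j) (coord S i p) v)
  = 'd (transition i k) (coord S i p) v.
Proof.
move=> Di Dj Dk; apply/esym.
have D1 := transition_diff Di Dj; have D2 := transition_diff Dj Dk.
rewrite -(transition_coord j Di) in D2.
have N : \forall z \near coord S i p,
    transition j k (transition i j z) = transition i k z.
  have := near_overlap Di Dj; apply: filterS => z /overlapP[rz Dz].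
  by rewrite /transition /= (atlas_coordK hS Dz).
have := diff_val_at v (is_diff_near N (is_diff_chain D1 D2)).
by rewrite (transition_coord j Di).
Qed.

Lemma tangent_linear p a v w :
  tangent S p v -> tangent S p w -> tangent S p (a *: v + w).
Proof.
move=> [v0 vT] [w0 wT]; split=> [i Di|i j Di Dj].
  have -> : (a *: v + w) i = a *: v i + w i by [].
  by rewrite v0 // w0 // scaler0 addr0.
have E1 k : (a *: v + w) k = a *: v k + w k by [].
by rewrite !E1 (vT i j Di Dj) (wT i j Di Dj) linearP.
Qed.

Lemma tangent_eq i p v w : domain S i p ->
  tangent S p v -> tangent S p w -> v i = w i -> v = w.
Proof.
move=> Di [v0 vT] [w0 wT] vw; apply/funext => j.
have [Dj|Dj] := pselect (domain S j p); last by rewrite v0 ?w0.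
by rewrite (vT i j) // (wT i j) // vw.
Qed.

(** The tangent vector with component [a] in the chart [i]; the components in
    the other charts are then forced. *)
Definition extend_tangent i p (a : E) : I -> E := fun j =>
  if `[< domain S j p >] then 'd (transition i j) (coord S i p) a else 0.

Lemma extend_tangentP i p a : domain S i p ->
  tangent S p (extend_tangent i p a) /\ extend_tangent i p a i = a.
Proof.
move=> Di; split; last first.
  by rewrite /extend_tangent asboolT // d_transition_id.
split=> [j Dj|j k Dj Dk]; first by rewrite /extend_tangent asboolF.
by rewrite /extend_tangent !asboolT // d_transition_comp.
Qed.

Lemma jacobi_arith (a b c d e f x y z : E) :
  ((z + a) - (y + b) - (c - f)) + ((x + c) - (z + d) - (e - b))
  + ((y + e) - (x + f) - (a - d)) = 0.
Proof.
apply: (findim_eq findimE) => l; rewrite !(linearD l, linearN l) (linear0 l).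
ring.
Qed.

Section Sections.
Variables (F : normedModType R) (fib : P -> set (I -> F)).
Hypothesis fib_linear : forall p a v w, carrier S p ->
  fib p v -> fib p w -> fib p (a *: v + w).

Local Notation field := (smooth_section S fib).

Lemma domain_carrier i p : domain S i p -> carrier S p.
Proof. by exists i. Qed.

Lemma section_smooth i X : field X ->
  smooth_on (chart_range S i) (fun z => X (param S i z) i).
Proof. by move=> [_ +]; exact. Qed.

Lemma section_linear f X Y : smooth_fun S f -> field X -> field Y ->
  field (fun p => f p *: X p + Y p).
Proof.
move=> sf [X1 X2] [Y1 Y2]; split=> [p Sp|i].
  by apply: fib_linear => //; [exact: X1|exact: Y1].
have oi := atlas_open_range hS i.
by apply: smoothD => //; apply: smoothZ => //; exact: sf.
Qed.

Lemma smooth_fun_cst (c : R) : smooth_fun S (fun=> c).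
Proof. by move=> i; apply: smooth_cst; exact: atlas_open_range. Qed.

Lemma section_add X Y : field X -> field Y -> field (fun p => X p + Y p).
Proof.
move=> sX sY; have := section_linear (smooth_fun_cst 1) sX sY.
rewrite (_ : (fun p => 1 *: X p + Y p) = (fun p => X p + Y p)) //.
by apply/funext => p; rewrite scale1r.
Qed.

Lemma section_opp X : field X -> field (fun p => - X p).
Proof.
move=> sX.
have s0 := section_linear (smooth_fun_cst (-1)) sX sX.
have := section_linear (smooth_fun_cst 2%:R) s0 (section_linear (smooth_fun_cst (-2%:R)) sX sX).
rewrite (_ : (fun p => _) = (fun p => - X p)) //.
apply/funext => p; rewrite scaleN1r addNr scaler0 add0r scaleNr scaler_nat.
by rewrite mulr2n opprD -addrA addNr addr0.
Qed.

Lemma section_sub X Y : field X -> field Y -> field (fun p => X p - Y p).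
Proof. by move=> sX sY; exact: section_add sX (section_opp sY). Qed.

Lemma section_scale f X : smooth_fun S f -> field X ->
  field (fun p => f p *: X p).
Proof.
move=> sf sX; have := section_sub (section_linear sf sX sX) sX.
rewrite (_ : (fun p => _ - _) = (fun p => f p *: X p)) //.
by apply/funext => p; rewrite addrK.
Qed.

Lemma section_zero X : field X -> field (fun=> 0).
Proof.
move=> sX; have := section_sub sX sX.
rewrite (_ : (fun p => _ - _) = (fun=> 0)) //.
by apply/funext => p; rewrite subrr.
Qed.

Lemma section_sum (K : Type) (r : seq K) (c : K -> R) (X : K -> P -> I -> F) Y :
  field Y -> (forall k, field (X k)) ->
  field (fun p => \sum_(k <- r) c k *: X k p).
Proof.
move=> sY sX; elim: r => [|k r IH].
  rewrite (_ : (fun p => _) = (fun=> 0)); first exact: section_zero sY.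
  by apply/funext => p; rewrite big_nil.
rewrite (_ : (fun p => _) =
    (fun p => c k *: X k p + \sum_(k <- r) c k *: X k p)); last first.
  by apply/funext => p; rewrite big_cons.
exact: section_linear (smooth_fun_cst (c k)) (sX k) IH.
Qed.

Lemma section_congr X Y : (forall p, carrier S p -> X p = Y p) ->
  field X -> field Y.
Proof.
move=> XY [X1 X2]; split=> [p Sp|i]; first by rewrite -XY //; exact: X1.
apply: (smooth_congr (atlas_open_range hS i) _ (X2 i)) => z rz.
by rewrite XY //; exists i => //; exact: (param_range rz).1.
Qed.

End Sections.

Lemma smooth_funM f h : smooth_fun S f -> smooth_fun S h ->
  smooth_fun S (fun p => f p * h p).
Proof.
by move=> sf sh i; apply: smoothM; [exact: atlas_open_range|exact: sf|exact: sh].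
Qed.

Lemma smooth_funD f h : smooth_fun S f -> smooth_fun S h ->
  smooth_fun S (fun p => f p + h p).
Proof.
by move=> sf sh i; apply: smoothD; [exact: atlas_open_range|exact: sf|exact: sh].
Qed.

Lemma smooth_funV f : (forall p, carrier S p -> f p != 0) -> smooth_fun S f ->
  smooth_fun S (fun p => (f p)^-1).
Proof.
move=> f0 sf i; apply: smoothV; [exact: atlas_open_range| |exact: sf].
by move=> z rz; apply: f0; exists i => //; exact: (param_range rz).1.
Qed.

Definition rep i (F : Type) (X : P -> I -> F) : E -> F := fun z => X (param S i z) i.

Lemma range_coord i p : domain S i p -> chart_range S i (coord S i p).
Proof. by exists p. Qed.

Lemma rep_is_diff i X p : vfield S X -> domain S i p ->
  is_diff (coord S i p) (rep i X) ('d (rep i X) (coord S i p)).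
Proof.
by move=> [_ sX] Di; exact: smooth_is_diff (sX i) (range_coord Di).
Qed.

Definition drep i (F : normedModType R) (X : P -> I -> F) p (v : E) : F :=
  'd (rep i X) (coord S i p) v.

Definition hrep i (F : normedModType R) (X : P -> I -> F) p (w v : E) : F :=
  'd (fun z => 'd (rep i X) z w) (coord S i p) v.

Lemma drepB i (F : normedModType R) (X : P -> I -> F) p v w :
  drep i X p (v - w) = drep i X p v - drep i X p w.
Proof. exact: linearB. Qed.

Lemma hrepC i X p v w : vfield S X -> domain S i p ->
  hrep i X p v w = hrep i X p w v.
Proof.
move=> sX Di.
exact: (Schwarz v w findimE (atlas_open_range hS i) (range_coord Di) (sX.2 i)).
Qed.

Lemma lieE i X Y p : domain S i p ->
  lie S X Y p i = drep i Y p (X p i) - drep i X p (Y p i).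
Proof. by move=> Di; rewrite /lie asboolT. Qed.

Lemma rep_transition i j X p : vfield S X -> domain S i p -> domain S j p ->
  \forall z \near coord S i p,
    rep j X (transition i j z) = 'd (transition i j) z (rep i X z).
Proof.
move=> [tX _] Di Dj.
have := near_overlap Di Dj; apply: filterS => z /overlapP[rz Dz].
have [Dzi cz] := param_range rz.
rewrite /rep /transition /= (atlas_coordK hS Dz).
have [_ T] := tX _ (domain_carrier Dz).
by rewrite (T i j Dzi Dz) cz.
Qed.

Lemma rep_coord i (F : Type) (X : P -> I -> F) p : domain S i p ->
  rep i X (coord S i p) = X p i.
Proof. by move=> Di; rewrite /rep (atlas_coordK hS Di). Qed.

(** Differentiating the transformation law of the components of [X] produces
    a second derivative of the transition map next to the expected term. *)
Lemma drep_transition i j X v p : vfield S X ->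
  domain S i p -> domain S j p ->
  drep j X p ('d (transition i j) (coord S i p) v) =
  'd (fun z => 'd (transition i j) z (X p i)) (coord S i p) v
  + 'd (transition i j) (coord S i p) (drep i X p v).
Proof.
move=> sX Di Dj.
have D1 := transition_diff Di Dj.
have D2 : is_diff (transition i j (coord S i p)) (rep j X) (drep j X p).
  by rewrite (transition_coord j Di); exact: rep_is_diff.
have D12 := is_diff_chain D1 D2.
have D3 := is_diff_along_field findimE (atlas_transition hS i j)
  (mem_overlap Di Dj) (rep_is_diff sX Di).
have <- := diff_val_at v (is_diff_near (rep_transition sX Di Dj) D12).
by apply: etrans (diff_val_at v D3) _; rewrite (rep_coord X Di).
Qed.

(** In the transformation law of the bracket the second derivatives of the
    transition map cancel by symmetry. *)
Lemma lie_vfield X Y : vfield S X -> vfield S Y -> vfield S (lie S X Y).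
Proof.
move=> sX sY; split=> [p [k _ Dk]|i]; first split=> [i Di|i j Di Dj].
- by rewrite /lie asboolF.
- rewrite !lieE //.
  have [_ TX] := sX.1 p (domain_carrier Di).
  have [_ TY] := sY.1 p (domain_carrier Di).
  rewrite (TX i j Di Dj) (TY i j Di Dj) linearB.
  have EX := drep_transition (Y p i) sX Di Dj.
  have EY := drep_transition (X p i) sY Di Dj.
  have C := Schwarz (X p i) (Y p i) findimE (atlas_open_overlap hS i j)
     (mem_overlap Di Dj) (atlas_transition hS i j).
  apply: etrans (congr2 (fun a b => a - b) EY EX) _.
  exact: subrDD (esym C).
have oi := atlas_open_range hS i.
have sXi := section_smooth i sX; have sYi := section_smooth i sY.
apply: (@smooth_congr _ _ _ _ (fun z => 'd (rep i Y) z (rep i X z)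
  - 'd (rep i X) z (rep i Y z))) => //.
  move=> z rz; have [Dz cz] := param_range rz.
  by rewrite lieE // /drep cz.
apply: smoothB => //.
  exact: (smooth_diff_along findimE oi (fun=> id) sYi (smooth_id oi) sXi).
exact: (smooth_diff_along findimE oi (fun=> id) sXi (smooth_id oi) sYi).
Qed.

Lemma rep_lie i X Y z : chart_range S i z -> rep i (lie S X Y) z =
  'd (rep i Y) z (rep i X z) - 'd (rep i X) z (rep i Y z).
Proof.
by move=> rz; have [Dz cz] := param_range rz; rewrite /rep lieE // /drep cz.
Qed.

Lemma near_range i p : domain S i p ->
  \forall z \near coord S i p, chart_range S i z.
Proof.
move=> Di; apply: open_nbhs_nbhs; split; last exact: range_coord.
exact: atlas_open_range.
Qed.

Lemma drep_lie i X Y p v : vfield S X -> vfield S Y -> domain S i p ->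
  drep i (lie S X Y) p v =
  (hrep i Y p (X p i) v + drep i Y p (drep i X p v))
  - (hrep i X p (Y p i) v + drep i X p (drep i Y p v)).
Proof.
move=> sX sY Di; have rp := range_coord Di.
have D1 := is_diff_along_field findimE (sY.2 i) rp (rep_is_diff sX Di).
have D2 := is_diff_along_field findimE (sX.2 i) rp (rep_is_diff sY Di).
have N : \forall z \near coord S i p, 'd (rep i Y) z (rep i X z)
  - 'd (rep i X) z (rep i Y z) = rep i (lie S X Y) z.
  by have := near_range Di; apply: filterS => z rz; rewrite rep_lie.
apply: etrans (diff_val_at v (is_diff_near N (is_diffB D1 D2))) _.
by rewrite /hrep -(rep_coord X Di) -(rep_coord Y Di).
Qed.

(** Expanding the brackets in a chart, all terms cancel in pairs once the
    second derivatives of the components are known to be symmetric. *)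
Lemma Jacobi X Y Z p : vfield S X -> vfield S Y -> vfield S Z -> carrier S p ->
  lie S X (lie S Y Z) p + lie S Y (lie S Z X) p + lie S Z (lie S X Y) p = 0.
Proof.
move=> sX sY sZ Sp; apply/funext => i.
have [Di|Di] := pselect (domain S i p); last first.
  by rewrite !fctE /lie !asboolF // !addr0.
rewrite !fctE !lieE // !drep_lie // !drepB.
rewrite (hrepC (X p i) (Y p i) sZ Di) (hrepC (Y p i) (Z p i) sX Di).
rewrite (hrepC (Z p i) (X p i) sY Di).
exact: jacobi_arith.
Qed.

(** The second derivatives of [f] cancel by symmetry, and what remains is the
    derivative of [f] along the bracket. *)
Lemma along_bracket f X Y i p : smooth_fun S f -> vfield S X -> vfield S Y ->
  domain S i p ->
  'd (fun z => 'd (f \o param S i) z (rep i Y z)) (coord S i p) (X p i)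
  - 'd (fun z => 'd (f \o param S i) z (rep i X z)) (coord S i p) (Y p i)
  = along S i p (lie S X Y p) f.
Proof.
move=> sf sX sY Di; have rp := range_coord Di.
have D1 := is_diff_along_field findimE (sf i) rp (rep_is_diff sX Di).
have D2 := is_diff_along_field findimE (sf i) rp (rep_is_diff sY Di).
have C := Schwarz_real (X p i) (Y p i) (atlas_open_range hS i) rp (sf i).
apply: etrans (congr2 (fun a b => a - b)
  (diff_val_at (X p i) D2) (diff_val_at (Y p i) D1)) _.
rewrite (rep_coord X Di) (rep_coord Y Di).
apply: etrans (@subrDD R _ _ _ _ (esym C)) _.
by rewrite /along lieE //; exact: esym (linearB _ _ _).
Qed.

End Atlas.

(** * The slit tangent bundle *)

Lemma open_neq0 (R : realType) (V : normedModType R) : open [set y : V | y != 0].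
Proof.
have -> : [set y : V | y != 0] = ~` [set 0].
  by apply/seteqP; split=> y /=; [move/eqP|move=> ?; apply/eqP].
apply/closed_openC/accessible_closed_set1/hausdorff_accessible.
exact: norm_hausdorff.
Qed.

Section SlitTangent.
Variables (R : realType) (n : nat) (M : topologicalType) (I : Type).
Variable A : atlas 'rV[R]_n M I.
Hypothesis hM : smooth_manifold A.

Local Notation V := 'rV[R]_n.
Local Notation TM := (M * (I -> V))%type.
Local Notation TM0 := (slit_tangent A).

Lemma base_atlas : smooth_atlas A.
Proof.
have cK := manifold_coordK hM; have oR := manifold_open_range hM.
split => // [i j|]; last exact: (manifold_transition hM).
rewrite openE => z [p [Di Dj] <-].
have rp : chart_range A i (coord A i p) by exists p.
have pc := manifold_param_cont hM rp.
have : nbhs (coord A i p) (chart_range A i `&` (param A i @^-1` domain A j)).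
  apply: filterI; first exact: open_nbhs_nbhs.
  apply: pc; apply: open_nbhs_nbhs; split; last by rewrite cK.
  exact: manifold_open_domain.
by apply: filterS => y [[q Dq <-]]; rewrite /preimage /= cK // => Dqj; exists q.
Qed.

Local Notation bA := base_atlas.
Let fV : findim V := findim_rV R n.

Lemma slit_coordK i u : domain TM0 i u -> param TM0 i (coord TM0 i u) = u.
Proof.
case: u => p v [/= Dp [v0 vT] _]; rewrite /= (atlas_coordK bA Dp).
congr pair; apply/funext => j.
have [Dj|Dj] := pselect (domain A j p); last by rewrite asboolF // v0.
by rewrite asboolT // (vT i j Dp Dj).
Qed.

Lemma slit_neq0 i u : domain TM0 i u -> u.2 i != 0.
Proof.
move=> [Dp vT v0]; apply: contra_neq v0 => vi.
have z : tangent A u.1 0.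
  split=> // j k Dj Dk; rewrite [LHS]/(0 : V).
  by rewrite -[(0 : I -> V) j]/(0 : V) linear0.
by apply: (tangent_eq Dp vT z).
Qed.

Lemma slit_range i z :
  chart_range TM0 i z <-> chart_range A i z.1 /\ z.2 != 0.
Proof.
split=> [[u Du <-] /=|[[p Dp pz] z0]].
  by split; [exists u.1; case: Du|exact: slit_neq0 Du].
exists (p, extend_tangent A i p z.2); last first.
  rewrite /= pz (extend_tangentP bA z.2 Dp).2.
  by case: (z).
have [eT eE] := extend_tangentP bA z.2 Dp.
by split => //; apply: contra_neq z0 => /= e0; rewrite -eE e0.
Qed.

Lemma slit_overlap i j z :
  overlap TM0 i j z <-> overlap A i j z.1 /\ z.2 != 0.
Proof.
split=> [[u [Di Dj] <-] /=|[[p [Dp Dj] pz] z0]].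
  split; last exact: slit_neq0 Di.
  by exists u.1 => //; split; [case: Di|case: Dj].
exists (p, extend_tangent A i p z.2); last first.
  rewrite /= pz (extend_tangentP bA z.2 Dp).2.
  by case: (z).
have [eT eE] := extend_tangentP bA z.2 Dp.
by split; split => //; apply: contra_neq z0 => /= e0; rewrite -eE e0.
Qed.

Lemma open_slit (U : set V) : open U ->
  open [set z : V * V | U z.1 /\ z.2 != 0].
Proof.
move=> oU; apply: openI.
  by apply: (@open_comp _ _ fst) oU => z _; exact: cvg_fst.
by apply: (@open_comp _ _ snd) (open_neq0 V) => z _; exact: cvg_snd.
Qed.

Lemma slit_transitionE i j z : overlap TM0 i j z ->
  transition TM0 i j z = (transition A i j z.1, 'd (transition A i j) (z.1) (z.2)).
Proof.
by move/slit_overlap => [/overlapP -/(_ bA) [rz Dz] z0]; rewrite /transition /= asboolT.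
Qed.

Lemma slit_open_overlap i j : open (overlap TM0 i j).
Proof.
have -> : overlap TM0 i j = [set z : V * V | overlap A i j z.1 /\ z.2 != 0].
  by apply/seteqP; split=> z /slit_overlap.
exact/open_slit/(atlas_open_overlap bA).
Qed.

(** The transition maps [(x, y) |-> (t(x), dt_x(y))] are smooth because those
    of the base are, [dt_x(y)] being jointly smooth in [x] and [y]. *)
Lemma slit_atlas : smooth_atlas TM0.
Proof.
split=> [i|i j|i p|i j].
- have -> : chart_range TM0 i = [set z : V * V | chart_range A i z.1 /\ z.2 != 0].
    by apply/seteqP; split=> z /slit_range.
  exact/open_slit/(atlas_open_range bA).
- exact: slit_open_overlap.
- exact: slit_coordK.
have oU := slit_open_overlap (i := i) (j := j).
have sT := atlas_transition bA i j.
have sid := smooth_id oU.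
have s1 : smooth_on (overlap TM0 i j) (fun z : V * V => z.1) by exact: smooth_fst.
have s2 : smooth_on (overlap TM0 i j) (fun z : V * V => z.2) by exact: smooth_snd.
have m1 (z : V * V) : overlap TM0 i j z -> overlap A i j z.1.
  by move/slit_overlap => [].
apply: (smooth_congr oU (fun z Uz => esym (slit_transitionE Uz))).
apply: smooth_pair => //; first exact: smooth_comp fV oU m1 s1 sT.
exact: smooth_diff_along fV oU m1 sT s1 s2.
Qed.

Local Notation sA := slit_atlas.

Lemma slit_domain i u : carrier TM0 u -> domain TM0 i u <-> domain A i u.1.
Proof. by move=> [j _ [Dj uT u0]]; split=> [[]|Di]. Qed.

(** The second derivative of the base transition only affects the fibre
    component: it is the reason why [rho] and [gamma] make sense whereas the
    fibre component of a vector does not. *)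
Lemma d_slit_transition i j u a b : domain TM0 i u -> domain TM0 j u ->
  'd (transition TM0 i j) (coord TM0 i u) (a, b) =
  ('d (transition A i j) (coord A i u.1) a,
   'd (fun t => 'd (transition A i j) t (u.2 i)) (coord A i u.1) a
   + 'd (transition A i j) (coord A i u.1) b).
Proof.
move=> Di Dj.
have [Di1 _ _] := Di; have [Dj1 _ _] := Dj.
have N : \forall z \near coord TM0 i u,
  (transition A i j z.1, 'd (transition A i j) (z.1) (z.2)) = transition TM0 i j z.
  have := near_overlap sA Di Dj; apply: filterS => z Uz.
  by rewrite slit_transitionE.
have D1 := is_diff_chain (is_diff_fst (coord TM0 i u)) (transition_diff bA Di1 Dj1).
have D2 := is_diff_along fV (atlas_transition bA i j)
  (mem_overlap Di1 Dj1 : overlap A i j (coord TM0 i u).1)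
  (is_diff_fst _) (is_diff_snd _).
exact: (diff_val_at (a, b) (is_diff_near N (is_diff_pair D1 D2))).
Qed.

Lemma d_slit_vertical i j u b : domain TM0 i u -> domain TM0 j u ->
  'd (transition TM0 i j) (coord TM0 i u) (0, b) =
  (0, 'd (transition A i j) (coord A i u.1) b).
Proof.
move=> Di Dj; apply: etrans (d_slit_transition 0 b Di Dj) _.
apply: (congr2 pair); first exact: linear0.
apply: etrans (add0r _); apply: (congr2 (fun x y => x + y)) => //.
exact: linear0.
Qed.

Lemma rho_tangent u w : carrier TM0 u -> tangent TM0 u w ->
  tangent A u.1 (rho w).
Proof.
move=> Cu [w0 wT]; split=> [i Di|i j Di Dj].
  by rewrite /rho w0 // => /(slit_domain i Cu).
have Di' := (slit_domain i Cu).2 Di; have Dj' := (slit_domain j Cu).2 Dj.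
rewrite /rho (wT i j Di' Dj') [w i]surjective_pairing.
by rewrite (d_slit_transition _ _ Di' Dj').
Qed.

Lemma gamma_tangent u v : carrier TM0 u -> tangent A u.1 v ->
  tangent TM0 u (gamma v).
Proof.
move=> Cu [v0 vT]; split=> [i Di|i j Di Dj].
  by rewrite /gamma v0 // => /(slit_domain i Cu).
have Di' := (slit_domain i Cu).1 Di; have Dj' := (slit_domain j Cu).1 Dj.
by rewrite /gamma (vT i j Di' Dj') (d_slit_vertical _ Di Dj).
Qed.

Lemma vertical_gamma u w : carrier TM0 u -> tangent TM0 u w -> rho w = 0 ->
  exists2 v, tangent A u.1 v & w = gamma v.
Proof.
move=> Cu [w0 wT] rw; exists (fun i => (w i).2); last first.
  apply/funext => i; rewrite /gamma [LHS]surjective_pairing.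
  by have -> : (w i).1 = 0 by exact: (congr1 (fun h => h i) rw).
split=> [i Di|i j Di Dj].
  by rewrite w0 // => /(slit_domain i Cu).
have Di' := (slit_domain i Cu).2 Di; have Dj' := (slit_domain j Cu).2 Dj.
have w1 : (w i).1 = 0 by exact: (congr1 (fun h => h i) rw).
rewrite (wT i j Di' Dj') {1}[w i]surjective_pairing w1.
by rewrite (d_slit_vertical _ Di' Dj').
Qed.

Lemma rho_field_pi X : vfield TM0 X -> pi_vfield A (rho_field X).
Proof.
move=> [X1 X2]; split=> [u Cu|i]; first exact: rho_tangent (X1 u Cu).
by apply: smooth_fst => //; exact: (atlas_open_range sA).
Qed.

Lemma gamma_field_vfield X : pi_vfield A X -> vfield TM0 (gamma_field X).
Proof.
move=> [X1 X2]; split=> [u Cu|i]; first exact: gamma_tangent (X1 u Cu).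
have oi := atlas_open_range sA i.
by apply: smooth_pair => //; exact: smooth_cst.
Qed.

(** A field killed by [rho] has components [(0, b)], which transform as those
    of a section of the pullback bundle. *)
Lemma vertical_field X : vfield TM0 X ->
  (forall u, carrier TM0 u -> rho (X u) = 0) ->
  exists2 Y, pi_vfield A Y & forall u, carrier TM0 u -> X u = gamma_field Y u.
Proof.
move=> [X1 X2] rX.
have XE u : carrier TM0 u -> X u = gamma (fun i => (X u i).2).
  move=> Cu; apply/funext => i; rewrite /gamma [LHS]surjective_pairing.
  by have -> : (X u i).1 = 0 by exact: (congr1 (fun h => h i) (rX u Cu)).
exists (fun u i => (X u i).2) => //; split=> [u Cu|i].
  have [v vT] := vertical_gamma Cu (X1 u Cu) (rX u Cu).
  by rewrite (XE u Cu) => E; rewrite (_ : (fun i => _) = v) // E.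
by apply: smooth_snd => //; exact: (atlas_open_range sA).
Qed.

Lemma eta_pi : pi_vfield A (@eta R n M I).
Proof.
split=> [u [i _ [_ uT _]] //|i].
have oi := atlas_open_range sA i.
have s2 := smooth_snd oi (smooth_id oi).
apply: (smooth_congr oi _ s2) => z rz.
have [Dz cz] := param_range sA rz.
by rewrite -[in LHS]cz.
Qed.

End SlitTangent.

(** * Regular connections and their horizontal maps *)

Section Connections.
Variables (R : realType) (n : nat) (M : topologicalType) (I : Type).
Variable A : atlas 'rV[R]_n M I.
Hypothesis hM : smooth_manifold A.

Local Notation V := 'rV[R]_n.
Local Notation TM := (M * (I -> V))%type.
Local Notation TM0 := (slit_tangent A).
Local Notation sA := (slit_atlas hM).
Local Notation bA := (base_atlas hM).

Let fib_pi (p : TM) (a : R) (v w : I -> V) : carrier TM0 p ->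
  tangent A p.1 v -> tangent A p.1 w -> tangent A p.1 (a *: v + w).
Proof. by move=> _; exact: tangent_linear. Qed.

Let fib_vf (p : TM) (a : R) (v w : I -> V * V) : carrier TM0 p ->
  tangent TM0 p v -> tangent TM0 p w -> tangent TM0 p (a *: v + w).
Proof. by move=> _; exact: tangent_linear. Qed.

Lemma pi_add X Y : pi_vfield A X -> pi_vfield A Y ->
  pi_vfield A (fun u => X u + Y u).
Proof. by move=> sX sY; have := section_add sA fib_pi sX sY. Qed.

Lemma pi_sub X Y : pi_vfield A X -> pi_vfield A Y ->
  pi_vfield A (fun u => X u - Y u).
Proof. by move=> sX sY; have := section_sub sA fib_pi sX sY. Qed.

Lemma pi_scale f X : smooth_fun TM0 f -> pi_vfield A X ->
  pi_vfield A (fun u => f u *: X u).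
Proof. by move=> sf sX; have := section_scale sA fib_pi sf sX. Qed.

Lemma pi_congr X Y : (forall u, carrier TM0 u -> X u = Y u) ->
  pi_vfield A X -> pi_vfield A Y.
Proof. by move=> XY sX; have := section_congr sA XY sX. Qed.

Lemma vfield_add X Y : vfield TM0 X -> vfield TM0 Y ->
  vfield TM0 (fun u => X u + Y u).
Proof. by move=> sX sY; have := section_add sA fib_vf sX sY. Qed.

Lemma vfield_sub X Y : vfield TM0 X -> vfield TM0 Y ->
  vfield TM0 (fun u => X u - Y u).
Proof. by move=> sX sY; have := section_sub sA fib_vf sX sY. Qed.

Lemma vfield_scale f X : smooth_fun TM0 f -> vfield TM0 X ->
  vfield TM0 (fun u => f u *: X u).
Proof. by move=> sf sX; have := section_scale sA fib_vf sf sX. Qed.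

Lemma vfield_sum (K : Type) (r : seq K) (c : K -> R) (X : K -> TM -> I -> V * V) Y :
  vfield TM0 Y -> (forall k, vfield TM0 (X k)) ->
  vfield TM0 (fun u => \sum_(k <- r) c k *: X k u).
Proof. by move=> sY sX; have := section_sum sA fib_vf r c sY sX. Qed.

Lemma vfield_congr X Y : (forall u, carrier TM0 u -> X u = Y u) ->
  vfield TM0 X -> vfield TM0 Y.
Proof. by move=> XY sX; have := section_congr sA XY sX. Qed.

Lemma pi_zero : pi_vfield A (fun=> 0).
Proof. have := section_zero sA fib_pi (eta_pi hM). exact. Qed.

Lemma vfield_zero : vfield TM0 (fun=> 0).
Proof. have := section_zero sA fib_vf (gamma_field_vfield hM pi_zero). exact. Qed.

(** Smoothness only concerns the slit tangent bundle, on which this function is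
    0; it is 1 elsewhere, so that multiplying a field by it keeps the values
    there. *)
Definition off_carrier (u : TM) : R := if `[< carrier TM0 u >] then 0 else 1.

Lemma off_carrier_smooth : smooth_fun TM0 off_carrier.
Proof.
move=> i; have oi := atlas_open_range sA i.
apply: (smooth_congr oi _ (smooth_cst (0 : R) oi)) => z rz /=.
by rewrite /off_carrier asboolT //; exists i => //; exact: (param_range sA rz).1.
Qed.

Lemma tangent_zero_chart i (u : TM) (v : I -> V) : domain A i u.1 ->
  tangent A u.1 v -> v i = 0 -> v = 0.
Proof.
move=> Di vT vi; have z : tangent A u.1 0.
  have := tangent_linear (-1) vT vT.
  by rewrite scaleN1r addNr.
exact: (tangent_eq Di vT z).
Qed.

Variable D : (TM -> I -> V * V) -> (TM -> I -> V) -> (TM -> I -> V).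
Hypothesis hD : linear_connection A D.

(** Fields are functions on a larger set than the slit tangent bundle, and the
    axioms of a connection do not say that the values elsewhere are irrelevant.
    Yet scaling by [off_carrier] does not change a field that vanishes on the
    slit tangent bundle, whereas it makes the derivative 0. *)
Lemma connection_zerol X Y u : vfield TM0 X -> pi_vfield A Y -> carrier TM0 u ->
  (forall a, carrier TM0 a -> X a = 0) -> D X Y u = 0.
Proof.
move=> sX sY Cu X0.
have := connection_scalel hD off_carrier_smooth sX sY Cu.
rewrite (_ : (fun a => off_carrier a *: X a) = X); last first.
  apply/funext => a; rewrite /off_carrier; case: asboolP => Ca.
    by rewrite scale0r X0.
  by rewrite scale1r.
by rewrite /off_carrier asboolT // scale0r.
Qed.

Lemma connection_congrl X X' Y u : vfield TM0 X -> vfield TM0 X' ->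
  pi_vfield A Y -> carrier TM0 u ->
  (forall a, carrier TM0 a -> X a = X' a) -> D X Y u = D X' Y u.
Proof.
move=> sX sX' sY Cu XX'.
have sB := vfield_sub sX sX'.
have -> : X = (fun a => (X a - X' a) + X' a).
  by apply/funext => a; rewrite subrK.
rewrite (connection_addl hD sB sX' sY Cu) connection_zerol // ?add0r // => a Ca.
by rewrite XX' // subrr.
Qed.

Lemma connection_zeror X Y u : vfield TM0 X -> pi_vfield A Y -> carrier TM0 u ->
  (forall a, carrier TM0 a -> Y a = 0) -> D X Y u = 0.
Proof.
move=> sX sY Cu Y0; have [i _ Di] := Cu.
have := connection_leibniz hD off_carrier_smooth sX sY Di.
rewrite (_ : (fun a => off_carrier a *: Y a) = Y); last first.
  apply/funext => a; rewrite /off_carrier; case: asboolP => Ca.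
    by rewrite scale0r Y0.
  by rewrite scale1r.
by rewrite Y0 // scaler0 add0r /off_carrier asboolT // scale0r.
Qed.

Lemma connection_congrr X Y Y' u : vfield TM0 X -> pi_vfield A Y ->
  pi_vfield A Y' -> carrier TM0 u ->
  (forall a, carrier TM0 a -> Y a = Y' a) -> D X Y u = D X Y' u.
Proof.
move=> sX sY sY' Cu YY'.
have sB := pi_sub sY sY'.
have -> : Y = (fun a => (Y a - Y' a) + Y' a).
  by apply/funext => a; rewrite subrK.
rewrite (connection_addr hD sX sB sY' Cu) connection_zeror // ?add0r // => a Ca.
by rewrite YY' // subrr.
Qed.

Lemma connection_subl X X' Y u : vfield TM0 X -> vfield TM0 X' ->
  pi_vfield A Y -> carrier TM0 u ->
  D (fun a => X a - X' a) Y u = D X Y u - D X' Y u.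
Proof.
move=> sX sX' sY Cu; have sB := vfield_sub sX sX'.
apply/eqP; rewrite eq_sym subr_eq -(connection_addl hD sB sX' sY Cu).
by apply/eqP; congr (D _ Y u); apply/funext => a; rewrite subrK.
Qed.

Lemma connection_subr X Y Y' u : vfield TM0 X -> pi_vfield A Y ->
  pi_vfield A Y' -> carrier TM0 u ->
  D X (fun a => Y a - Y' a) u = D X Y u - D X Y' u.
Proof.
move=> sX sY sY' Cu; have sB := pi_sub sY sY'.
apply/eqP; rewrite eq_sym subr_eq -(connection_addr hD sX sB sY' Cu).
by apply/eqP; congr (D X _ u); apply/funext => a; rewrite subrK.
Qed.

Lemma connection_suml (K : Type) (r : seq K) (c : K -> R)
    (X : K -> TM -> I -> V * V) Y u :
  (forall k, vfield TM0 (X k)) -> pi_vfield A Y -> carrier TM0 u ->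
  D (fun a => \sum_(k <- r) c k *: X k a) Y u
  = \sum_(k <- r) c k *: D (X k) Y u.
Proof.
move=> sX sY Cu; elim: r => [|k r IH].
  rewrite big_nil; apply: connection_zerol => // [|a _]; last exact: big_nil.
  exact: (vfield_sum [::] c vfield_zero sX).
rewrite big_cons -IH.
have sc := smooth_fun_cst sA (c k).
rewrite -(connection_scalel hD sc (sX k) sY Cu).
rewrite -(connection_addl hD _ _ sY Cu).
- by congr (D _ Y u); apply/funext => a; rewrite big_cons.
- exact: vfield_scale.
- exact: (vfield_sum r c vfield_zero sX).
Qed.

Section Regular.
Hypothesis hR : regular_connection A D.

Let sE := eta_pi hM.

Lemma kernel_vertical X u : vfield TM0 X -> carrier TM0 u ->
  rho (X u) = 0 -> D X (@eta R n M I) u = 0 -> X u = 0.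
Proof.
move=> sX Cu rX DX; have [_ H] := hR Cu.
apply: (H (X u)); split; first by split => //; exact: sX.1.
by exists X.
Qed.

(** Regularity provides horizontal fields through every vector, hence all the
    global fields that one would otherwise get from bump functions. *)
Lemma horizontal_extension u a : carrier TM0 u -> tangent A u.1 a ->
  exists X, [/\ vfield TM0 X, rho (X u) = a & D X (@eta R n M I) u = 0].
Proof.
move=> Cu aT; have [i _ Di] := Cu; have [Di1 _ _] := Di.
pose w := extend_tangent TM0 i u (a i, 0).
have [wT wi] := extend_tangentP sA (a i, 0) Di.
have rw : rho w = a.
  by apply: (tangent_eq Di1 (rho_tangent hM Cu wT) aT); rewrite /rho wi.
have [H _] := hR Cu.
have [v [h [[vT rv] [X [sX Xu DX]] wE]]] := H w wT.
exists X; split => //; rewrite Xu -rw wE; apply/funext => k.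
have vk : (v k).1 = 0 by exact: (congr1 (fun f => f k) rv).
have E : rho (v + h) k = (v k).1 + (h k).1 by [].
by rewrite E vk add0r.
Qed.

Lemma pi_extension u a : carrier TM0 u -> tangent A u.1 a ->
  exists2 X, pi_vfield A X & X u = a.
Proof.
move=> Cu aT; have [X [sX rX _]] := horizontal_extension Cu aT.
by exists (rho_field X) => //; exact: rho_field_pi.
Qed.

(** The fields [H_k] are horizontal at [u] only; [rho H_k] is a frame near [u]
    whose derivatives [D_(H_k) eta], which vanish at [u], measure how much the
    [H_k] have to be corrected at nearby points. *)
Lemma horizontal_frame i u : domain TM0 i u ->
  exists H : 'I_n -> TM -> I -> V * V, forall k,
    [/\ vfield TM0 (H k), rho (H k u) i = delta_mx 0 k &
        D (H k) (@eta R n M I) u = 0].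
Proof.
move=> Di; have [Di1 _ _] := Di.
have /choice[H HP] : forall k, exists X, [/\ vfield TM0 X,
    rho (X u) i = delta_mx 0 k & D X (@eta R n M I) u = 0].
  move=> k; have [eT eE] := extend_tangentP bA (delta_mx 0 k : V) Di1.
  have [X [sX rX DX]] := horizontal_extension (domain_carrier Di) eT.
  by exists X; split => //; rewrite rX.
by exists H.
Qed.

Section Frame.
Variables (i : I) (u : TM) (H : 'I_n -> TM -> I -> V * V).
Hypothesis Di : domain TM0 i u.
Hypothesis HP : forall k,
    [/\ vfield TM0 (H k), rho (H k u) i = delta_mx 0 k &
        D (H k) (@eta R n M I) u = 0].

Let sH k : vfield TM0 (H k). Proof. by have [] := HP k. Qed.

Definition base_frame k := rho_field (H k).
(** By regularity the connection map is injective on vertical vectors, so that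
    these fields also form a frame near [u]. *)
Definition fibre_frame k := D (gamma_field (base_frame k)) (@eta R n M I).

Lemma base_frame_pi k : pi_vfield A (base_frame k).
Proof. exact: rho_field_pi. Qed.

Lemma fibre_frame_pi k : pi_vfield A (fibre_frame k).
Proof.
by apply: (connection_section hD) => //; apply: gamma_field_vfield => //; exact: base_frame_pi.
Qed.

Definition frame_mx (e : 'I_n -> TM -> I -> V) (z : V * V) : 'M[R]_n :=
  \matrix_k rep TM0 i (e k) z.

Lemma mul_frame_mx e z (c : V) :
  c *m frame_mx e z = \sum_k c 0 k *: rep TM0 i (e k) z.
Proof. by rewrite mulmx_sum_row; apply: eq_bigr => k _; rewrite rowK. Qed.

Lemma base_frame_coord (c : V) :
  \sum_k c 0 k *: base_frame k u i = c.
Proof.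
rewrite [RHS]row_sum_delta; apply: eq_bigr => k _.
by have [_ + _] := HP k => <-.
Qed.

Lemma sum_family (F : normedModType R) (e : 'I_n -> I -> F) (c : 'I_n -> R) j :
  (\sum_k c k *: e k) j = \sum_k c k *: e k j.
Proof. by rewrite fct_sumE; apply: eq_bigr. Qed.

Definition vertical_combination (c : V) : TM -> I -> V * V :=
  fun a => \sum_k c 0 k *: gamma_field (base_frame k) a.

Lemma vertical_combination_vfield c : vfield TM0 (vertical_combination c).
Proof.
apply: (vfield_sum _ (fun k => c 0 k) vfield_zero) => k.
by apply: gamma_field_vfield => //; exact: base_frame_pi.
Qed.

Lemma connection_vertical_combination c a : carrier TM0 a ->
  D (vertical_combination c) (@eta R n M I) a = \sum_k c 0 k *: fibre_frame k a.
Proof.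
move=> Ca; apply: connection_suml => // k.
by apply: gamma_field_vfield => //; exact: base_frame_pi.
Qed.

Lemma vertical_combination_inj c :
  D (vertical_combination c) (@eta R n M I) u = 0 \/
  vertical_combination c u = 0 -> c = 0.
Proof.
have Cu := domain_carrier Di.
suff H0 : vertical_combination c u = 0 -> c = 0.
  case=> // D0; apply: H0; apply: kernel_vertical => //.
    exact: vertical_combination_vfield.
  apply/funext => j; rewrite /rho /vertical_combination sum_family.
  rewrite (big_morph fst (id1 := 0) (op1 := fun x y => x + y)) // big1 // => k _.
  by rewrite /= scaler0.
move=> v0; rewrite -(base_frame_coord c).
have := congr1 (fun f => (f i).2) v0; rewrite /vertical_combination sum_family.
by rewrite (big_morph snd (id1 := 0) (op1 := fun x y => x + y)).
Qed.

Lemma base_frame_unit : frame_mx base_frame (coord TM0 i u) \in unitmx.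
Proof.
rewrite -row_free_unit; apply: inj_row_free => c.
rewrite mul_frame_mx => <-; rewrite -[LHS]base_frame_coord.
by apply: eq_bigr => k _; rewrite (rep_coord sA).
Qed.

Lemma fibre_frame_unit : frame_mx fibre_frame (coord TM0 i u) \in unitmx.
Proof.
have Cu := domain_carrier Di; have [Di1 _ _] := Di.
rewrite -row_free_unit; apply: inj_row_free => c c0.
apply: vertical_combination_inj; left.
have sC := vertical_combination_vfield c.
apply: (tangent_zero_chart Di1); first exact: (connection_section hD sC sE).1.
rewrite connection_vertical_combination // sum_family -[RHS]c0 mul_frame_mx.
by apply: eq_bigr => k _; rewrite (rep_coord sA).
Qed.

End Frame.

Lemma horizontal_unique X Y u : vfield TM0 X -> carrier TM0 u ->
  D X (@eta R n M I) u = 0 -> rho (X u) = Y u -> horizontal A D Y u = X u.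
Proof.
move=> sX Cu DX rX; rewrite /horizontal.
have : [set w | ker_connection A D u w /\ rho w = Y u] (X u).
  by split => //; exists X.
move=> /(xgetI 0) [[X' [sX' <- DX']] rX'].
apply/subr0_eq; have sB := vfield_sub sX' sX.
apply: (kernel_vertical sB Cu); last by rewrite connection_subl // DX DX' subrr.
apply/funext => j; rewrite -[RHS](subrr (Y u j)) -{1}rX' -rX.
by [].
Qed.

Lemma horizontal_at Y u : pi_vfield A Y -> carrier TM0 u ->
  exists X, [/\ vfield TM0 X, X u = horizontal A D Y u,
    rho (X u) = Y u & D X (@eta R n M I) u = 0].
Proof.
move=> sY Cu; have [X [sX rX DX]] := horizontal_extension Cu (sY.1 u Cu).
by exists X; split => //; rewrite (horizontal_unique sX Cu DX rX).
Qed.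

(** Near a point, the horizontal lift of [Y] is a combination
    [sum_k c_k H_k - sum_k d_k gamma(rho H_k)]. Being a lift of [Y] is a linear
    system for [c], with the matrix of [base_frame]; being horizontal is then a
    linear system for [d], with the matrix of [fibre_frame]. Both matrices are
    invertible at the point, hence nearby, and the solutions are smooth. *)
Lemma horizontal_vfield Y : pi_vfield A Y -> vfield TM0 (horizontal A D Y).
Proof.
move=> sY; split=> [u Cu|i].
  by have [X [sX <- _ _]] := horizontal_at sY Cu; exact: sX.1.
apply: smooth_local => z0 rz0; have [Di c0] := param_range sA rz0.
set u := param TM0 i z0 in Di c0.
have [H HP] := horizontal_frame Di.
have sH k : vfield TM0 (H k) by have [] := HP k.
have oi := atlas_open_range sA i.
set e := base_frame H; set F := fibre_frame H.
have se k : pi_vfield A (e k) by exact: base_frame_pi HP k.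
have sF k : pi_vfield A (F k) by exact: fibre_frame_pi HP k.
have smx (G : 'I_n -> TM -> I -> V) : (forall k, pi_vfield A (G k)) ->
    forall a b, smooth_on (chart_range TM0 i) (fun z => frame_mx i G z a b).
  move=> sG a b; apply: (smooth_congr oi _ (smooth_coord oi b ((sG a).2 i))).
  by move=> z _; rewrite mxE.
have rz := range_coord Di.
have [U1 [oU1 U1z sU1 E1]] := open_unitmx oi (smx e se) rz (base_frame_unit Di HP).
have [U2 [oU2 U2z sU2 E2]] := open_unitmx oi (smx F sF) rz (fibre_frame_unit Di HP).
pose U := U1 `&` U2; have oU : open U by exact: openI.
exists U; first by rewrite -c0; split.
pose c z := rep TM0 i Y z *m invmx (frame_mx i e z).
pose N z := \sum_k c z 0 k *: rep TM0 i (D (H k) (@eta R n M I)) z.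
pose d z := N z *m invmx (frame_mx i F z).
pose X z := fun a => \sum_k c z 0 k *: H k a - vertical_combination H (d z) a.
have sUr : U `<=` chart_range TM0 i by move=> z [/sU1].
have sDH k := connection_section hD (sH k) sE.
have smU (G : V * V -> V) : smooth_on (chart_range TM0 i) G -> smooth_on U G.
  exact: smooth_sub.
have sc : smooth_on U c.
  apply: smooth_solve => // [a b|z [/E1]//|].
    exact: smooth_sub sUr (smx e se a b).
  exact: smU (sY.2 i).
have sN : smooth_on U N.
  apply: smooth_sum => // k; apply: smoothZ => //; first exact: smooth_coord.
  exact: smU ((sDH k).2 i).
have sd : smooth_on U d.
  apply: smooth_solve => // [a b|z [_ /E2]//].
  exact: smooth_sub sUr (smx F sF a b).
have sX z : vfield TM0 (X z).
  apply: vfield_sub; first exact: (vfield_sum _ (fun k => c z 0 k) vfield_zero).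
  exact: vertical_combination_vfield.
have XE z : U z -> horizontal A D Y (param TM0 i z) = X z (param TM0 i z).
  move=> Uz; have [Dz cz] := param_range sA (sUr z Uz).
  have Cz := domain_carrier Dz; have [Dz1 _ _] := Dz.
  set p := param TM0 i z in Dz cz Cz Dz1 *.
  have sS := vfield_sum (index_enum 'I_n) (fun k => c z 0 k) vfield_zero sH.
  have sC := vertical_combination_vfield HP (d z).
  apply: horizontal_unique => //.
    apply: (tangent_zero_chart Dz1); first exact: (connection_section hD (sX z) sE).1.
    rewrite connection_subl // (connection_suml _ _ sH) //.
    rewrite (connection_vertical_combination HP) //.
    have -> (f g : I -> V) : (f - g) i = f i - g i by [].
    rewrite !sum_family; apply/subr0_eq; rewrite subr0.
    apply/eqP; rewrite subr_eq0; apply/eqP.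
    have NE : d z *m frame_mx i F z = N z by rewrite mulmxKV //; case: Uz => _ /E2.
    by apply: etrans (esym NE) _; rewrite mul_frame_mx.
  have [sXz _] := sX z.
  apply: (tangent_eq Dz1); [exact: (rho_tangent hM Cz (sXz p Cz))|exact: sY.1|].
  have cE : c z *m frame_mx i e z = Y p i by rewrite mulmxKV //; case: Uz => /E1.
  apply: etrans _ cE; rewrite mul_frame_mx /rho.
  have -> : X z p i = \sum_k c z 0 k *: H k p i
     - \sum_k d z 0 k *: gamma_field (base_frame H k) p i.
    rewrite /X /vertical_combination.
    have -> (f g : I -> V * V) : (f - g) i = f i - g i by [].
    by rewrite !sum_family.
  have -> (x y : V * V) : (x - y).1 = x.1 - y.1 by [].
  rewrite !(big_morph fst (id1 := 0) (op1 := fun x y => x + y)) //.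
  rewrite [X in _ - X]big1 ?subr0 // => k _.
  by rewrite /= scaler0.
apply: (@smooth_congr _ _ _ _ (fun z => \sum_k c z 0 k *: rep TM0 i (H k) z
     - \sum_k d z 0 k *: rep TM0 i (gamma_field (base_frame H k)) z)) => //.
  move=> z Uz; rewrite XE // /X /vertical_combination.
  have -> (f g : I -> V * V) : (f - g) i = f i - g i by [].
  by rewrite !sum_family.
apply: smoothB => //; apply: smooth_sum => // k; apply: smoothZ => //.
- exact: smooth_coord.
- exact: smooth_sub sUr ((sH k).2 i).
- exact: smooth_coord.
- exact: smooth_sub sUr ((gamma_field_vfield hM (se k)).2 i).
Qed.

Lemma rho_horizontal Y u : pi_vfield A Y -> carrier TM0 u ->
  rho (horizontal A D Y u) = Y u.
Proof. by move=> sY Cu; have [X [sX <- ]] := horizontal_at sY Cu. Qed.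

Lemma horizontal_vertical X : vfield TM0 X -> exists2 Y, pi_vfield A Y &
  forall u, carrier TM0 u ->
    X u = horizontal A D (rho_field X) u + gamma_field Y u.
Proof.
move=> sX; have sr := rho_field_pi hM sX.
have sh := horizontal_vfield sr.
have [u Cu|Y sY YE] := vertical_field hM (vfield_sub sX sh).
  apply/funext => j; apply: etrans (subrr (rho (X u) j)).
  by rewrite -{2}[rho (X u)]/(rho_field X u) -(rho_horizontal sr Cu).
by exists Y => // u Cu; rewrite -YE // addrC subrK.
Qed.

End Regular.
End Connections.

(** * Bilinear forms depending smoothly on a point *)

Section Forms.
Variables (R : realType) (E V : normedModType R).
Hypothesis findimV : findim V.
Variables (U : set E) (B : E -> V -> V -> R).
Hypothesis oU : open U.
Hypothesis B_linl : forall z c a a' b, U z ->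
  B z (c *: a + a') b = c * B z a b + B z a' b.
Hypothesis B_linr : forall z c a b b', U z ->
  B z a (c *: b + b') = c * B z a b + B z a b'.
Hypothesis B_smooth : forall a b, smooth_on U (fun z => B z a b).

Let B_suml z (K : Type) (r : seq K) (c : K -> R) (e : K -> V) b : U z ->
  B z (\sum_(k <- r) c k *: e k) b = \sum_(k <- r) c k * B z (e k) b.
Proof.
move=> Uz; elim: r => [|k r IH]; last by rewrite !big_cons B_linl // IH.
rewrite !big_nil; have := B_linl (-1) 0 0 b Uz.
by rewrite scaler0 addr0 mulN1r addNr.
Qed.

Let B_sumr z (K : Type) (r : seq K) (c : K -> R) (e : K -> V) a : U z ->
  B z a (\sum_(k <- r) c k *: e k) = \sum_(k <- r) c k * B z a (e k).
Proof.
move=> Uz; elim: r => [|k r IH]; last by rewrite !big_cons B_linr // IH.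
rewrite !big_nil; have := B_linr (-1) a 0 0 Uz.
by rewrite scaler0 addr0 mulN1r addNr.
Qed.

(** Expanding [a] and [b] in a basis reduces this to finitely many functions
    [B z (e_j) (e_k)]; the same holds for the differential below. *)
Lemma form_smooth (a b : E -> V) : smooth_on U a -> smooth_on U b ->
  smooth_on U (fun z => B z (a z) (b z)).
Proof.
move=> sa sb; have [n [e [l [lc lE]]]] := findimV.
apply: (@smooth_congr _ _ _ _ (fun z =>
  \sum_k l k (a z) * \sum_m l m (b z) * B z (e k) (e m))) => //.
  move=> z Uz; rewrite [in RHS](lE (a z)) B_suml //; apply: eq_bigr => k _.
  by rewrite [in RHS](lE (b z)) B_sumr.
apply: smooth_sum => // k; apply: smoothM => //.
  exact: (smooth_lin_comp oU (lc k) sa).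
apply: smooth_sum => // m; apply: smoothM => //.
exact: (smooth_lin_comp oU (lc m) sb).
Qed.

Lemma is_diff_form (a da b db : E -> V) x : U x ->
  is_diff x a da -> is_diff x b db ->
  is_diff x (fun z => B z (a z) (b z))
    (fun v => 'd (fun z => B z (a x) (b x)) x v
       + (B x (da v) (b x) + B x (a x) (db v))).
Proof.
have [n [e [l [lc lE]]]] := findimV.
have nearU y : U y -> \forall z \near y, U z by move=> Uy; exact: open_nbhs_nbhs.
have H (a1 da1 b1 db1 : E -> V) : U x -> is_diff x a1 da1 -> is_diff x b1 db1 ->
  is_diff x (fun z => B z (a1 z) (b1 z)) (fun v => \sum_k \sum_m
    ((l k (da1 v) * l m (b1 x) + l k (a1 x) * l m (db1 v)) * B x (e k) (e m)
    + l k (a1 x) * l m (b1 x) * 'd (fun z => B z (e k) (e m)) x v)).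
  move=> Ux da1x db1x.
  have N : \forall z \near x,
      (\sum_k \sum_m l k (a1 z) * l m (b1 z) * B z (e k) (e m))
      = B z (a1 z) (b1 z).
    apply: filterS (nearU _ Ux) => z Uz.
    rewrite [in RHS](lE (a1 z)) B_suml //; apply: eq_bigr => k _.
    rewrite [in RHS](lE (b1 z)) B_sumr // big_distrr.
    by apply: eq_bigr => m _; rewrite /= mulrA.
  apply: (is_diff_near N); apply: is_diff_sum_seq => k.
  apply: is_diff_sum_seq => m.
  have D1 := is_diff_linear_comp (lc k) da1x.
  have D2 := is_diff_linear_comp (lc m) db1x.
  have D3 := smooth_is_diff (B_smooth (e k) (e m)) Ux.
  have D4 := is_diff_scale (is_diff_scale D1 D2) D3.
  by apply: (is_diff_eq D4).
move=> Ux dax dbx; apply: (is_diff_eq (H _ _ _ _ Ux dax dbx)).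
apply/funext => v.
have DC := H _ _ _ _ Ux (is_diff_const (a x) x) (is_diff_const (b x) x).
apply: etrans _ (congr2 (fun p q => p + q) (esym (diff_val_at v DC)) erefl).
have BE a1 b1 : B x a1 b1 =
    \sum_k \sum_m l k a1 * l m b1 * B x (e k) (e m).
  rewrite [in LHS](lE a1) B_suml //; apply: eq_bigr => k _.
  rewrite [in LHS](lE b1) B_sumr // big_distrr.
  by apply: eq_bigr => m _; rewrite /= mulrA.
rewrite (BE (da v)) (BE (a x)) -!big_split; apply: eq_bigr => k _ /=.
rewrite -!big_split; apply: eq_bigr => m _ /=.
rewrite (linear0 (l k)) (linear0 (l m)); ring.
Qed.

End Forms.

(** * The Finsler metric in a chart *)

Lemma derive1_near (R : realType) (f g : R -> R) (x : R) :
  (\forall t \near x, f t = g t) -> derive1 f x = derive1 g x.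
Proof.
by move=> fg; rewrite !derive1E; apply: near_eq_derive => //; rewrite oner_eq0.
Qed.

Lemma half_linear (R : realType) (E : normedModType R) (d : {linear E -> R})
    (c : R) (x y : E) : 2^-1 * d (c *: x + y) = c * (2^-1 * d x) + 2^-1 * d y.
Proof. by rewrite linearP mulrDr; congr (_ + _); exact: mulrCA. Qed.

Section Metric.
Variables (R : realType) (n : nat) (M : topologicalType) (I : Type).
Variable A : atlas 'rV[R]_n M I.
Hypothesis hM : smooth_manifold A.

Local Notation V := 'rV[R]_n.
Local Notation TM := (M * (I -> V))%type.
Local Notation TM0 := (slit_tangent A).
Local Notation sA := (slit_atlas hM).
Local Notation bA := (base_atlas hM).
Let fV : findim V := findim_rV R n.

Variable L : TM -> R.

Definition chart_energy i (z : V * V) : R := L (param TM0 i z) ^+ 2.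

(** The components [g_ij] of the metric, read as a bilinear form on [V]. *)
Definition chart_metric i (z : V * V) (a b : V) : R :=
  2^-1 * 'd (fun z => 'd (chart_energy i) z ((0, b) : V * V)) z ((0, a) : V * V).

Hypothesis sL : smooth_fun TM0 (fun u => L u ^+ 2).

Let oi i : open (chart_range TM0 i) := atlas_open_range sA i.

Let sE i : smooth_on (chart_range TM0 i) (chart_energy i) := sL i.

Lemma fibre_line (x y : V) (v : V) (t : R) :
  ((x, y + t *: v) : V * V) = (x, y) + t *: ((0, v) : V * V).
Proof.
by apply: injective_projections => //=; rewrite scaler0 addr0.
Qed.

(** The metric is defined by second differences of the energy inside a fibre.
    Along such a line the point of the base is fixed, so that a single chart
    contains all points whose fibre component is not 0. *)
Lemma fibre_translate i u v : domain TM0 i u -> tangent A u.1 v ->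
  u.2 i + v i != 0 -> domain TM0 i (u.1, u.2 + v).
Proof.
move=> [Du uT _] vT n0; split => //=.
  by have := tangent_linear 1 uT vT; rewrite scale1r.
by apply: contra_neq n0 => e; rewrite -[LHS]/((u.2 + v) i) e.
Qed.

Lemma energy_translate i u v : domain TM0 i u -> tangent A u.1 v ->
  u.2 i + v i != 0 ->
  L (u.1, u.2 + v) ^+ 2 = chart_energy i (coord A i u.1, u.2 i + v i).
Proof.
move=> Du vT n0; have Dv := fibre_translate Du vT n0.
by rewrite /chart_energy -(atlas_coordK sA Dv).
Qed.

Let tangent_scale u (s : R) v : tangent A u v -> tangent A u (s *: v).
Proof.
move=> vT; have z := tangent_linear (-1) vT vT.
have := tangent_linear s vT z.
by rewrite scaleN1r addNr addr0.
Qed.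

Lemma near_line_neq0 (y v : V) : y != 0 ->
  \forall s \near (0 : R), y + s *: v != 0.
Proof.
move=> y0.
have c : {for (0 : R), continuous (fun s : R => y + s *: v)}.
  by apply: cvgD; [exact: cvg_cst|apply: cvgZr_tmp; exact: cvg_id].
apply: (c [set y | y != 0]); apply: open_nbhs_nbhs.
by split; [exact: open_neq0|rewrite /= scale0r addr0].
Qed.

Lemma energy_derive1 i u v w : domain TM0 i u -> tangent A u.1 v ->
  tangent A u.1 w -> u.2 i + v i != 0 ->
  derive1 (fun t : R => L (u.1, u.2 + v + t *: w) ^+ 2) 0
  = 'd (chart_energy i) (coord A i u.1, u.2 i + v i) ((0, w i) : V * V).
Proof.
move=> Du vT wT n0; have Dv := fibre_translate Du vT n0.
rewrite -(@derive1_line _ _ _ (chart_energy i) (coord A i u.1, u.2 i + v i)); last first.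
  apply: (smooth_differentiable (sE i)); apply/(slit_range hM); split => //=.
  by exists u.1 => //; case: Du.
apply: derive1_near; have := near_line_neq0 (w i) n0; apply: filterS => t nt.
rewrite -fibre_line.
exact: (energy_translate Dv (tangent_scale t wT) nt).
Qed.

Lemma finsler_metric_chart i u v w : domain TM0 i u -> tangent A u.1 v ->
  tangent A u.1 w ->
  finsler_metric L u v w = chart_metric i (coord TM0 i u) (v i) (w i).
Proof.
move=> Du vT wT; rewrite /finsler_metric /chart_metric; congr (_ * _).
have rz := range_coord Du.
rewrite -(@derive1_line _ _ _ (fun z => 'd (chart_energy i) z ((0, w i) : V * V))); last first.
  exact: (smooth_differentiable (smooth_diff _ (sE i)) rz).
apply: derive1_near.
have := near_line_neq0 (v i) (slit_neq0 Du); apply: filterS => s ns.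
rewrite -[coord TM0 i u]/(coord A i u.1, u.2 i) -fibre_line.
by rewrite (energy_derive1 Du (tangent_scale s vT) wT).
Qed.

Section Chart.
Variables (i : I) (z : V * V).
Hypothesis rz : chart_range TM0 i z.

Lemma chart_metricC a b : chart_metric i z a b = chart_metric i z b a.
Proof.
rewrite /chart_metric; congr (_ * _).
exact: (Schwarz_real ((0, b) : V * V) ((0, a) : V * V) (@oi i) rz (sE i)).
Qed.

Lemma chart_metric_linl (c : R) a a' b : chart_metric i z (c *: a + a') b =
  c * chart_metric i z a b + chart_metric i z a' b.
Proof.
rewrite /chart_metric.
have -> : ((0, c *: a + a') : V * V) = c *: ((0, a) : V * V) + (0, a').
  by apply: injective_projections => //=; rewrite scaler0 addr0.
exact: half_linear.
Qed.

Lemma chart_metric0l b : chart_metric i z 0 b = 0.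
Proof.
by have := chart_metric_linl (-1) 0 0 b; rewrite scaler0 addr0 mulN1r addNr.
Qed.

Lemma chart_metric_linr (c : R) a b b' : chart_metric i z a (c *: b + b') =
  c * chart_metric i z a b + chart_metric i z a b'.
Proof. by rewrite chart_metricC chart_metric_linl !(chart_metricC a). Qed.

End Chart.

Lemma chart_metric_smooth i a b :
  smooth_on (chart_range TM0 i) (fun z => chart_metric i z a b).
Proof.
apply: smoothM; [exact: oi|exact/smooth_cst/oi|].
exact: (smooth_diff ((0, a) : V * V) (smooth_diff ((0, b) : V * V) (sE i))).
Qed.

Definition d_chart_metric i z (v : V * V) (a b : V) : R :=
  'd (fun z => chart_metric i z a b) z v.

Lemma d_chart_metricC i z v a b : chart_range TM0 i z ->
  d_chart_metric i z v a b = d_chart_metric i z v b a.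
Proof.
move=> rz.
have N : \forall z \near z, chart_metric i z b a = chart_metric i z a b.
  have : \forall z \near z, chart_range TM0 i z by exact: open_nbhs_nbhs.
  by apply: filterS => t rt; exact: chart_metricC.
have D := smooth_is_diff (chart_metric_smooth i b a) rz.
exact: (diff_val_at v (is_diff_near N D)).
Qed.

(** The vertical derivative of the metric, twice the Cartan tensor, is totally
    symmetric as a third derivative of the energy. *)
Lemma d_chart_metricCA i z (a b c : V) : chart_range TM0 i z ->
  d_chart_metric i z (0, a) b c = d_chart_metric i z (0, b) a c.
Proof.
move=> rz; rewrite /d_chart_metric /chart_metric.
have S := smooth_diff ((0, c) : V * V) (sE i).
pose e := fun z => 'd (chart_energy i) z ((0, c) : V * V).
have K v w : 'd (fun z => 2^-1 * 'd e z v) z w = 2^-1 * 'd (fun z => 'd e z v) z w.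
  have D := smooth_is_diff (smooth_diff v S) rz.
  have C := is_diff_const (2^-1 : R) z.
  apply: etrans (diff_val_at w (is_diff_scale C D)) _.
  by rewrite scale0r add0r.
apply: etrans (K _ _) (etrans _ (esym (K _ _))); congr (_ * _).
exact: (Schwarz_real ((0, b) : V * V) ((0, a) : V * V) (@oi i) rz S).
Qed.

Lemma is_diff_metric i (a da b db : V * V -> V) z : chart_range TM0 i z ->
  is_diff z a da -> is_diff z b db ->
  is_diff z (fun z => chart_metric i z (a z) (b z))
    (fun v => d_chart_metric i z v (a z) (b z)
       + (chart_metric i z (da v) (b z) + chart_metric i z (a z) (db v))).
Proof.
move=> rz dax dbx.
apply: (is_diff_form fV (@oi i) _ _ (@chart_metric_smooth i) rz dax dbx).
  by move=> t c x x' y rt; exact: chart_metric_linl.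
by move=> t c x y y' rt; exact: chart_metric_linr.
Qed.

Lemma smooth_metric i (a b : V * V -> V) :
  smooth_on (chart_range TM0 i) a -> smooth_on (chart_range TM0 i) b ->
  smooth_on (chart_range TM0 i) (fun z => chart_metric i z (a z) (b z)).
Proof.
apply: (form_smooth fV (@oi i) _ _ (@chart_metric_smooth i)).
  by move=> t c x x' y rt; exact: chart_metric_linl.
by move=> t c x y y' rt; exact: chart_metric_linr.
Qed.

Local Notation g := (finsler_metric L).

Section Pointwise.
Variable u : TM.
Hypothesis Cu : carrier TM0 u.

Lemma metricC v w : tangent A u.1 v -> tangent A u.1 w -> g u v w = g u w v.
Proof.
move=> vT wT; have [i _ Di] := Cu.
by rewrite !(finsler_metric_chart Di) // chart_metricC //; exact: range_coord.
Qed.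

Lemma metric_linl (c : R) v v' w : tangent A u.1 v -> tangent A u.1 v' ->
  tangent A u.1 w -> g u (c *: v + v') w = c * g u v w + g u v' w.
Proof.
move=> vT vT' wT; have [i _ Di] := Cu.
rewrite !(finsler_metric_chart Di) //; last exact: tangent_linear.
exact: chart_metric_linl.
Qed.

Lemma metricDl v v' w : tangent A u.1 v -> tangent A u.1 v' ->
  tangent A u.1 w -> g u (v + v') w = g u v w + g u v' w.
Proof.
by move=> vT vT' wT; have := metric_linl 1 vT vT' wT; rewrite scale1r mul1r.
Qed.

Lemma tangent0 (v : I -> V) : tangent A u.1 v -> tangent A u.1 0.
Proof. by move=> vT; have := tangent_linear (-1) vT vT; rewrite scaleN1r addNr. Qed.

Lemma metric0l w : tangent A u.1 w -> g u 0 w = 0.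
Proof.
move=> wT; have zT := tangent0 wT.
by have := metric_linl (-1) zT zT wT; rewrite scaler0 addr0 mulN1r addNr.
Qed.

Lemma metricZl (c : R) v w : tangent A u.1 v -> tangent A u.1 w ->
  g u (c *: v) w = c * g u v w.
Proof.
move=> vT wT; have := metric_linl c vT (tangent0 vT) wT.
by rewrite addr0 metric0l // addr0.
Qed.

Lemma metricNl v w : tangent A u.1 v -> tangent A u.1 w ->
  g u (- v) w = - g u v w.
Proof. by move=> vT wT; rewrite -scaleN1r metricZl // mulN1r. Qed.

Lemma tangentN (v : I -> V) : tangent A u.1 v -> tangent A u.1 (- v).
Proof.
by move=> vT; have := tangent_linear (-1) vT (tangent0 vT); rewrite scaleN1r addr0.
Qed.

Lemma tangentD (v w : I -> V) : tangent A u.1 v -> tangent A u.1 w ->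
  tangent A u.1 (v + w).
Proof. by move=> vT wT; have := tangent_linear 1 vT wT; rewrite scale1r. Qed.

Lemma tangentZ (c : R) (v : I -> V) : tangent A u.1 v -> tangent A u.1 (c *: v).
Proof. by move=> vT; have := tangent_linear c vT (tangent0 vT); rewrite addr0. Qed.

Lemma metricBl v v' w : tangent A u.1 v -> tangent A u.1 v' ->
  tangent A u.1 w -> g u (v - v') w = g u v w - g u v' w.
Proof.
by move=> vT vT' wT; rewrite metricDl ?metricNl //; exact: tangentN.
Qed.

End Pointwise.

Lemma metric_smooth X Y : pi_vfield A X -> pi_vfield A Y ->
  smooth_fun TM0 (fun u => g u (X u) (Y u)).
Proof.
move=> sX sY i.
apply: (smooth_congr (@oi i) _ (smooth_metric (sX.2 i) (sY.2 i))) => z rz.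
have [Dz cz] := param_range sA rz; have Cz := domain_carrier Dz.
by rewrite /= (finsler_metric_chart Dz (sX.1 _ Cz) (sY.1 _ Cz)) cz.
Qed.

Lemma along_metric i u w X Y : pi_vfield A X -> pi_vfield A Y ->
  domain TM0 i u ->
  along TM0 i u w (fun a => g a (X a) (Y a)) =
  d_chart_metric i (coord TM0 i u) (w i) (X u i) (Y u i)
  + (chart_metric i (coord TM0 i u) (drep TM0 i X u (w i)) (Y u i)
     + chart_metric i (coord TM0 i u) (X u i) (drep TM0 i Y u (w i))).
Proof.
move=> sX sY Di; have rz := range_coord Di.
have D := is_diff_metric rz (smooth_is_diff (sX.2 i) rz) (smooth_is_diff (sY.2 i) rz).
have N : \forall z \near coord TM0 i u,
    chart_metric i z (rep TM0 i X z) (rep TM0 i Y z)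
    = ((fun a => g a (X a) (Y a)) \o param TM0 i) z.
  have := near_range sA Di; apply: filterS => z rt.
  have [Dz cz] := param_range sA rt; have Cz := domain_carrier Dz.
  by rewrite /= (finsler_metric_chart Dz (sX.1 _ Cz) (sY.1 _ Cz)) cz.
apply: etrans (diff_val_at (w i) (is_diff_near N D)) _.
by rewrite -(rep_coord sA X Di) -(rep_coord sA Y Di).
Qed.

End Metric.

(** * Torsion *)

Section Torsion.
Variables (R : realType) (n : nat) (M : topologicalType) (I : Type).
Variable A : atlas 'rV[R]_n M I.
Hypothesis hM : smooth_manifold A.

Local Notation V := 'rV[R]_n.
Local Notation TM := (M * (I -> V))%type.
Local Notation TM0 := (slit_tangent A).
Local Notation sA := (slit_atlas hM).
Local Notation bA := (base_atlas hM).
Let fV : findim V := findim_rV R n.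
Let fVV : findim (V * V)%type := findim_prod fV fV.

Lemma lie_vfield0 X Y : vfield TM0 X -> vfield TM0 Y -> vfield TM0 (lie TM0 X Y).
Proof. exact: (lie_vfield fVV sA). Qed.

Lemma drep_rho i X u w : vfield TM0 X -> domain TM0 i u ->
  (drep TM0 i X u w).1 = drep TM0 i (rho_field X) u w.
Proof.
move=> sX Di; have [l lc lE] := fst_linear V V.
have D := is_diff_linear_comp lc (rep_is_diff sX Di).
have := diff_val_at w D; rewrite lE => E.
by apply: esym; apply: etrans E _.
Qed.

Lemma rho_lie i X Y u : vfield TM0 X -> vfield TM0 Y -> domain TM0 i u ->
  rho (lie TM0 X Y u) i =
  drep TM0 i (rho_field Y) u (X u i) - drep TM0 i (rho_field X) u (Y u i).
Proof.
move=> sX sY Di; rewrite /rho lieE //.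
by rewrite -(drep_rho _ sX Di) -(drep_rho _ sY Di).
Qed.

Lemma drep_cst i (c : V) (u : TM) w : drep TM0 i (fun _ _ => c) u w = 0.
Proof. exact: (diff_val_at w (is_diff_const c _)). Qed.

Variable D : (TM -> I -> V * V) -> (TM -> I -> V) -> (TM -> I -> V).
Hypothesis hD : linear_connection A D.

Lemma torsionE i X Y u : vfield TM0 X -> vfield TM0 Y -> domain TM0 i u ->
  torsion A D X Y u i = (D X (rho_field Y) u i - D Y (rho_field X) u i)
   - (drep TM0 i (rho_field Y) u (X u i) - drep TM0 i (rho_field X) u (Y u i)).
Proof. by move=> sX sY Di; rewrite -rho_lie. Qed.

Lemma torsion_pi X Y : vfield TM0 X -> vfield TM0 Y ->
  pi_vfield A (torsion A D X Y).
Proof.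
move=> sX sY; have rX := rho_field_pi hM sX; have rY := rho_field_pi hM sY.
apply: (pi_sub hM); last exact: rho_field_pi (lie_vfield0 sX sY).
by apply: (pi_sub hM); apply: (connection_section hD).
Qed.

Lemma torsionC X Y u : vfield TM0 X -> vfield TM0 Y -> carrier TM0 u ->
  torsion A D X Y u = - torsion A D Y X u.
Proof.
move=> sX sY Cu; have [i _ Di] := Cu; have [Di1 _ _] := Di.
apply: (tangent_eq Di1); first exact: (torsion_pi sX sY).1.
  by apply: tangentN; exact: (torsion_pi sY sX).1.
rewrite -[RHS]/(- (torsion A D Y X u i)) !torsionE //.
by apply: (findim_eq fV) => l; rewrite !(linearD l, linearN l); ring.
Qed.

Lemma torsion_congr X X' Y Y' u : vfield TM0 X -> vfield TM0 X' ->
  vfield TM0 Y -> vfield TM0 Y' -> carrier TM0 u ->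
  (forall a, carrier TM0 a -> X a = X' a) ->
  (forall a, carrier TM0 a -> Y a = Y' a) ->
  torsion A D X Y u = torsion A D X' Y' u.
Proof.
move=> sX sX' sY sY' Cu XX' YY'.
have rX := rho_field_pi hM sX; have rY := rho_field_pi hM sY.
have rX' := rho_field_pi hM sX'; have rY' := rho_field_pi hM sY'.
have [i _ Di] := Cu; have [Di1 _ _] := Di.
apply: (tangent_eq Di1); [exact: (torsion_pi sX sY).1|exact: (torsion_pi sX' sY').1|].
have rr W W' : vfield TM0 W -> vfield TM0 W' ->
   (forall a, carrier TM0 a -> W a = W' a) ->
   drep TM0 i (rho_field W) u = drep TM0 i (rho_field W') u.
  move=> sW sW' WW'; apply/funext => w.
  have N : \forall z \near coord TM0 i u,
      rep TM0 i (rho_field W) z = rep TM0 i (rho_field W') z.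
    have := near_range sA Di; apply: filterS => z rz.
    have [Dz _] := param_range sA rz.
    by rewrite /rep /rho_field WW' //; exact: domain_carrier Dz.
  have := rho_field_pi hM sW => -[_ /(_ i)] sm.
  exact: esym (diff_val_at w (is_diff_near N (smooth_is_diff sm (range_coord Di)))).
rewrite !torsionE // (rr _ _ sX sX' XX') (rr _ _ sY sY' YY') (XX' u Cu) (YY' u Cu).
congr (_ - _ - _).
  rewrite (connection_congrl hM hD sX sX' rY Cu XX').
  rewrite (connection_congrr hM hD sX' rY rY' Cu) // => a Ca.
  by rewrite /rho_field YY'.
rewrite (connection_congrl hM hD sY sY' rX Cu YY').
rewrite (connection_congrr hM hD sY' rX rX' Cu) // => a Ca.
by rewrite /rho_field XX'.
Qed.

Lemma torsionDl X X' Y u : vfield TM0 X -> vfield TM0 X' -> vfield TM0 Y ->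
  carrier TM0 u ->
  torsion A D (fun a => X a + X' a) Y u = torsion A D X Y u + torsion A D X' Y u.
Proof.
move=> sX sX' sY Cu; have sS := vfield_add hM sX sX'.
have rX := rho_field_pi hM sX; have rY := rho_field_pi hM sY.
have rX' := rho_field_pi hM sX'.
have [i _ Di] := Cu; have [Di1 _ _] := Di.
apply: (tangent_eq Di1); first exact: (torsion_pi sS sY).1.
  by apply: tangentD; [exact: (torsion_pi sX sY).1|exact: (torsion_pi sX' sY).1].
have -> (f h : I -> V) : (f + h) i = f i + h i by [].
rewrite !torsionE // (connection_addl hD sX sX' rY Cu).
have rS : rho_field (fun a => X a + X' a) =
  (fun a => rho_field X a + rho_field X' a) by [].
rewrite rS (connection_addr hD sY rX rX' Cu).
have E : drep TM0 i (fun a => rho_field X a + rho_field X' a) u (Y u i) =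
    drep TM0 i (rho_field X) u (Y u i) + drep TM0 i (rho_field X') u (Y u i).
  have D1 := smooth_is_diff (rX.2 i) (range_coord Di).
  have D2 := smooth_is_diff (rX'.2 i) (range_coord Di).
  exact: (diff_val_at (Y u i) (is_diff_add D1 D2)).
have E2 : drep TM0 i (rho_field Y) u ((X u + X' u) i) =
    drep TM0 i (rho_field Y) u (X u i) + drep TM0 i (rho_field Y) u (X' u i).
  exact: linearD.
have key (a a' b b' c c' d d' : V) :
    ((a + a') - (b + b')) - ((c + c') - (d + d'))
    = ((a - b) - (c - d)) + ((a' - b') - (c' - d')).
  by apply: (findim_eq fV) => l; rewrite !(linearD l, linearN l); ring.
rewrite E E2; exact: key.
Qed.

Lemma rho_gamma_field X : rho_field (gamma_field X) = (fun _ _ => 0) :> (TM -> I -> V).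
Proof. by []. Qed.

(** [rho] kills vertical fields and their brackets. *)
Lemma torsion_vertical X Y u : pi_vfield A X -> pi_vfield A Y ->
  carrier TM0 u -> torsion A D (gamma_field X) (gamma_field Y) u = 0.
Proof.
move=> sX sY Cu; have gX := gamma_field_vfield hM sX.
have gY := gamma_field_vfield hM sY.
have [i _ Di] := Cu; have [Di1 _ _] := Di.
apply: (tangent_zero_chart Di1); first exact: (torsion_pi gX gY).1.
rewrite torsionE // !rho_gamma_field !drep_cst.
rewrite !(connection_zeror hM hD) //; try exact: pi_zero hM.
by rewrite [(0 : I -> V) i]/(0 : V) !subr0.
Qed.

Section Regular.
Hypothesis hR : regular_connection A D.

(** [T(X, Y)] compares the covariant derivative of [Y] along a vertical vector
    with the ordinary one in the fibre. *)
Lemma hv_torsionE i X Y u : pi_vfield A X -> pi_vfield A Y -> domain TM0 i u ->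
  hv_torsion A D X Y u i =
  D (gamma_field X) Y u i - drep TM0 i Y u (0, X u i).
Proof.
move=> sX sY Di; have Cu := domain_carrier Di.
have gX := gamma_field_vfield hM sX; have hY := horizontal_vfield hM hD hR sY.
rewrite /hv_torsion torsionE // rho_gamma_field drep_cst subr0.
have Z : D (horizontal A D Y) (fun _ _ => 0) u = 0.
  exact: (connection_zeror hM hD hY (pi_zero hM) Cu).
rewrite Z.
have rY := rho_field_pi hM hY.
have rYE a : carrier TM0 a -> rho_field (horizontal A D Y) a = Y a.
  by move=> Ca; exact: (rho_horizontal hM hD hR).
rewrite (connection_congrr hM hD gX rY sY Cu rYE).
apply: (congr2 (fun a b : V => a - b)); first exact: subr0.
have N : \forall z \near coord TM0 i u,
    rep TM0 i Y z = rep TM0 i (rho_field (horizontal A D Y)) z.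
  have := near_range sA Di; apply: filterS => z rz.
  have [Dz _] := param_range sA rz.
  by rewrite /rep rYE //; exact: domain_carrier Dz.
have D1 := smooth_is_diff (sY.2 i) (range_coord Di).
exact: (diff_val_at (gamma_field X u i) (is_diff_near N D1)).
Qed.

End Regular.

End Torsion.

(** * Cartan connections and concurrent fields *)

Lemma cartan_arith (R : realType) (d a b t t' : R) :
  d + (a + b) = t + a + (t' + b) -> t' = t -> d = 2 * t.
Proof. lra. Qed.

Lemma dual_arith (R : realType) (d a b t : R) :
  d + (a + b) = t + a + 0 -> d + (0 + b) = 0 -> t = 0.
Proof. lra. Qed.

Section Cartan.
Variables (R : realType) (n : nat) (M : topologicalType) (I : Type).
Variable A : atlas 'rV[R]_n M I.
Hypothesis hM : smooth_manifold A.

Local Notation V := 'rV[R]_n.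
Local Notation TM := (M * (I -> V))%type.
Local Notation TM0 := (slit_tangent A).
Local Notation sA := (slit_atlas hM).
Local Notation bA := (base_atlas hM).
Let fV : findim V := findim_rV R n.
Let fVV : findim (V * V)%type := findim_prod fV fV.

(** A tangent vector is the sum of a vertical vector, lifted from a section of
    the pullback bundle, and of a horizontal one, which is by definition the
    value of a field. *)
Lemma vfield_extension D u w : linear_connection A D -> regular_connection A D ->
  carrier TM0 u -> tangent TM0 u w -> exists2 X, vfield TM0 X & X u = w.
Proof.
move=> hD hR Cu wT; have [H _] := hR u Cu.
have [v [h [[vT rv] [X [sX Xu DX]] wE]]] := H w wT.
have [a aT vE] := vertical_gamma hM Cu vT rv.
have [Y sY Yu] := pi_extension hM hR Cu aT.
exists (fun p => gamma_field Y p + X p).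
  by apply: (vfield_add hM) => //; exact: gamma_field_vfield.
by rewrite Xu wE vE /gamma_field Yu.
Qed.

Variable L : TM -> R.
Hypothesis sL : smooth_fun TM0 (fun u => L u ^+ 2).
Hypothesis L_pos : forall u v, carrier TM0 u -> tangent A u.1 v -> v != 0 ->
  0 < finsler_metric L u v v.

Local Notation g := (finsler_metric L).

Lemma metric_nondegenerate u v : carrier TM0 u -> tangent A u.1 v ->
  g u v v = 0 -> v = 0.
Proof.
move=> Cu vT gv; apply/eqP; case: eqP => // /eqP v0.
by have := L_pos Cu vT v0; rewrite gv ltxx.
Qed.

Variable D : (TM -> I -> V * V) -> (TM -> I -> V) -> (TM -> I -> V).
Hypothesis hC : cartan_connection A D L.

Let hD := cartan_linear hC.
Let hR := cartan_regular hC.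
Let oi i : open (chart_range TM0 i) := atlas_open_range sA i.

Lemma hv_torsion_pi X Y : pi_vfield A X -> pi_vfield A Y ->
  pi_vfield A (hv_torsion A D X Y).
Proof.
move=> sX sY; apply: (torsion_pi hM hD); first exact: gamma_field_vfield.
exact: (horizontal_vfield hM hD hR).
Qed.

(** The vertical derivative of the metric is carried by the (h)hv-torsion: this
    is where the symmetry axiom of the Cartan connection enters. *)
Lemma cartan_tensor i u X Y Z : pi_vfield A X -> pi_vfield A Y ->
  pi_vfield A Z -> domain TM0 i u ->
  d_chart_metric A L i (coord TM0 i u) (0, X u i) (Y u i) (Z u i)
  = 2 * g u (hv_torsion A D X Y u) (Z u).
Proof.
move=> sX sY sZ Di; have Cu := domain_carrier Di.
have rz := range_coord Di.
have gX := gamma_field_vfield hM sX.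
have E := cartan_metric hC gX sY sZ Di.
rewrite (along_metric hM sL _ sY sZ Di) in E.
have DY := connection_section hD gX sY; have DZ := connection_section hD gX sZ.
have TY := hv_torsion_pi sX sY; have TZ := hv_torsion_pi sX sZ.
rewrite (finsler_metric_chart hM sL Di (DY.1 u Cu) (sZ.1 u Cu)) in E.
rewrite (finsler_metric_chart hM sL Di (sY.1 u Cu) (DZ.1 u Cu)) in E.
have dE W : pi_vfield A W -> D (gamma_field X) W u i =
    1 *: hv_torsion A D X W u i + drep TM0 i W u (0, X u i).
  by move=> sW; rewrite (hv_torsionE hM hD hR sX sW Di) scale1r subrK.
rewrite (dE Y sY) (dE Z sZ) in E.
rewrite chart_metric_linl (chart_metric_linr hM sL rz) !mul1r in E.
have F1 := finsler_metric_chart hM sL Di (TY.1 u Cu) (sZ.1 u Cu).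
have F2 := finsler_metric_chart hM sL Di (sY.1 u Cu) (TZ.1 u Cu).
rewrite -F1 -F2 in E.
have S1 := cartan_hv_torsion hC sX sY sZ Cu.
have S2 := metricC hM sL Cu (sY.1 u Cu) (TZ.1 u Cu).
exact: cartan_arith E (etrans S2 (esym S1)).
Qed.

(** The Cartan tensor vanishes: the Finsler metric is Riemannian. *)
Definition vertically_flat (L' : TM -> R) : Prop :=
  forall i z v a b, chart_range TM0 i z -> d_chart_metric A L' i z (0, v) a b = 0.

Lemma flat_hv_torsion X Y u : vertically_flat L -> pi_vfield A X ->
  pi_vfield A Y -> carrier TM0 u -> hv_torsion A D X Y u = 0.
Proof.
move=> flat sX sY Cu; have [i _ Di] := Cu.
have sT := hv_torsion_pi sX sY.
apply: (metric_nondegenerate Cu (sT.1 u Cu)).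
have := cartan_tensor sX sY sT Di; rewrite flat; last exact: range_coord.
by move/esym/eqP; rewrite mulf_eq0 pnatr_eq0 /= => /eqP.
Qed.

(** After decomposition of both fields, [Q = 0] kills the horizontal part of the
    torsion, [T = 0] the mixed parts, and the vertical part is always 0. *)
Lemma flat_torsion X Y u : vertically_flat L -> vfield TM0 X ->
  vfield TM0 Y -> carrier TM0 u -> torsion A D X Y u = 0.
Proof.
move=> flat sX sY Cu.
have rX := rho_field_pi hM sX; have rY := rho_field_pi hM sY.
have hX := horizontal_vfield hM hD hR rX; have hY := horizontal_vfield hM hD hR rY.
have [X' sX' XE] := horizontal_vertical hM hD hR sX.
have [Y' sY' YE] := horizontal_vertical hM hD hR sY.
have gX := gamma_field_vfield hM sX'; have gY := gamma_field_vfield hM sY'.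
have sX2 := vfield_add hM hX gX; have sY2 := vfield_add hM hY gY.
rewrite (torsion_congr hM hD sX sX2 sY sY2 Cu XE YE).
rewrite (torsionDl hM hD hX gX sY2 Cu).
rewrite (torsionC hM hD hX sY2 Cu) (torsionC hM hD gX sY2 Cu).
rewrite (torsionDl hM hD hY gY hX Cu) (torsionDl hM hD hY gY gX Cu).
have -> : torsion A D (horizontal A D (rho_field Y)) (horizontal A D (rho_field X)) u = 0.
  exact: (cartan_h_torsion hC rY rX Cu).
have -> : torsion A D (gamma_field Y') (horizontal A D (rho_field X)) u = 0.
  exact: flat_hv_torsion.
rewrite (torsionC hM hD hY gX Cu).
have -> : torsion A D (gamma_field X') (horizontal A D (rho_field Y)) u = 0.
  exact: flat_hv_torsion.
by rewrite (torsion_vertical hM hD sY' sX' Cu) !(oppr0, addr0).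
Qed.

Section Concurrent.
Variable zeta : TM -> I -> V.
Hypothesis hz : concurrent A D zeta.

Let sz : pi_vfield A zeta := hz.1.

(** The two conditions defining a concurrent field are those for a horizontal
    and for a vertical field. *)
Lemma connection_zeta W u : vfield TM0 W -> carrier TM0 u ->
  D W zeta u = - rho (W u).
Proof.
move=> sW Cu; have rW := rho_field_pi hM sW.
have hW := horizontal_vfield hM hD hR rW.
have [Y sY WE] := horizontal_vertical hM hD hR sW.
have gY := gamma_field_vfield hM sY.
rewrite (connection_congrl hM hD sW (vfield_add hM hW gY) sz Cu WE).
rewrite (connection_addl hD hW gY sz Cu).
have [-> _] := hz.2 _ u rW Cu; have [_ ->] := hz.2 _ u sY Cu.
by rewrite addr0.
Qed.

Definition zeta_norm u := g u (zeta u) (zeta u).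

Lemma along_zeta_norm i u W : vfield TM0 W -> domain TM0 i u ->
  along TM0 i u (W u) zeta_norm = - 2 * g u (rho (W u)) (zeta u).
Proof.
move=> sW Di; have Cu := domain_carrier Di.
have zT := sz.1 u Cu; have rT := rho_tangent hM Cu (sW.1 u Cu).
apply: etrans (cartan_metric hC sW sz sz Di) _.
rewrite (connection_zeta sW Cu).
rewrite (metricC hM sL Cu zT (tangentN rT)) (metricNl hM sL Cu rT zT).
by rewrite mulNr mulr_natl mulr2n opprD.
Qed.

Lemma d_zeta_norm i z (w : V * V) : chart_range TM0 i z ->
  'd (zeta_norm \o param TM0 i) z w
  = - 2 * chart_metric A L i z w.1 (rep TM0 i zeta z).
Proof.
move=> rz; have [Di cz] := param_range sA rz.
set u := param TM0 i z in Di cz *; have Cu := domain_carrier Di.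
have [wT wi] := extend_tangentP sA w Di.
have [W sW Wu] := vfield_extension hD hR Cu wT.
have := along_zeta_norm sW Di; rewrite /along Wu wi cz => ->.
have zT := sz.1 u Cu; have rT := rho_tangent hM Cu wT.
by rewrite (finsler_metric_chart hM sL Di rT zT) cz /rho wi.
Qed.

Lemma zeta_norm_smooth : smooth_fun TM0 zeta_norm.
Proof. exact: (metric_smooth hM sL). Qed.

(** The 1-form dual to [zeta] is [- 1/2] times the differential of
    [g(zeta, zeta)], whose vertical derivative is 0: by symmetry of second
    derivatives the 1-form does not depend on the direction [y]. *)
Lemma dual_form_vertical i z a v : chart_range TM0 i z ->
  'd (fun z => chart_metric A L i z a (rep TM0 i zeta z)) z ((0, v) : V * V) = 0.
Proof.
move=> rz; set q := zeta_norm \o param TM0 i.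
have sq : smooth_on (chart_range TM0 i) q := zeta_norm_smooth i.
have near_rz : \forall t \near z, chart_range TM0 i t by exact: open_nbhs_nbhs.
have N1 : \forall t \near z, - 2^-1 * 'd q t ((a, 0) : V * V) =
    chart_metric A L i t a (rep TM0 i zeta t).
  apply: filterS near_rz => t rt; rewrite d_zeta_norm //=.
  by rewrite mulrA mulrNN mulVf ?mul1r // pnatr_eq0.
have N2 : \forall t \near z, 0 = 'd q t ((0, v) : V * V).
  apply: filterS near_rz => t rt; rewrite d_zeta_norm //=.
  by rewrite chart_metric0l mulr0.
have D1 := is_diff_scale (is_diff_const (- 2^-1 : R) z)
  (smooth_is_diff (smooth_diff ((a, 0) : V * V) sq) rz).
apply: etrans (diff_val_at ((0, v) : V * V) (is_diff_near N1 D1)) _.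
have E := etrans (Schwarz_real ((a, 0) : V * V) ((0, v) : V * V) (@oi i) rz sq)
  (diff_val_at ((a, 0) : V * V) (is_diff_near N2 (is_diff_const (0 : R) z))).
apply: etrans (congr1 (fun t => 0 *: _ + - 2^-1 *: t) E) _.
by rewrite scale0r scaler0 addr0.
Qed.

(** The vertical derivative of [g(Y, zeta)] only sees [Y], by
    [dual_form_vertical], and [D_(gamma X) zeta = 0]: the metric axiom then says
    that the covariant and the ordinary derivative of [Y] have the same product
    with [zeta]. *)
Lemma hv_torsion_zeta X Y u : pi_vfield A X -> pi_vfield A Y ->
  carrier TM0 u -> g u (hv_torsion A D X Y u) (zeta u) = 0.
Proof.
move=> sX sY Cu; have [i _ Di] := Cu; have rz := range_coord Di.
have gX := gamma_field_vfield hM sX.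
have DY := connection_section hD gX sY.
have Tpi := hv_torsion_pi sX sY.
have zT := sz.1 u Cu.
have E := cartan_metric hC gX sY sz Di.
rewrite (along_metric hM sL _ sY sz Di) in E.
have [_ Dz] := hz.2 _ u sX Cu; rewrite Dz in E.
rewrite (metricC hM sL Cu (sY.1 u Cu) (tangent0 zT)) in E.
rewrite (metric0l hM sL Cu (sY.1 u Cu)) in E.
have B := dual_form_vertical (Y u i) (X u i) rz.
have Dm := is_diff_metric hM sL rz (is_diff_const (Y u i) _) (smooth_is_diff (sz.2 i) rz).
have B' : d_chart_metric A L i (coord TM0 i u) (0, X u i) (Y u i)
      (rep TM0 i zeta (coord TM0 i u))
    + (chart_metric A L i (coord TM0 i u) 0 (rep TM0 i zeta (coord TM0 i u))
      + chart_metric A L i (coord TM0 i u) (Y u i) (drep TM0 i zeta u (0, X u i)))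
    = 0 := etrans (esym (diff_val_at ((0, X u i) : V * V) Dm)) B.
rewrite chart_metric0l (rep_coord sA zeta Di) in B'.
rewrite (finsler_metric_chart hM sL Di (DY.1 u Cu) zT) in E.
have dE : D (gamma_field X) Y u i =
    1 *: hv_torsion A D X Y u i + drep TM0 i Y u (0, X u i).
  by rewrite (hv_torsionE hM hD hR sX sY Di) scale1r subrK.
rewrite dE chart_metric_linl mul1r in E.
rewrite -(finsler_metric_chart hM sL Di (Tpi.1 u Cu) zT) in E.
exact: dual_arith E B'.
Qed.

End Concurrent.

End Cartan.

(** * A concurrent field makes the metric Riemannian *)

Lemma double_arith (R : realType) (a b : R) : a + b = 2 * b -> 2^-1 * a = 2^-1 * b.
Proof. by move=> e; congr (_ * _); lra. Qed.

Lemma cancel_arith (R : realType) (a b c : R) : a + (0 + b) = c -> c = b -> a = 0.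
Proof. lra. Qed.

Lemma radial_arith (R : realType) (c c1 c2 r d e : R) :
  c1 + c = 0 -> c2 + 0 = 0 -> r * d = c1 - e * c2 -> c + r * d = 0.
Proof.
move=> h1 h2 ->; have -> : c2 = 0 by lra.
by rewrite mulr0 subr0 addrC.
Qed.

Lemma path_ge0 (R : realType) (r t : R) : 0 <= r -> t <= 1 -> 0 <= t ->
  0 <= 1 + t * (r - 1).
Proof.
move=> r0 t1 t0; have -> : 1 + t * (r - 1) = (1 - t) + t * r by ring.
by rewrite addr_ge0 ?subr_ge0 // mulr_ge0.
Qed.

Lemma path_le1 (R : realType) (r t : R) : r <= 1 -> 0 <= t ->
  1 + t * (r - 1) <= 1.
Proof. by move=> r1 t0; rewrite gerDl mulr_ge0_le0 // subr_le0. Qed.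

(** If the segment from [x] to [y] meets the origin, [y] is a negative multiple
    of [x], and the segment from [- x] to [y] avoids the origin. *)
Lemma segment_avoids0 (R : realType) (W : normedModType R) (x y : W) :
  x != 0 -> y != 0 -> exists e : R, (e = 1 \/ e = -1) /\
  forall r : R, 0 <= r <= 1 -> e *: x + r *: (y - e *: x) != 0.
Proof.
move=> x0 y0.
have [H|] := pselect (forall r : R, 0 <= r <= 1 -> 1 *: x + r *: (y - 1 *: x) != 0).
  by exists 1; split => //; left.
move=> /existsNP[r /not_implyP[/andP[r0 r1] /negP/negPn/eqP]].
rewrite scale1r => E.
have rN0 : r != 0.
  by apply/eqP => r0'; move: E; rewrite r0' scale0r addr0 => /eqP; apply/negP.
have rp : 0 < r by rewrite lt_def rN0.
have Ey : r *: y = (r - 1) *: x.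
  move: E; rewrite scalerBr addrCA => /eqP; rewrite addr_eq0 => /eqP ->.
  by rewrite scalerBl scale1r opprB.
have rN1 : r != 1.
  apply/eqP => r1'; move: Ey; rewrite r1' scale1r subrr scale0r.
  by move/eqP; apply/negP.
have r1p : 0 < 1 - r by rewrite subr_gt0 lt_def eq_sym rN1.
exists (-1); split; first by right.
move=> s /andP[s0 s1]; apply/negP => /eqP Es.
have E2 : (r * (-1 + s) + s * (r - 1)) *: x = 0.
  rewrite scalerDl -!scalerA -Ey !scalerA [s * r]mulrC -scalerA -!scalerA -scalerDr.
  rewrite -[RHS](scaler0 _ r) -Es; congr (_ *: _).
  by rewrite scaleN1r opprK scalerDr scalerDl scaleN1r addrA [RHS]addrAC.
move/eqP: E2; rewrite scaler_eq0 (negbTE x0) orbF => /eqP E3.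
have : 0 < r * (1 - s) + s * (1 - r).
  have [s10|s10] := eqVneq s 1.
    by rewrite s10 subrr mulr0 add0r mul1r.
  apply: ltr_pwDl; first by rewrite mulr_gt0 // subr_gt0 lt_def eq_sym s10.
  by rewrite mulr_ge0 // ltW.
have -> : r * (1 - s) + s * (1 - r) = - (r * (-1 + s) + s * (r - 1)) by ring.
by rewrite E3 oppr0 ltxx.
Qed.

Section DirectionIndependence.
Variables (R : realType) (n : nat) (M : topologicalType) (I : Type).
Variable A : atlas 'rV[R]_n M I.
Hypothesis hM : smooth_manifold A.

Local Notation V := 'rV[R]_n.
Local Notation TM := (M * (I -> V))%type.
Local Notation TM0 := (slit_tangent A).
Local Notation sA := (slit_atlas hM).
Local Notation bA := (base_atlas hM).
Let fV : findim V := findim_rV R n.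
Let fVV : findim (V * V)%type := findim_prod fV fV.

Variable L : TM -> R.
Hypothesis hL : finsler A L.

Lemma energy_smooth : smooth_fun TM0 (fun u => L u ^+ 2).
Proof.
have E : (fun u => L u ^+ 2) = (fun u => L u * L u).
  by apply/funext => u; rewrite expr2.
by rewrite E; apply: smooth_funM (finsler_smooth hL) (finsler_smooth hL); exact: sA.
Qed.

Let sL := energy_smooth.
Local Notation g := (finsler_metric L).
Let oi i : open (chart_range TM0 i) := atlas_open_range sA i.
Let sE i : smooth_on (chart_range TM0 i) (chart_energy A L i) := sL i.
Let cm := chart_metric A L.
Let dcm := d_chart_metric A L.

Lemma near_chart i z : chart_range TM0 i z -> \forall t \near z, chart_range TM0 i t.
Proof. by move=> rz; exact: open_nbhs_nbhs. Qed.

Lemma energy_homogeneous i z (t : R) : chart_range TM0 i z -> 0 < t ->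
  chart_energy A L i (z.1, t *: z.2) = t ^+ 2 * chart_energy A L i z.
Proof.
move=> rz t0; have [Di cz] := param_range sA rz.
set u := param TM0 i z in Di cz *; have [Dp uT un] := Di.
have Dt : domain TM0 i (u.1, t *: u.2).
  split => //=; first exact: (@tangentZ _ _ _ _ A (u.1, u.2)).
  by rewrite scaler_eq0 (negbTE un) orbF gt_eqF.
have -> : (z.1, t *: z.2) = coord TM0 i (u.1, t *: u.2) by rewrite -cz.
rewrite /chart_energy (atlas_coordK sA Dt) -exprMn.
by rewrite (finsler_homogeneous hL (domain_carrier Di) t0).
Qed.

Lemma is_diff_vertical_part (x : V * V) :
  is_diff x (fun z : V * V => ((0, z.2) : V * V)) (fun z => (0, z.2)).
Proof.
have [k kc kE] := inr_linear V V.
by have := is_diff_linear_comp kc (is_diff_snd x); rewrite kE.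
Qed.

(** Euler's relation: the energy is homogeneous of degree 2 in the fibre. *)
Lemma energy_euler i z : chart_range TM0 i z ->
  'd (chart_energy A L i) z ((0, z.2) : V * V) = 2 * chart_energy A L i z.
Proof.
move=> rz; set E := chart_energy A L i.
have dE := smooth_differentiable (sE i) rz.
rewrite -(derive1_line _ dE).
have N : \forall t \near (0 : R), E (z + t *: ((0, z.2) : V * V)) = (1 + t) ^+ 2 * E z.
  have : \forall t \near (0 : R), -1 < t.
    by apply: open_nbhs_nbhs; split; [exact: open_gt|rewrite /= ltrN10].
  apply: filterS => t t1.
  have -> : z + t *: ((0, z.2) : V * V) = (z.1, (1 + t) *: z.2).
    apply: injective_projections => /=; first by rewrite scaler0 addr0.
    by rewrite scalerDl scale1r.
  by apply: energy_homogeneous => //; rewrite -ltrBlDl sub0r.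
rewrite (derive1_near N) derive1E.
have D1 : is_derive (0 : R) (1 : R) (cst (1 : R) + id) (0 + 1).
  exact: is_deriveD.
have D2 := is_deriveX 2 D1.
have D3 := is_deriveM D2 (is_derive_cst (E z) (0 : R) (1 : R)).
have [_ D4] := D3.
apply: etrans D4 _ => /=.
rewrite /GRing.scale /= !fctE /=.
ring.
Qed.

(** The vertical derivative of Euler's relation. *)
Lemma metric_euler i z a : chart_range TM0 i z ->
  cm i z a z.2 = 2^-1 * 'd (chart_energy A L i) z ((0, a) : V * V).
Proof.
move=> rz; set E := chart_energy A L i.
have D1 := is_diff_along_field fVV (sE i) rz (is_diff_vertical_part z).
have D2 := is_diff_scale (is_diff_const (2 : R) z) (smooth_is_diff (sE i) rz).
have N : \forall t \near z, 2 *: E t = 'd E t ((0, t.2) : V * V).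
  by have := near_chart rz; apply: filterS => t rt; rewrite energy_euler.
have E1 := diff_val_at ((0, a) : V * V) (is_diff_near N D2).
have E2 := diff_val_at ((0, a) : V * V) D1.
have {}E2 := etrans (esym E2) E1.
apply: double_arith; apply: etrans E2 _.
by rewrite scale0r add0r.
Qed.

(** The vertical derivative of [metric_euler]: the derivative of [g(a, y)] along
    [v] is already [g(a, v)], which leaves nothing for the derivative of [g]. *)
Lemma d_metric_eta i z v a : chart_range TM0 i z -> dcm i z (0, v) a z.2 = 0.
Proof.
move=> rz.
have D1 := is_diff_metric hM sL rz (is_diff_const a z) (is_diff_snd z).
have D2 := is_diff_scale (is_diff_const (2^-1 : R) z)
  (smooth_is_diff (smooth_diff ((0, a) : V * V) (sE i)) rz).
have N : \forall t \near z,
    2^-1 *: 'd (chart_energy A L i) t ((0, a) : V * V) = cm i t a t.2.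
  by have := near_chart rz; apply: filterS => t rt; rewrite metric_euler.
have E1 := diff_val_at ((0, v) : V * V) (is_diff_near N D2).
have E2 : dcm i z (0, v) a z.2 + (cm i z 0 z.2 + cm i z a v) = _ :=
  etrans (esym (diff_val_at ((0, v) : V * V) D1)) E1.
have c0 : cm i z 0 z.2 = 0 by exact: chart_metric0l.
rewrite c0 in E2; apply: (cancel_arith E2).
rewrite scale0r add0r; exact: (chart_metricC hM sL rz v a).
Qed.

(** Differentiating the relation [C(w, a, b) = 0] in a vertical direction [e],
    and moving [w] to the outside by symmetry of second derivatives. *)
Lemma transverse_relation i (w : V * V -> V) a b :
  smooth_on (chart_range TM0 i) w ->
  (forall z, chart_range TM0 i z -> dcm i z (0, w z) a b = 0) ->
  forall z e, chart_range TM0 i z ->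
    'd (fun t => dcm i t (0, e) a b) z ((0, w z) : V * V)
    + dcm i z (0, 'd w z ((0, e) : V * V)) a b = 0.
Proof.
move=> sw w0 z e rz.
have sf := chart_metric_smooth hM sL i a b.
have [k kc kE] := inr_linear V V.
have DW := is_diff_linear_comp kc (smooth_is_diff sw rz).
rewrite kE in DW.
have D1 := is_diff_along_field fVV sf rz DW.
have N : \forall t \near z, 0 = 'd (fun z => chart_metric A L i z a b) t ((0, w t) : V * V).
  by have := near_chart rz; apply: filterS => t rt; exact: esym (w0 t rt).
have E1 := diff_val_at ((0, e) : V * V) (is_diff_near N (is_diff_const (0 : R) z)).
have E2 := etrans (esym (diff_val_at ((0, e) : V * V) D1)) E1.
apply: etrans E2; congr (_ + _).
exact: (Schwarz_real ((0, e) : V * V) ((0, w z) : V * V) (@oi i) rz sf).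
Qed.

Variable D : (TM -> I -> V * V) -> (TM -> I -> V) -> (TM -> I -> V).
Hypothesis hC : cartan_connection A D L.
Variable zeta : TM -> I -> V.
Hypothesis hz : concurrent A D zeta.

Let hD := cartan_linear hC.
Let hR := cartan_regular hC.
Let sz : pi_vfield A zeta := hz.1.
Let L_pos := finsler_posdef hL.

Lemma pi_extension_chart i z a : chart_range TM0 i z ->
  exists X, [/\ pi_vfield A X, domain TM0 i (param TM0 i z),
    coord TM0 i (param TM0 i z) = z & X (param TM0 i z) i = a].
Proof.
move=> rz; have [Di cz] := param_range sA rz.
have [Di1 _ _] := Di; have [eT eE] := extend_tangentP bA a Di1.
have [X sX Xu] := pi_extension hM hR (domain_carrier Di) eT.
by exists X; split => //; rewrite Xu.
Qed.

Lemma d_metric_zeta i z v a : chart_range TM0 i z ->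
  dcm i z (0, v) a (rep TM0 i zeta z) = 0.
Proof.
move=> rz; have [X [sX Di cz Xv]] := pi_extension_chart v rz.
have [Y [sY _ _ Ya]] := pi_extension_chart a rz.
have := cartan_tensor hM sL hC sX sY sz Di.
rewrite (hv_torsion_zeta hM sL hC hz sX sY (domain_carrier Di)) mulr0.
by rewrite Xv Ya cz.
Qed.

(** The symmetry axiom moves [zeta] out of the torsion, and
    [hv_torsion_zeta] applies. *)
Lemma zeta_torsion X u : pi_vfield A X -> carrier TM0 u ->
  hv_torsion A D X zeta u = 0.
Proof.
move=> sX Cu; have sT := hv_torsion_pi hM hC sX sz.
apply: (metric_nondegenerate L_pos Cu (sT.1 u Cu)).
rewrite (cartan_hv_torsion hC sX sz sT Cu).
exact: (hv_torsion_zeta hM sL hC hz).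
Qed.

(** The covariant vertical derivative of [zeta] is 0, and it differs from the
    ordinary one by [T(., zeta) = 0]. *)
Lemma d_zeta_vertical i z v : chart_range TM0 i z ->
  'd (rep TM0 i zeta) z ((0, v) : V * V) = 0.
Proof.
move=> rz; have [X [sX Di cz Xv]] := pi_extension_chart v rz.
have Cu := domain_carrier Di.
have := hv_torsionE hM hD hR sX sz Di.
rewrite (zeta_torsion sX Cu) (hz.2 _ _ sX Cu).2 Xv /drep cz.
move=> E; apply/eqP; rewrite -oppr_eq0; apply/eqP.
by apply: etrans (esym E); exact: (esym (sub0r _)).
Qed.

(** At a zero of [zeta], a horizontal derivative of [g(T(X, Y), zeta) = 0] in
    the direction of [T(X, Y)] gives [g(T(X, Y), T(X, Y)) = 0]. *)
Lemma torsion_at_zero X Y u : pi_vfield A X -> pi_vfield A Y ->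
  carrier TM0 u -> zeta u = 0 -> hv_torsion A D X Y u = 0.
Proof.
move=> sX sY Cu z0; have [i _ Di] := Cu.
set T := hv_torsion A D X Y.
have sT : pi_vfield A T := hv_torsion_pi hM hC sX sY.
apply: (metric_nondegenerate L_pos Cu (sT.1 u Cu)).
have hT := horizontal_vfield hM hD hR sT.
have DT := connection_section hD hT sT.
have E := cartan_metric hC hT sT sz Di.
have a0 : along TM0 i u (horizontal A D T u) (fun a => g a (T a) (zeta a)) = 0.
  have N : \forall t \near coord TM0 i u,
      0 = ((fun a => g a (T a) (zeta a)) \o param TM0 i) t.
    have := near_chart (range_coord Di); apply: filterS => t rt.
    have [Dt _] := param_range sA rt.
    by rewrite /= (hv_torsion_zeta hM sL hC hz sX sY (domain_carrier Dt)).
  exact: (diff_val_at _ (is_diff_near N (is_diff_const (0 : R) _))).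
rewrite a0 z0 (connection_zeta hM hC hz hT Cu) (rho_horizontal hM hD hR sT Cu) in E.
have TT := sT.1 u Cu; have zT := tangent0 TT.
rewrite (metricC hM sL Cu (DT.1 u Cu) zT) (metric0l hM sL Cu (DT.1 u Cu)) in E.
rewrite (metricC hM sL Cu TT (tangentN TT)) (metricNl hM sL Cu TT TT) add0r in E.
by apply/eqP; rewrite -oppr_eq0 -E.
Qed.

(** Along a segment from [zeta] or [- zeta] to [y] in a fibre, the tensor [C] is
    constant in the direction [zeta] and homogeneous of degree -1, so that
    [r C] is constant, hence 0, along the segment. A Finsler metric with a
    concurrent field is thus Riemannian. *)
Theorem concurrent_flat : vertically_flat A L.
Proof.
move=> i z e a b rz.
have [ze|zN] := eqVneq (rep TM0 i zeta z) 0.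
  have [X [sX Di cz Xe]] := pi_extension_chart e rz.
  have [Y [sY _ _ Ya]] := pi_extension_chart a rz.
  have [Z [sZ _ _ Zb]] := pi_extension_chart b rz.
  have Cu := domain_carrier Di; have [Di1 _ _] := Di.
  have z0 := tangent_zero_chart Di1 (sz.1 _ Cu) ze.
  have := cartan_tensor hM sL hC sX sY sZ Di.
  rewrite (torsion_at_zero sX sY Cu z0) (metric0l hM sL Cu (sZ.1 _ Cu)) mulr0.
  by rewrite Xe Ya Zb cz.
have [rx z2N] := (slit_range hM i z).1 rz.
(* The fibre without its origin is not star-shaped about [zeta], whence
   the choice of the sign [s]. *)
have [s [_ sP]] := segment_avoids0 zN z2N.
set x0 := rep TM0 i zeta z in zN sP.
pose base : V * V := (z.1, s *: x0).
pose dir : V * V := (0, z.2 - s *: x0).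
have pathE r : base + r *: dir = (z.1, s *: x0 + r *: (z.2 - s *: x0)).
  by apply: injective_projections => //=; rewrite scaler0 addr0.
have rpath r : 0 <= r <= 1 -> chart_range TM0 i (base + r *: dir).
  by move=> r01; apply/(slit_range hM); rewrite pathE /=; split=> //; exact: sP.
have endE : base + 1 *: dir = z.
  by rewrite pathE scale1r addrCA subrr addr0; case: (z).
(* [zeta] is constant along the path, as it does not depend on [y]. *)
have zpath r : 0 <= r <= 1 -> rep TM0 i zeta (base + r *: dir) = x0.
  move=> /andP[r0 r1].
  have -> : base + r *: dir = z + (r - 1) *: dir.
    by rewrite -[in RHS]endE -addrA -scalerDl [1 + _]addrC subrK.
  apply: (segment_cst fV) => t /andP[t0 t1].
  have -> : z + t *: ((r - 1) *: dir) = base + (1 + t * (r - 1)) *: dir.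
    by rewrite -[in LHS]endE -addrA scalerA -scalerDl.
  have rt : chart_range TM0 i (base + (1 + t * (r - 1)) *: dir).
    apply: rpath; apply/andP; split; first exact: path_ge0.
    exact: path_le1.
  split; first exact: smooth_differentiable (sz.2 i) rt.
  have -> : (r - 1) *: dir = ((0, (r - 1) *: (z.2 - s *: x0)) : V * V).
    by apply: injective_projections => //=; rewrite scaler0.
  exact: d_zeta_vertical.
pose c t := dcm i t (0, e) a b.
have sc : smooth_on (chart_range TM0 i) c.
  exact: smooth_diff (chart_metric_smooth hM sL i a b).
have sym t u v w : chart_range TM0 i t -> dcm i t (0, w) u v = dcm i t (0, u) v w.
  move=> rt; rewrite -[LHS]/(d_chart_metric A L i t (0, w) u v).
  rewrite (d_chart_metricCA hM sL w u v rt).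
  exact: (d_chart_metricC hM sL (0, u) w v rt).
rewrite -[LHS]/(c z) -endE scale1r; apply: radial_zero => r r01.
have rr := rpath r r01; set t := base + r *: dir in rr *.
split; first exact: smooth_differentiable sc rr.
(* Euler: [C] is homogeneous of degree -1. *)
have H1 : 'd c t ((0, t.2) : V * V) + c t = 0.
  have s2 : smooth_on (chart_range TM0 i) (fun z : V * V => z.2).
    by have := smooth_snd (@oi i) (smooth_id (@oi i)).
  have h q : chart_range TM0 i q -> dcm i q (0, q.2) a b = 0.
    by move=> rq; rewrite sym //; exact: d_metric_eta.
  have := transverse_relation s2 h e rr.
  by rewrite (diff_val_at ((0, e) : V * V) (is_diff_snd t)).
(* [C] does not change in the direction of [zeta]. *)
have H2 : 'd c t ((0, x0) : V * V) + 0 = 0.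
  have h q : chart_range TM0 i q -> dcm i q (0, rep TM0 i zeta q) a b = 0.
    by move=> rq; rewrite sym //; exact: d_metric_zeta.
  have T : 'd c t ((0, rep TM0 i zeta t) : V * V)
      + dcm i t (0, 'd (rep TM0 i zeta) t ((0, e) : V * V)) a b = 0.
    exact: (@transverse_relation i (rep TM0 i zeta) a b (sz.2 i) h t e rr).
  rewrite (d_zeta_vertical e rr) (zpath r r01) in T.
  by apply: etrans T; congr (_ + _); exact: esym (linear0 _).
apply: (radial_arith (e := s) H1 H2).
have -> : r * 'd c t dir = 'd c t (r *: dir) by exact: esym (linearZ _ _).
have -> : r *: dir = ((0, t.2) : V * V) - s *: ((0, x0) : V * V).
  rewrite /t pathE; apply: injective_projections => /=.
    by rewrite !scaler0 subr0.
  by rewrite [RHS]addrAC subrr add0r.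
exact: etrans (linearB _ _ _) (congr2 (fun p q => p - q) erefl (linearZ _ _)).
Qed.

End DirectionIndependence.

(** * The metric of the energy beta-change *)

Lemma half_double (R : realType) (a b c da db : R) : da = a -> db = 0 ->
  2^-1 * (0 *: (c *: b) + 2 *: (da *: b + c *: db)) = a * b.
Proof.
move=> -> ->; change (2^-1 * (0 * (c * b) + 2 * (a * b + c * 0)) = a * b).
by field.
Qed.

Lemma product_rule0 (R : realType) (x p q r s : R) :
  x = 0 -> p = 0 -> s = 0 -> x + (p *: q + r *: s) = 0.
Proof. by move=> -> -> ->; rewrite scale0r scaler0 !addr0. Qed.

Section EnergyBetaChange.
Variables (R : realType) (n : nat) (M : topologicalType) (I : Type).
Variable A : atlas 'rV[R]_n M I.
Hypothesis hM : smooth_manifold A.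

Local Notation V := 'rV[R]_n.
Local Notation TM := (M * (I -> V))%type.
Local Notation TM0 := (slit_tangent A).
Local Notation sA := (slit_atlas hM).
Local Notation bA := (base_atlas hM).
Let fV : findim V := findim_rV R n.

Variable L : TM -> R.
Hypothesis hL : finsler A L.
Variable D : (TM -> I -> V * V) -> (TM -> I -> V) -> (TM -> I -> V).
Hypothesis hC : cartan_connection A D L.
Variable zeta : TM -> I -> V.
Hypothesis hz : concurrent A D zeta.

Let sz : pi_vfield A zeta := hz.1.
Let sL := energy_smooth hM hL.
Local Notation g := (finsler_metric L).
Let oi i : open (chart_range TM0 i) := atlas_open_range sA i.
Let sE i : smooth_on (chart_range TM0 i) (chart_energy A L i) := sL i.
Let cm := chart_metric A L.
Let dcm := d_chart_metric A L.
Let flat := concurrent_flat hM hL hC hz.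

Local Notation Lt := (energy_beta_change L zeta).

Definition dual_form i z (a : V) : R := chart_metric A L i z a (rep TM0 i zeta z).

Definition chart_B i z : R := dual_form i z z.2.

Lemma changed_energyE u :
  Lt u ^+ 2 = L u ^+ 2 + g u (zeta u) (@eta R n M I u) ^+ 2.
Proof. by rewrite sqr_sqrtr // addr_ge0 // sqr_ge0. Qed.

Lemma changed_energy_smooth : smooth_fun TM0 (fun u => Lt u ^+ 2).
Proof.
have sB := metric_smooth hM sL sz (eta_pi hM).
have := smooth_funD sA sL (smooth_funM sA sB sB).
rewrite (_ : (fun p => _) = (fun u => Lt u ^+ 2)) //.
by apply/funext => u; rewrite changed_energyE [X in _ = _ + X]expr2.
Qed.

Lemma changed_chart_energy i z : chart_range TM0 i z ->
  chart_energy A Lt i z = chart_energy A L i z + chart_B i z ^+ 2.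
Proof.
move=> rz; have [Di cz] := param_range sA rz.
have Cu := domain_carrier Di; have [_ uT _] := Di.
rewrite /chart_energy changed_energyE; congr (_ + _ ^+ 2).
rewrite (finsler_metric_chart hM sL Di (sz.1 _ Cu) uT) cz.
rewrite (chart_metricC hM sL rz) /chart_B /dual_form.
by congr (chart_metric _ _ _ _ _ _); rewrite -[in RHS]cz.
Qed.

Lemma dual_form_diff i z a : chart_range TM0 i z ->
  differentiable (dual_form i ^~ a) z.
Proof.
move=> rz; have S := smooth_metric hM sL (smooth_cst a (@oi i)) (sz.2 i).
exact: smooth_differentiable S rz.
Qed.

Lemma d_dual_form i z a v : chart_range TM0 i z ->
  'd (dual_form i ^~ a) z ((0, v) : V * V) = 0.
Proof. exact: (dual_form_vertical hM sL hC hz). Qed.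

Lemma chart_B_smooth i : smooth_on (chart_range TM0 i) (chart_B i).
Proof.
have s2 : smooth_on (chart_range TM0 i) (fun z : V * V => z.2).
  by have := smooth_snd (@oi i) (smooth_id (@oi i)).
exact: (smooth_metric hM sL s2 (sz.2 i)).
Qed.

(** [B] is the value at [y] of a 1-form that does not depend on [y]. *)
Lemma d_chart_B i z v : chart_range TM0 i z ->
  'd (chart_B i) z ((0, v) : V * V) = dual_form i z v.
Proof.
move=> rz.
have Dm := is_diff_metric hM sL rz (is_diff_snd z) (smooth_is_diff (sz.2 i) rz).
apply: etrans (diff_val_at ((0, v) : V * V) Dm) _.
have F := flat v z.2 (rep TM0 i zeta z) rz.
have Z : chart_metric A L i z z.2 ('d (rep TM0 i zeta) z ((0, v) : V * V)) = 0.
  rewrite (d_zeta_vertical hM hL hC hz v rz) (chart_metricC hM sL rz).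
  exact: chart_metric0l.
apply: etrans (congr2 (fun p q => p + q) F (congr2 (fun p q => p + q) erefl Z)) _.
by rewrite add0r addr0.
Qed.

Lemma d_changed_energy i z b : chart_range TM0 i z ->
  'd (chart_energy A Lt i) z ((0, b) : V * V)
  = 'd (chart_energy A L i) z ((0, b) : V * V)
    + 2 * (chart_B i z * dual_form i z b).
Proof.
move=> rz; have DB := smooth_is_diff (@chart_B_smooth i) rz.
have D1 := is_diff_add (smooth_is_diff (sE i) rz) (is_diff_scale DB DB).
have N : \forall t \near z, chart_energy A L i t + chart_B i t *: chart_B i t
    = chart_energy A Lt i t.
  have := near_chart hM rz; apply: filterS => t rt.
  by rewrite changed_chart_energy // expr2.
apply: etrans (diff_val_at ((0, b) : V * V) (is_diff_near N D1)) _.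
congr (_ + _); rewrite d_chart_B // mulr_natl mulr2n.
by rewrite /GRing.scale /= mulrC.
Qed.

(** The new metric is [g + zeta^* (x) zeta^*], as the 1-form dual to [zeta] does
    not depend on the direction. *)
Lemma changed_chart_metric i z a b : chart_range TM0 i z ->
  chart_metric A Lt i z a b
  = chart_metric A L i z a b + dual_form i z a * dual_form i z b.
Proof.
move=> rz.
have DB := smooth_is_diff (@chart_B_smooth i) rz.
have Db := differentiableP (dual_form_diff b rz).
have D1 := is_diff_add (smooth_is_diff (smooth_diff ((0, b) : V * V) (sE i)) rz)
  (is_diff_scale (is_diff_const (2 : R) z) (is_diff_scale DB Db)).
have N : \forall t \near z, 'd (chart_energy A L i) t ((0, b) : V * V)
    + 2 *: (chart_B i t *: dual_form i t b)
    = 'd (chart_energy A Lt i) t ((0, b) : V * V).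
  have := near_chart hM rz; apply: filterS => t rt.
  exact: esym (d_changed_energy b rt).
have E := diff_val_at ((0, a) : V * V) (is_diff_near N D1).
rewrite /chart_metric.
apply: etrans (congr1 (fun x => 2^-1 * x) E) _.
rewrite mulrDr; congr (_ + _).
exact: half_double (d_chart_B a rz) (d_dual_form b a rz).
Qed.

(** The vertical derivatives of [g] and of the dual 1-form are both 0. *)
Lemma changed_flat : vertically_flat A Lt.
Proof.
move=> i z v a b rz.
have D1 := is_diff_add (smooth_is_diff (chart_metric_smooth hM sL i a b) rz)
  (is_diff_scale (differentiableP (dual_form_diff a rz))
     (differentiableP (dual_form_diff b rz))).
have N : \forall t \near z, chart_metric A L i t a b
    + dual_form i t a *: dual_form i t b = chart_metric A Lt i t a b.
  have := near_chart hM rz; apply: filterS => t rt.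
  by rewrite changed_chart_metric.
apply: etrans (diff_val_at ((0, v) : V * V) (is_diff_near N D1)) _.
exact: product_rule0 (flat v a b rz) (d_dual_form a v rz) (d_dual_form b v rz).
Qed.

Lemma changed_metric u v w : carrier TM0 u ->
  tangent A u.1 v -> tangent A u.1 w ->
  finsler_metric Lt u v w = g u v w + g u v (zeta u) * g u w (zeta u).
Proof.
move=> Cu vT wT; have [i _ Di] := Cu; have zT := sz.1 u Cu.
rewrite (finsler_metric_chart hM changed_energy_smooth Di vT wT).
rewrite (finsler_metric_chart hM sL Di vT wT).
rewrite (finsler_metric_chart hM sL Di vT zT).
rewrite (finsler_metric_chart hM sL Di wT zT).
rewrite (changed_chart_metric _ _ (range_coord Di)) /dual_form.
by rewrite (rep_coord sA zeta Di).
Qed.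

Lemma changed_posdef u v : carrier TM0 u -> tangent A u.1 v -> v != 0 ->
  0 < finsler_metric Lt u v v.
Proof.
move=> Cu vT v0; rewrite changed_metric //.
apply: ltr_pwDl; first exact: (finsler_posdef hL).
by rewrite -expr2 sqr_ge0.
Qed.

End EnergyBetaChange.

(** * Curvature and the first Bianchi identity *)

(** The Koszul argument: a trilinear form symmetric in its first two arguments
    and skew in the last two is 0. *)
Lemma symmetric_skew_zero (R : realType) (T : Type) (F : T -> T -> T -> R)
    (P : T -> Prop) :
  (forall x y z, P x -> P y -> P z -> F x y z = F y x z) ->
  (forall x y z, P x -> P y -> P z -> F x y z = - F x z y) ->
  forall x y z, P x -> P y -> P z -> F x y z = 0.
Proof.
move=> S K x y z Px Py Pz.
have E : F x y z = - F x y z.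
  apply: etrans (S x y z Px Py Pz) _.
  by rewrite (K y x z) // (S y z x) // (K z y x) // (S z x y) // (K x z y) // !opprK.
lra.
Qed.

Section Families.
Variables (R : realType) (n : nat) (I : Type).
Local Notation V := 'rV[R]_n.

Let fV : findim V := findim_rV R n.

Lemma bianchi_arith (xy xz yx yz zx zy lx ly lz tx ty tz : I -> V) :
  xy - xz = lx + tx -> yz - yx = ly + ty -> zx - zy = lz + tz ->
  tx + ty + tz = 0 ->
  (- xy + yx + lz) + (- yz + zy + lx) + (- zx + xz + ly) = 0.
Proof.
move=> E1 E2 E3 E4.
have -> : (- xy + yx + lz) + (- yz + zy + lx) + (- zx + xz + ly)
   = (lx + ly + lz) - ((xy - xz) + (yz - yx) + (zx - zy)).
  apply/funext => i; rewrite !fctE; apply: (findim_eq fV) => l.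
  by rewrite !(linearD l, linearN l); ring.
rewrite E1 E2 E3 -[RHS]oppr0 -E4.
apply/funext => i; rewrite !fctE; apply: (findim_eq fV) => l.
by rewrite !(linearD l, linearN l); ring.
Qed.

Lemma curvatureC_arith (x y z : I -> V) : - x + y - z = - (- y + x + z).
Proof.
apply/funext => i; rewrite !fctE; apply: (findim_eq fV) => l.
by rewrite !(linearD l, linearN l); ring.
Qed.

Lemma curvatureD_arith (x x' y y' z z' : I -> V) :
  - (x + x') + (y + y') + (z + z') = (- x + y + z) + (- x' + y' + z').
Proof.
apply/funext => i; rewrite !fctE; apply: (findim_eq fV) => l.
by rewrite !(linearD l, linearN l); ring.
Qed.

End Families.

Section Curvature.
Variables (R : realType) (n : nat) (M : topologicalType) (I : Type).
Variable A : atlas 'rV[R]_n M I.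
Hypothesis hM : smooth_manifold A.

Local Notation V := 'rV[R]_n.
Local Notation TM := (M * (I -> V))%type.
Local Notation TM0 := (slit_tangent A).
Local Notation sA := (slit_atlas hM).
Local Notation bA := (base_atlas hM).
Let fV : findim V := findim_rV R n.
Let fVV : findim (V * V)%type := findim_prod fV fV.

Variable D : (TM -> I -> V * V) -> (TM -> I -> V) -> (TM -> I -> V).
Hypothesis hD : linear_connection A D.

Let sD X Y := @connection_section _ _ _ _ _ _ hD X Y.
Let sl := lie_vfield0 hM.

Lemma pi_opp X : pi_vfield A X -> pi_vfield A (fun u => - X u).
Proof.
move=> sX; apply: (pi_congr hM) (pi_sub hM (pi_zero hM) sX) => u _.
by rewrite sub0r.
Qed.

Lemma curvature_pi X Y Z : vfield TM0 X -> vfield TM0 Y -> pi_vfield A Z ->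
  pi_vfield A (curvature A D X Y Z).
Proof.
move=> sX sY sZ; apply: (pi_add hM); last exact: sD (sl sX sY) sZ.
apply: (pi_add hM); last exact: sD sY (sD sX sZ).
exact: pi_opp (sD sX (sD sY sZ)).
Qed.

Lemma lieC (X Y : TM -> I -> V * V) u : lie TM0 X Y u = - lie TM0 Y X u.
Proof.
apply/funext => i; rewrite -[RHS]/(- (lie TM0 Y X u i)) /lie.
by case: asboolP => _; rewrite ?opprB ?oppr0.
Qed.

Lemma lieDl X X' Y u : vfield TM0 X -> vfield TM0 X' -> vfield TM0 Y ->
  carrier TM0 u ->
  lie TM0 (fun a => X a + X' a) Y u = lie TM0 X Y u + lie TM0 X' Y u.
Proof.
move=> sX sX' sY Cu; have [i _ Di] := Cu.
have sS := vfield_add hM sX sX'.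
apply: (tangent_eq Di).
- exact: (sl sS sY).1.
- by have := tangent_linear 1 ((sl sX sY).1 u Cu) ((sl sX' sY).1 u Cu); rewrite scale1r.
have -> : (lie TM0 X Y u + lie TM0 X' Y u) i = lie TM0 X Y u i + lie TM0 X' Y u i by [].
rewrite !lieE //.
have E1 : drep TM0 i Y u ((X u + X' u) i) =
    drep TM0 i Y u (X u i) + drep TM0 i Y u (X' u i) by exact: linearD.
have E2 : drep TM0 i (fun a => X a + X' a) u (Y u i) =
    drep TM0 i X u (Y u i) + drep TM0 i X' u (Y u i).
  exact: (diff_val_at (Y u i) (is_diff_add (rep_is_diff sX Di) (rep_is_diff sX' Di))).
rewrite E1 E2 opprD.
exact: addrACA.
Qed.

Lemma lie_congr X X' Y u : vfield TM0 X -> vfield TM0 X' -> carrier TM0 u ->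
  (forall a, carrier TM0 a -> X a = X' a) -> lie TM0 X Y u = lie TM0 X' Y u.
Proof.
move=> sX sX' Cu XX'; apply/funext => i.
have [Di|Di] := pselect (domain TM0 i u); last by rewrite /lie !asboolF.
apply: etrans (lieE X Y Di) (etrans _ (esym (lieE X' Y Di))).
rewrite (XX' u Cu); apply: (congr2 (fun p q : V * V => p - q)); first by [].
have N : \forall z \near coord TM0 i u, rep TM0 i X' z = rep TM0 i X z.
  have := near_range sA Di; apply: filterS => z rz.
  have [Dz _] := param_range sA rz.
  by rewrite /rep XX' //; exact: domain_carrier Dz.
exact: (diff_val_at (Y u i) (is_diff_near N (rep_is_diff sX' Di))).
Qed.

Lemma connection_oppl X Y u : vfield TM0 X -> pi_vfield A Y -> carrier TM0 u ->
  D (fun a => - X a) Y u = - D X Y u.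
Proof.
move=> sX sY Cu; have := connection_subl hM hD (vfield_zero hM) sX sY Cu.
rewrite (connection_zerol hM hD (vfield_zero hM) sY Cu) // sub0r => <-.
by congr (D _ Y u); apply/funext => a; rewrite sub0r.
Qed.

Lemma curvatureC X Y Z u : vfield TM0 X -> vfield TM0 Y -> pi_vfield A Z ->
  carrier TM0 u -> curvature A D X Y Z u = - curvature A D Y X Z u.
Proof.
move=> sX sY sZ Cu; rewrite /curvature.
have -> : lie TM0 X Y = (fun a => - lie TM0 Y X a).
  by apply/funext => a; exact: lieC.
rewrite (connection_oppl (sl sY sX) sZ Cu).
exact: curvatureC_arith.
Qed.

Lemma curvature_congrl X X' Y Z u : vfield TM0 X -> vfield TM0 X' ->
  vfield TM0 Y -> pi_vfield A Z -> carrier TM0 u ->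
  (forall a, carrier TM0 a -> X a = X' a) ->
  curvature A D X Y Z u = curvature A D X' Y Z u.
Proof.
move=> sX sX' sY sZ Cu XX'; rewrite /curvature.
rewrite (connection_congrl hM hD sX sX' (sD sY sZ) Cu XX').
rewrite (connection_congrr hM hD sY (sD sX sZ) (sD sX' sZ) Cu); last first.
  by move=> a Ca; exact: (connection_congrl hM hD).
have E a (Ca : carrier TM0 a) := lie_congr Y sX sX' Ca XX'.
apply: (congr2 (fun p q : I -> V => p + q)); first by [].
exact: (connection_congrl hM hD (sl sX sY) (sl sX' sY) sZ Cu E).
Qed.

Lemma curvature_congrr X Y Z Z' u : vfield TM0 X -> vfield TM0 Y ->
  pi_vfield A Z -> pi_vfield A Z' -> carrier TM0 u ->
  (forall a, carrier TM0 a -> Z a = Z' a) ->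
  curvature A D X Y Z u = curvature A D X Y Z' u.
Proof.
move=> sX sY sZ sZ' Cu ZZ'; rewrite /curvature.
rewrite (connection_congrr hM hD sX (sD sY sZ) (sD sY sZ') Cu); last first.
  by move=> a Ca; exact: (connection_congrr hM hD).
rewrite (connection_congrr hM hD sY (sD sX sZ) (sD sX sZ') Cu); last first.
  by move=> a Ca; exact: (connection_congrr hM hD).
apply: (congr2 (fun p q : I -> V => p + q)); first by [].
exact: (connection_congrr hM hD (sl sX sY) sZ sZ' Cu ZZ').
Qed.

Lemma curvatureDl X X' Y Z u : vfield TM0 X -> vfield TM0 X' ->
  vfield TM0 Y -> pi_vfield A Z -> carrier TM0 u ->
  curvature A D (fun a => X a + X' a) Y Z u =
  curvature A D X Y Z u + curvature A D X' Y Z u.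
Proof.
move=> sX sX' sY sZ Cu; rewrite /curvature.
have sS := vfield_add hM sX sX'.
rewrite (connection_addl hD sX sX' (sD sY sZ) Cu).
rewrite (connection_congrr hM hD sY (sD sS sZ) (pi_add hM (sD sX sZ) (sD sX' sZ)) Cu);
  last by move=> a Ca; exact: (connection_addl hD).
rewrite (connection_addr hD sY (sD sX sZ) (sD sX' sZ) Cu).
have E a (Ca : carrier TM0 a) := lieDl sX sX' sY Ca.
have El := connection_congrl hM hD (sl sS sY)
  (vfield_add hM (sl sX sY) (sl sX' sY)) sZ Cu E.
have El2 := etrans El (connection_addl hD (sl sX sY) (sl sX' sY) sZ Cu).
apply: etrans (congr2 (fun p q : I -> V => p + q) erefl El2) _.
exact: curvatureD_arith.
Qed.

(** Without torsion [D_Y rho Z - D_Z rho Y = rho [Y, Z]]. Applied twice, this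
    turns the cyclic sum of the curvatures into the cyclic sum of
    [rho [X, [Y, Z]]], up to sign, and the Jacobi identity concludes. *)
Lemma bianchi X Y Z u :
  (forall X Y a, vfield TM0 X -> vfield TM0 Y -> carrier TM0 a ->
     torsion A D X Y a = 0) ->
  vfield TM0 X -> vfield TM0 Y -> vfield TM0 Z -> carrier TM0 u ->
  curvature A D X Y (rho_field Z) u + curvature A D Y Z (rho_field X) u
  + curvature A D Z X (rho_field Y) u = 0.
Proof.
move=> T0 sX sY sZ Cu; rewrite /curvature.
have r := rho_field_pi hM.
have tf W W' a : vfield TM0 W -> vfield TM0 W' -> carrier TM0 a ->
    D W (rho_field W') a - D W' (rho_field W) a = rho_field (lie TM0 W W') a.
  by move=> sW sW' Ca; apply/subr0_eq; exact: T0.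
have tf2 W W1 W2 : vfield TM0 W -> vfield TM0 W1 -> vfield TM0 W2 ->
    D W (D W1 (rho_field W2)) u - D W (D W2 (rho_field W1)) u
    = D (lie TM0 W1 W2) (rho_field W) u + rho_field (lie TM0 W (lie TM0 W1 W2)) u.
  move=> sW s1 s2; have s12 := sl s1 s2.
  rewrite -(connection_subr hM hD sW (sD s1 (r _ s2)) (sD s2 (r _ s1)) Cu).
  have -> : D W (fun a => D W1 (rho_field W2) a - D W2 (rho_field W1) a) u
      = D W (rho_field (lie TM0 W1 W2)) u.
    apply: (connection_congrr hM hD sW _ (r _ s12) Cu) => [|a Ca].
      exact: (pi_sub hM (sD s1 (r _ s2)) (sD s2 (r _ s1))).
    exact: tf.
  by rewrite -(tf _ _ _ sW s12 Cu) addrC subrK.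
apply: (bianchi_arith (tf2 X Y Z sX sY sZ) (tf2 Y Z X sY sZ sX) (tf2 Z X Y sZ sX sY)).
have J := Jacobi fVV sA sX sY sZ Cu.
by rewrite -[RHS]/(rho 0) -J.
Qed.

End Curvature.

(** * Curvature of a torsion-free metric connection *)

Lemma skew_arith (R : realType) (a1 b1 c1 d1 a2 d2 e e' : R) :
  ((a1 + b1) + (c1 + d1)) - ((a2 + c1) + (b1 + d2)) = e + e' ->
  (- a1 + a2 + e) + (- d1 + d2 + e') = 0.
Proof. lra. Qed.

Section TorsionFree.
Variables (R : realType) (n : nat) (M : topologicalType) (I : Type).
Variable A : atlas 'rV[R]_n M I.
Hypothesis hM : smooth_manifold A.

Local Notation V := 'rV[R]_n.
Local Notation TM := (M * (I -> V))%type.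
Local Notation TM0 := (slit_tangent A).
Local Notation sA := (slit_atlas hM).
Let fV : findim V := findim_rV R n.
Let fVV : findim (V * V)%type := findim_prod fV fV.

Variable L : TM -> R.
Hypothesis sL : smooth_fun TM0 (fun u => L u ^+ 2).
Hypothesis L_pos : forall u v, carrier TM0 u -> tangent A u.1 v -> v != 0 ->
  0 < finsler_metric L u v v.
Local Notation g := (finsler_metric L).

Variable D : (TM -> I -> V * V) -> (TM -> I -> V) -> (TM -> I -> V).
Hypothesis hC : cartan_connection A D L.

Let hD := cartan_linear hC.
Let hR := cartan_regular hC.
Let sD X Y := @connection_section _ _ _ _ _ _ hD X Y.
Let sl := lie_vfield0 hM.

Lemma metric_curvature_shape u x y z w : carrier TM0 u -> tangent A u.1 x ->
  tangent A u.1 y -> tangent A u.1 z -> tangent A u.1 w ->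
  g u (- x + y + z) w = - g u x w + g u y w + g u z w.
Proof.
move=> Cu xT yT zT wT; have nT := tangentN xT.
rewrite (metricDl hM sL Cu (tangentD nT yT) zT wT).
by rewrite (metricDl hM sL Cu nT yT wT) (metricNl hM sL Cu xT wT).
Qed.

(** Differentiating [g(Z, Z')] twice, the metric axiom turns the relation
    [X(Y f) - Y(X f) = [X, Y] f] for [f = g(Z, Z')] into the statement. *)
Lemma curvature_skew X Y Z Z' u : vfield TM0 X -> vfield TM0 Y ->
  pi_vfield A Z -> pi_vfield A Z' -> carrier TM0 u ->
  g u (curvature A D X Y Z u) (Z' u) + g u (Z u) (curvature A D X Y Z' u) = 0.
Proof.
move=> sX sY sZ sZ' Cu; have [i _ Di] := Cu; have rz := range_coord Di.
pose f a := g a (Z a) (Z' a).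
have sf : smooth_fun TM0 f by exact: metric_smooth.
pose F1 W a := g a (D W Z a) (Z' a); pose F2 W a := g a (Z a) (D W Z' a).
have H W W' : vfield TM0 W -> vfield TM0 W' ->
  'd (fun z => 'd (f \o param TM0 i) z (rep TM0 i W z)) (coord TM0 i u) (W' u i)
  = (g u (D W' (D W Z) u) (Z' u) + g u (D W Z u) (D W' Z' u))
    + (g u (D W' Z u) (D W Z' u) + g u (Z u) (D W' (D W Z') u)).
  move=> sW sW'.
  have N : \forall z \near coord TM0 i u,
      (F1 W \o param TM0 i) z + (F2 W \o param TM0 i) z
      = 'd (f \o param TM0 i) z (rep TM0 i W z).
    have := near_range sA Di; apply: filterS => z rt.
    have [Dz cz] := param_range sA rt.
    have := cartan_metric hC sW sZ sZ' Dz.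
    by rewrite /along cz => ->.
  have s1 := metric_smooth hM sL (sD sW sZ) sZ'.
  have s2 := metric_smooth hM sL sZ (sD sW sZ').
  have D1 := smooth_is_diff (s1 i) rz; have D2 := smooth_is_diff (s2 i) rz.
  apply: etrans (diff_val_at (W' u i) (is_diff_near N (is_diff_add D1 D2))) _.
  exact: (congr2 (fun p q => p + q) (cartan_metric hC sW' (sD sW sZ) sZ' Di)
    (cartan_metric hC sW' sZ (sD sW sZ') Di)).
have B := along_bracket fVV sA sf sX sY Di.
have B1 := etrans (esym (congr2 (fun p q => p - q) (H Y X sY sX) (H X Y sX sY))) B.
have {B1}B := etrans B1 (cartan_metric hC (sl sX sY) sZ sZ' Di).
have T W (sW : pi_vfield A W) := sW.1 u Cu.
have KT := curvature_pi hM hD sX sY sZ'.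
rewrite (metricC hM sL Cu (T _ sZ) (T _ KT)).
have E1 := metric_curvature_shape Cu (T _ (sD sX (sD sY sZ)))
  (T _ (sD sY (sD sX sZ))) (T _ (sD (sl sX sY) sZ)) (T _ sZ').
have E2 := metric_curvature_shape Cu (T _ (sD sX (sD sY sZ')))
  (T _ (sD sY (sD sX sZ'))) (T _ (sD (sl sX sY) sZ')) (T _ sZ).
apply: etrans (congr2 (fun p q => p + q) E1 E2) _.
have C W (sW : pi_vfield A W) := metricC hM sL Cu (T _ sZ) (T _ sW).
rewrite (C _ (sD sX (sD sY sZ'))) (C _ (sD sY (sD sX sZ'))) in B.
rewrite (C _ (sD (sl sX sY) sZ')) in B.
exact: skew_arith B.
Qed.

Hypothesis flat : vertically_flat A L.

Let T0 X Y u : vfield TM0 X -> vfield TM0 Y -> carrier TM0 u ->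
  torsion A D X Y u = 0.
Proof. exact: (flat_torsion hM sL L_pos hC). Qed.

Lemma curvature_zero X Y u : vfield TM0 X -> vfield TM0 Y -> carrier TM0 u ->
  curvature A D X Y (fun=> 0) u = 0.
Proof.
move=> sX sY Cu; have s0 := pi_zero hM.
have sK := curvature_pi hM hD sX sY s0.
have KT := sK.1 u Cu; have KKT := (curvature_pi hM hD sX sY sK).1 u Cu.
apply: (metric_nondegenerate L_pos Cu KT).
have := curvature_skew sX sY s0 sK Cu.
by rewrite (metric0l hM sL Cu KKT) addr0.
Qed.

(** The first Bianchi identity makes [K(W, gamma Y)X] symmetric in [W] and [X],
    metric compatibility makes it skew, so that it vanishes: as for the
    Levi-Civita connection, the curvature is horizontal. *)
Lemma vertical_curvature W Y Z u : vfield TM0 W -> pi_vfield A Y ->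
  pi_vfield A Z -> carrier TM0 u -> curvature A D W (gamma_field Y) Z u = 0.
Proof.
move=> sW sY sZ Cu; have gY := gamma_field_vfield hM sY.
have r := rho_field_pi hM.
pose K W X := curvature A D W (gamma_field Y) (rho_field X) u.
have sK W1 W2 (s1 : vfield TM0 W1) (s2 : vfield TM0 W2) :=
  (curvature_pi hM hD s1 gY (r _ s2)).1 u Cu.
have S W1 W2 : vfield TM0 W1 -> vfield TM0 W2 -> K W1 W2 = K W2 W1.
  move=> s1 s2; have := bianchi hM hD T0 s1 gY s2 Cu.
  (* The third term of the Bianchi identity is the curvature applied to
     [rho (gamma Y) = 0]. *)
  have -> : curvature A D W2 W1 (rho_field (gamma_field Y)) u = 0.
    exact: curvature_zero.
  rewrite (curvatureC hM hD gY s2 (r _ s1) Cu) addr0 => /subr0_eq.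
  exact.
have F0 := @symmetric_skew_zero R _
  (fun W X Z => g u (K W X) (rho_field Z u)) (vfield TM0).
have sQ := curvature_pi hM hD sW gY sZ.
have hZ := horizontal_vfield hM hD hR sZ; have hQ := horizontal_vfield hM hD hR sQ.
apply: (metric_nondegenerate L_pos Cu (sQ.1 u Cu)).
have := F0 _ _ W (horizontal A D Z)
  (horizontal A D (curvature A D W (gamma_field Y) Z)) sW hZ hQ.
have ZE a (Ca : carrier TM0 a) := rho_horizontal hM hD hR sZ Ca.
have KE : K W (horizontal A D Z) = curvature A D W (gamma_field Y) Z u.
  exact: (curvature_congrr hM hD sW gY (r _ hZ) sZ Cu ZE).
have QE := rho_horizontal hM hD hR sQ Cu.
rewrite KE -[rho_field _ u]/(rho (horizontal A D _ u)) QE; apply.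
- by move=> W1 W2 W3 s1 s2 s3; rewrite S.
- move=> W1 W2 W3 s1 s2 s3.
  have := curvature_skew s1 gY (r _ s2) (r _ s3) Cu.
  rewrite (metricC hM sL Cu ((r _ s2).1 u Cu) (sK _ _ s1 s3)).
  by move/eqP; rewrite addr_eq0 => /eqP.
Qed.

(** Fields with the same image under [rho] differ by a vertical field, to which
    [vertical_curvature] applies. *)
Lemma curvature_horizontal_part X X' Y Z u : vfield TM0 X -> vfield TM0 X' ->
  vfield TM0 Y -> pi_vfield A Z -> carrier TM0 u ->
  (forall a, carrier TM0 a -> rho (X a) = rho (X' a)) ->
  curvature A D X Y Z u = curvature A D X' Y Z u.
Proof.
move=> sX sX' sY sZ Cu XX'.
have [a Ca|V0 sV VE] := vertical_field hM (vfield_sub hM sX sX').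
  apply: etrans (_ : _ = rho (X a) - rho (X' a)) _ => //.
  by rewrite XX' // subrr.
have gV := gamma_field_vfield hM sV.
have XE a : carrier TM0 a -> X a = gamma_field V0 a + X' a.
  by move=> Ca; rewrite -(VE a Ca) subrK.
rewrite (curvature_congrl hM hD sX (vfield_add hM gV sX') sY sZ Cu XE).
rewrite (curvatureDl hM hD gV sX' sY sZ Cu) (curvatureC hM hD gV sY sZ Cu).
by rewrite (vertical_curvature sY sV sZ Cu) oppr0 add0r.
Qed.

Lemma P_hat_zero X Y u : pi_vfield A X -> pi_vfield A Y -> carrier TM0 u ->
  P_hat A D X Y u = 0.
Proof.
move=> sX sY Cu; have hX := horizontal_vfield hM hD hR sX.
exact: (vertical_curvature hX sY (eta_pi hM) Cu).
Qed.

Lemma hashiguchiE X Y u : vfield TM0 X -> pi_vfield A Y -> carrier TM0 u ->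
  hashiguchi A D X Y u = D X Y u.
Proof.
by move=> sX sY Cu; rewrite /hashiguchi P_hat_zero ?addr0 //; exact: rho_field_pi.
Qed.

Lemma hashiguchi_pi X Y : vfield TM0 X -> pi_vfield A Y ->
  pi_vfield A (hashiguchi A D X Y).
Proof.
move=> sX sY; apply: (pi_congr hM) (sD sX sY) => u Cu.
by rewrite hashiguchiE.
Qed.

Lemma hashiguchi_curvature X Y Z u : vfield TM0 X -> vfield TM0 Y ->
  pi_vfield A Z -> carrier TM0 u ->
  curvature A (hashiguchi A D) X Y Z u = curvature A D X Y Z u.
Proof.
move=> sX sY sZ Cu; rewrite /curvature.
have E W W' : vfield TM0 W -> vfield TM0 W' ->
  hashiguchi A D W (hashiguchi A D W' Z) u = D W (D W' Z) u.
  move=> s1 s2; have sH := hashiguchi_pi s2 sZ.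
  rewrite (hashiguchiE s1 sH Cu).
  apply: (connection_congrr hM hD s1 sH (sD s2 sZ) Cu) => a Ca.
  exact: hashiguchiE.
rewrite (E X Y sX sY) (E Y X sY sX).
apply: (congr2 (fun p q : I -> V => p + q)); first by [].
exact: (hashiguchiE (sl sX sY) sZ Cu).
Qed.

(** Both connections have the same kernel of the connection map. *)
Lemma hashiguchi_horizontal X u : carrier TM0 u ->
  horizontal A (hashiguchi A D) X u = horizontal A D X u.
Proof.
move=> Cu; rewrite /horizontal; congr (xget 0 _).
apply/seteqP; split=> w [[W [sW Wu DW]] rw]; split => //; exists W; split => //.
  by rewrite -(hashiguchiE sW (eta_pi hM) Cu).
by rewrite (hashiguchiE sW (eta_pi hM) Cu).
Qed.

End TorsionFree.

(** * The connection of the energy beta-change *)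

Lemma difference_arith (R : realType) (t1 t2 x1 x2 p1 p2 q1 q2 b c : R) :
  t1 + t2 = (x1 + x2) + ((p1 - q1) * c + b * (p2 - q2)) ->
  (t1 - (x1 + p1 * c) + q1 * c) + (t2 - (x2 + p2 * b) + q2 * b) = 0.
Proof.
by move=> E; rewrite [LHS](_ : _ = t1 + t2 - ((x1 + x2) + ((p1 - q1) * c + b * (p2 - q2))));
  [rewrite E subrr|ring].
Qed.

Lemma defect_derivative_arith (R : realType) (w c G al x y : R) : w != 0 ->
  al * w + c * (- 2 * x) = G -> al + (y - c * x) / w = (G + y) / w + c * x / w.
Proof.
move=> w0 E; have -> : al = (G + 2 * x * c) / w.
  by rewrite -E; field.
by field.
Qed.

Lemma scalar_arith (R : realType) (w a b p q r s t v : R) : w != 0 ->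
  ((a + p + q) / w + r / w * s / w) - ((b + q + p) / w + t / w * v / w)
  - (a - b) / w = r * s / w ^+ 2 - t * v / w ^+ 2.
Proof. by move=> w0; field. Qed.

Lemma curvature_change_arith (R : realType) (n : nat) (I : Type)
    (x y z X Y e : I -> 'rV[R]_n) (s1 s2 c k1 k2 m1 m2 : R) :
  s1 - s2 - c = m1 - m2 ->
  - (x - s1 *: e + k1 *: X) + (y - s2 *: e + k2 *: Y) + (z - c *: e)
  = (- x + y + z) + ((k2 *: Y + m1 *: e) - (k1 *: X + m2 *: e)).
Proof.
move=> E; have -> : m1 = s1 - s2 - c + m2 by rewrite E subrK.
apply/funext => i; rewrite !fctE; apply: (findim_eq (findim_rV R n)) => l.
have lZ k v : l (k *: v) = k * l v by exact: linearZ.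
rewrite !(linearD l, linearN l, lZ); ring.
Qed.

Lemma second_arith (R : realType) (n : nat) (I : Type)
    (x e X : I -> 'rV[R]_n) (a b c : R) :
  x - (a *: e + c *: - X) - b *: e = x - (a + b) *: e + c *: X.
Proof.
apply/funext => i; rewrite !fctE; apply: (findim_eq (findim_rV R n)) => l.
have lZ k v : l (k *: v) = k * l v by exact: linearZ.
rewrite !(linearD l, linearN l, lZ); ring.
Qed.

Section Difference.
Variables (R : realType) (n : nat) (M : topologicalType) (I : Type).
Variable A : atlas 'rV[R]_n M I.
Hypothesis hM : smooth_manifold A.

Local Notation V := 'rV[R]_n.
Local Notation TM := (M * (I -> V))%type.
Local Notation TM0 := (slit_tangent A).
Local Notation sA := (slit_atlas hM).
Let fV : findim V := findim_rV R n.

Lemma along_congr i u w f h : smooth_fun TM0 f -> domain TM0 i u ->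
  (forall a, carrier TM0 a -> f a = h a) ->
  along TM0 i u w f = along TM0 i u w h.
Proof.
move=> sf Di fh.
have N : \forall z \near coord TM0 i u, (f \o param TM0 i) z = (h \o param TM0 i) z.
  have := near_range sA Di; apply: filterS => z rz.
  have [Dz _] := param_range sA rz.
  exact: fh (domain_carrier Dz).
exact: esym (diff_val_at (w i) (is_diff_near N (smooth_is_diff (sf i) (range_coord Di)))).
Qed.

Lemma alongD i u w f h : smooth_fun TM0 f -> smooth_fun TM0 h -> domain TM0 i u ->
  along TM0 i u w (fun a => f a + h a) = along TM0 i u w f + along TM0 i u w h.
Proof.
move=> sf sh Di; have rz := range_coord Di.
exact: (diff_val_at (w i) (is_diff_add (smooth_is_diff (sf i) rz)
  (smooth_is_diff (sh i) rz))).
Qed.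

Lemma alongM i u w f h : smooth_fun TM0 f -> smooth_fun TM0 h -> domain TM0 i u ->
  along TM0 i u w (fun a => f a * h a)
  = along TM0 i u w f * h u + f u * along TM0 i u w h.
Proof.
move=> sf sh Di; have rz := range_coord Di.
apply: etrans (diff_val_at (w i) (is_diff_scale (smooth_is_diff (sf i) rz)
  (smooth_is_diff (sh i) rz))) _.
by rewrite -[X in _ * h X](slit_coordK hM Di) -[X in f X * _](slit_coordK hM Di).
Qed.

Lemma along_cst i u w (c : R) : along TM0 i u w (fun=> c) = 0.
Proof. exact: (diff_val_at (w i) (is_diff_const c _)). Qed.

Variable L : TM -> R.
Hypothesis hL : finsler A L.
Variable D : (TM -> I -> V * V) -> (TM -> I -> V) -> (TM -> I -> V).
Hypothesis hC : cartan_connection A D L.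
Variable zeta : TM -> I -> V.
Hypothesis hz : concurrent A D zeta.
Variable Dt : (TM -> I -> V * V) -> (TM -> I -> V) -> (TM -> I -> V).
Hypothesis hCt : cartan_connection A Dt (energy_beta_change L zeta).

Let sz : pi_vfield A zeta := hz.1.
Let sL := energy_smooth hM hL.
Let hD := cartan_linear hC.
Let hDt := cartan_linear hCt.
Let hR := cartan_regular hC.
Let sD X Y := @connection_section _ _ _ _ _ _ hD X Y.
Let sDt X Y := @connection_section _ _ _ _ _ _ hDt X Y.
Let sl := lie_vfield0 hM.
Let L_pos := finsler_posdef hL.
Local Notation Lt := (energy_beta_change L zeta).
Local Notation g := (finsler_metric L).
Local Notation gt := (finsler_metric Lt).
Let sLt := changed_energy_smooth hM hL hz.

Definition zeta_weight u : R := 1 + g u (zeta u) (zeta u).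

Lemma zeta_weight_neq0 u : carrier TM0 u -> zeta_weight u != 0.
Proof.
move=> Cu; rewrite gt_eqF // /zeta_weight; have zT := sz.1 u Cu.
have [z0|zN] := eqVneq (zeta u) 0.
  by rewrite z0 (metric0l hM sL Cu (tangent0 zT)) addr0.
by rewrite addr_gt0 // L_pos.
Qed.

Lemma zeta_weight_smooth : smooth_fun TM0 zeta_weight.
Proof.
by have := smooth_funD sA (smooth_fun_cst sA 1) (metric_smooth hM sL sz sz).
Qed.

Definition correction (X : TM -> I -> V * V) (Y : TM -> I -> V) u : R :=
  g u (rho_field X u) (Y u) / zeta_weight u.

Lemma correction_smooth X Y : vfield TM0 X -> pi_vfield A Y ->
  smooth_fun TM0 (correction X Y).
Proof.
move=> sX sY; have s1 := metric_smooth hM sL (rho_field_pi hM sX) sY.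
have s2 := smooth_funV sA zeta_weight_neq0 zeta_weight_smooth.
by have := smooth_funM sA s1 s2.
Qed.

(** The difference between the new Cartan connection and the connection
    [D_X Y - g(rho X, Y) / (1 + p^2) zeta], where [p^2 = g(zeta, zeta)]. *)
Definition connection_defect X Y u : I -> V :=
  Dt X Y u - D X Y u + correction X Y u *: zeta u.

Lemma connection_defect_pi X Y : vfield TM0 X -> pi_vfield A Y ->
  pi_vfield A (connection_defect X Y).
Proof.
move=> sX sY; apply: (pi_add hM).
  exact: (pi_sub hM (sDt sX sY) (sD sX sY)).
exact: (pi_scale hM (correction_smooth sX sY) sz).
Qed.

(** The metric axiom, with [D_X zeta = - rho X]. *)
Lemma along_dual_form i X Y u : vfield TM0 X -> pi_vfield A Y ->
  domain TM0 i u -> along TM0 i u (X u) (fun a => g a (Y a) (zeta a))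
  = g u (D X Y u) (zeta u) - g u (rho_field X u) (Y u).
Proof.
move=> sX sY Di; have Cu := domain_carrier Di.
apply: etrans (cartan_metric hC sX sY sz Di) _; congr (_ + _).
rewrite (connection_zeta hM hC hz sX Cu).
have rT := (rho_field_pi hM sX).1 u Cu; have YT := sY.1 u Cu.
rewrite (metricC hM sL Cu YT (tangentN rT)).
exact: (metricNl hM sL Cu rT YT).
Qed.

(** In the new metric [zeta] pairs with [Z] to [(1 + p^2) g(Z, zeta)], which
    cancels the denominator of [correction]. *)
Lemma changed_metric_defect X Y Z u : vfield TM0 X -> pi_vfield A Y ->
  pi_vfield A Z -> carrier TM0 u ->
  gt u (connection_defect X Y u) (Z u)
  = gt u (Dt X Y u) (Z u)
    - (g u (D X Y u) (Z u) + g u (D X Y u) (zeta u) * g u (Z u) (zeta u))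
    + g u (rho_field X u) (Y u) * g u (Z u) (zeta u).
Proof.
move=> sX sY sZ Cu.
have T W (sW : pi_vfield A W) := sW.1 u Cu.
have t1 := T _ (sDt sX sY); have t2 := T _ (sD sX sY).
have zT := T _ sz; have ZT := T _ sZ.
have czT := tangentZ (correction X Y u) zT.
rewrite (metricDl hM sLt Cu _ czT ZT); last exact: tangentD t1 (tangentN t2).
rewrite (metricBl hM sLt Cu t1 t2 ZT) (metricZl hM sLt Cu _ zT ZT).
rewrite (changed_metric hM hL hC hz Cu t2 ZT).
rewrite (changed_metric hM hL hC hz Cu zT ZT); congr (_ + _).
rewrite (metricC hM sL Cu zT ZT).
have -> (a b : R) : b + a * b = (1 + a) * b by rewrite mulrDl mul1r.
by rewrite /correction -[1 + _]/(zeta_weight u) mulrA divfK // zeta_weight_neq0.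
Qed.

Lemma connection_defect_skew X Y Z u : vfield TM0 X -> pi_vfield A Y ->
  pi_vfield A Z -> carrier TM0 u ->
  gt u (connection_defect X Y u) (Z u) + gt u (connection_defect X Z u) (Y u) = 0.
Proof.
move=> sX sY sZ Cu; have [i _ Di] := Cu.
have T W (sW : pi_vfield A W) := sW.1 u Cu.
apply: etrans (congr2 (fun p q => p + q) (changed_metric_defect sX sY sZ Cu)
  (changed_metric_defect sX sZ sY Cu)) _.
apply: difference_arith.
have sYZ := metric_smooth hM sL sY sZ.
have sYz := metric_smooth hM sL sY sz; have sZz := metric_smooth hM sL sZ sz.
have E := cartan_metric hCt sX sY sZ Di.
rewrite (metricC hM sLt Cu (T _ sY) (T _ (sDt sX sZ))) in E.
have AC := along_congr (X u) (metric_smooth hM sLt sY sZ) Di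
  (h := fun a => g a (Y a) (Z a) + g a (Y a) (zeta a) * g a (Z a) (zeta a))
  (fun a Ca => changed_metric hM hL hC hz Ca (sY.1 a Ca) (sZ.1 a Ca)).
have M1 := cartan_metric hC sX sY sZ Di.
rewrite (metricC hM sL Cu (T _ sY) (T _ (sD sX sZ))) in M1.
have P1 := alongD (X u) sYZ (smooth_funM sA sYz sZz) Di.
have P2 := etrans (alongM (X u) sYz sZz Di)
  (congr2 (fun p q => p * g u (Z u) (zeta u) + g u (Y u) (zeta u) * q)
    (along_dual_form sX sY Di) (along_dual_form sX sZ Di)).
exact: etrans (etrans (esym E) AC)
  (etrans P1 (congr2 (fun p q => p + q) M1 P2)).
Qed.

Lemma connection_defect_sym X Y u : vfield TM0 X -> vfield TM0 Y ->
  carrier TM0 u ->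
  connection_defect X (rho_field Y) u = connection_defect Y (rho_field X) u.
Proof.
move=> sX sY Cu; rewrite /connection_defect.
have r := rho_field_pi hM.
have T := flat_torsion hM sL L_pos hC (concurrent_flat hM hL hC hz) sX sY Cu.
have Tt := flat_torsion hM sLt (changed_posdef hM hL hC hz) hCt
  (changed_flat hM hL hC hz) sX sY Cu.
have -> : correction X (rho_field Y) u = correction Y (rho_field X) u.
  by rewrite /correction (metricC hM sL Cu ((r _ sX).1 u Cu) ((r _ sY).1 u Cu)).
apply: (congr2 (fun p q : I -> V => p + q)) => //.
move/subr0_eq: T => T; move/subr0_eq: Tt => Tt.
apply/eqP; rewrite subr_eq addrAC -addrA T -Tt.
by rewrite addrC subrK.
Qed.

(** Both connections are torsion free, so that the defect is symmetric in [X]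
    and [Y]; both are metric, each for its own metric, which makes the defect
    skew for the new one. The Koszul argument then applies, in terms of the
    horizontal fields that lift sections of the pullback bundle. *)
Lemma changed_connection X Y u : vfield TM0 X -> pi_vfield A Y ->
  carrier TM0 u -> Dt X Y u = D X Y u - correction X Y u *: zeta u.
Proof.
move=> sX sY Cu; have r := rho_field_pi hM.
suff E0 : connection_defect X Y u = 0.
  move: E0; rewrite /connection_defect => /eqP.
  by rewrite addr_eq0 subr_eq addrC => /eqP.
have F0 := @symmetric_skew_zero R _
  (fun X Y Z => gt u (connection_defect X (rho_field Y) u) (rho_field Z u))
  (vfield TM0).
have sE := connection_defect_pi sX sY.
have hY := horizontal_vfield hM hD hR sY; have hE := horizontal_vfield hM hD hR sE.
apply: (metric_nondegenerate (changed_posdef hM hL hC hz) Cu (sE.1 u Cu)).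
have := F0 _ _ X (horizontal A D Y) (horizontal A D (connection_defect X Y)) sX hY hE.
have YE a (Ca : carrier TM0 a) := rho_horizontal hM hD hR sY Ca.
have DE : connection_defect X (rho_field (horizontal A D Y)) u
    = connection_defect X Y u.
  rewrite /connection_defect /correction.
  rewrite (connection_congrr hM hDt sX (r _ hY) sY Cu YE).
  rewrite (connection_congrr hM hD sX (r _ hY) sY Cu YE).
  by rewrite -[rho_field (horizontal A D Y) u]/(rho (horizontal A D Y u)) YE.
have QE := rho_horizontal hM hD hR sE Cu.
rewrite DE -[rho_field (horizontal A D (connection_defect X Y)) u]/(rho (horizontal A D _ u)) QE.
apply.
- by move=> X1 X2 X3 s1 s2 s3; rewrite connection_defect_sym.
- move=> X1 X2 X3 s1 s2 s3.
  have := connection_defect_skew s1 (r _ s2) (r _ s3) Cu.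
  by move/eqP; rewrite addr_eq0 => /eqP.
Qed.

(** The coefficient of [zeta] in the second covariant derivatives: the
    derivative of [correction Y Z] along [X], plus the [correction] of the first
    derivative along [Y]. The first line is symmetric in [X] and [Y] up to
    [g(rho [X, Y], Z)], so that only the second one survives in the curvature. *)
Definition second_defect X Y Z u : R :=
  (g u (D X (rho_field Y) u) (Z u) + g u (rho_field Y u) (D X Z u)
   + g u (rho_field X u) (D Y Z u)) / zeta_weight u
  + correction Y Z u * g u (rho_field X u) (zeta u) / zeta_weight u.

(** The last term comes from [D_X zeta = - rho X]. *)
Lemma changed_second_derivative X Y Z u : vfield TM0 X -> vfield TM0 Y ->
  pi_vfield A Z -> carrier TM0 u ->
  Dt X (Dt Y Z) u = D X (D Y Z) u - second_defect X Y Z u *: zeta u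
    + correction Y Z u *: rho_field X u.
Proof.
move=> sX sY sZ Cu; have [i _ Di] := Cu; have r := rho_field_pi hM.
have sc := correction_smooth sY sZ.
have sW := pi_sub hM (sD sY sZ) (pi_scale hM sc sz).
have WE a (Ca : carrier TM0 a) := changed_connection sY sZ Ca.
apply: etrans (connection_congrr hM hDt sX (sDt sY sZ) sW Cu WE) _.
apply: etrans (changed_connection sX sW Cu) _.
rewrite (connection_subr hM hD sX (sD sY sZ) (pi_scale hM sc sz) Cu).
rewrite (connection_leibniz hD sc sX sz Di) (connection_zeta hM hC hz sX Cu).
have w0 := zeta_weight_neq0 Cu.
have XT := (r _ sX).1 u Cu; have zT := sz.1 u Cu; have DT := (sD sY sZ).1 u Cu.
have cE : correction X (fun a => D Y Z a - correction Y Z a *: zeta a) u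
   = (g u (rho_field X u) (D Y Z u)
      - correction Y Z u * g u (rho_field X u) (zeta u)) / zeta_weight u.
  rewrite {1}/correction; congr (_ / _).
  have czT := tangentZ (correction Y Z u) zT.
  rewrite (metricC hM sL Cu XT (tangentD DT (tangentN czT))).
  rewrite (metricBl hM sL Cu DT czT XT) (metricZl hM sL Cu _ zT XT).
  by rewrite (metricC hM sL Cu DT XT) (metricC hM sL Cu zT XT).
have aw : along TM0 i u (X u) zeta_weight = - 2 * g u (rho_field X u) (zeta u).
  have s1 := metric_smooth hM sL sz sz.
  apply: etrans (alongD (X u) (smooth_fun_cst sA 1) s1 Di) _.
  by rewrite along_cst add0r; exact: (along_zeta_norm hM sL hC hz sX Di).
have am : along TM0 i u (X u) (correction Y Z) * zeta_weight u
    + correction Y Z u * (- 2 * g u (rho_field X u) (zeta u))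
    = g u (D X (rho_field Y) u) (Z u) + g u (rho_field Y u) (D X Z u).
  rewrite -aw; apply: etrans (esym (alongM (X u) sc zeta_weight_smooth Di)) _.
  apply: etrans (cartan_metric hC sX (r _ sY) sZ Di).
  have cw a : carrier TM0 a ->
      correction Y Z a * zeta_weight a = g a (rho_field Y a) (Z a).
    by move=> Ca; exact: divfK (zeta_weight_neq0 Ca) _.
  exact: (along_congr (X u) (smooth_funM sA sc zeta_weight_smooth) Di cw).
have S : along TM0 i u (X u) (correction Y Z)
    + correction X (fun a => D Y Z a - correction Y Z a *: zeta a) u
    = second_defect X Y Z u.
  by rewrite cE; exact: defect_derivative_arith w0 am.
rewrite -S; exact: second_arith.
Qed.

(** In the alternation of the second derivatives, the derivatives of [Y] and [X]
    combine to [rho [X, Y]] as the torsion is 0, and cancel; what remains are the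
    terms of the tensor [H]. *)
Theorem changed_curvature X Y Z u : vfield TM0 X -> vfield TM0 Y ->
  pi_vfield A Z -> carrier TM0 u ->
  curvature A Dt X Y Z u = curvature A D X Y Z u
    + H_star L zeta (rho_field X) (rho_field Y) Z u.
Proof.
move=> sX sY sZ Cu; have r := rho_field_pi hM.
rewrite /curvature (changed_second_derivative sX sY sZ Cu).
rewrite (changed_second_derivative sY sX sZ Cu).
rewrite (changed_connection (sl sX sY) sZ Cu).
apply: curvature_change_arith.
have T := flat_torsion hM sL L_pos hC (concurrent_flat hM hL hC hz) sX sY Cu.
move/subr0_eq: T => T.
have XT := (sD sX (r _ sY)).1 u Cu; have YT := (sD sY (r _ sX)).1 u Cu.
have -> : correction (lie TM0 X Y) Z u = (g u (D X (rho_field Y) u) (Z u)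
    - g u (D Y (rho_field X) u) (Z u)) / zeta_weight u.
  rewrite /correction -(metricBl hM sL Cu XT YT (sZ.1 u Cu)).
  by rewrite T.
exact: scalar_arith (zeta_weight_neq0 Cu).
Qed.

End Difference.

(** * The Hashiguchi curvatures *)

Theorem theorem5p17 (R : realType) (n : nat) (M : topologicalType) (I : Type)
    (A : atlas 'rV[R]_n M I) (hM : smooth_manifold A)
    (L : M * (I -> 'rV[R]_n) -> R) (hL : finsler A L)
    (D : (M * (I -> 'rV[R]_n) -> I -> 'rV[R]_n * 'rV[R]_n) ->
         (M * (I -> 'rV[R]_n) -> I -> 'rV[R]_n) ->
         (M * (I -> 'rV[R]_n) -> I -> 'rV[R]_n))
    (hD : cartan_connection A D L)
    (zeta : M * (I -> 'rV[R]_n) -> I -> 'rV[R]_n)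
    (hzeta : concurrent A D zeta)
    (Dt : (M * (I -> 'rV[R]_n) -> I -> 'rV[R]_n * 'rV[R]_n) ->
          (M * (I -> 'rV[R]_n) -> I -> 'rV[R]_n) ->
          (M * (I -> 'rV[R]_n) -> I -> 'rV[R]_n))
    (hDt : cartan_connection A Dt (energy_beta_change L zeta)) :
  let g := finsler_metric L in
  let p2 u := g u (zeta u) (zeta u) in
  let Ds := hashiguchi A D in
  let Dts := hashiguchi A Dt in
  (forall X Y Z u, vfield (slit_tangent A) X -> vfield (slit_tangent A) Y ->
     pi_vfield A Z -> carrier (slit_tangent A) u ->
     curvature A Dts X Y Z u
       = curvature A Ds X Y Z u
         + (g u (torsion A D X Y u) (Z u) / (1 + p2 u)) *: zeta u
         + H_star L zeta (rho_field X) (rho_field Y) Z u)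
  /\ (forall X Y Z u, pi_vfield A X -> pi_vfield A Y -> pi_vfield A Z ->
     carrier (slit_tangent A) u ->
     [/\ v_curvature A Dts X Y Z u = v_curvature A Ds X Y Z u,
         hv_curvature A Dts X Y Z u
           = hv_curvature A Ds X Y Z u
             - (g u (hv_torsion A D Y X u) (Z u) / (1 + p2 u)) *: zeta u &
         h_curvature A Dts X Y Z u
           = h_curvature A Ds X Y Z u + H_star L zeta X Y Z u]).
Proof.
move=> g p2 Ds Dts.
have sL := energy_smooth hM hL; have Lp := finsler_posdef hL.
have fl := concurrent_flat hM hL hD hzeta.
have sLt := changed_energy_smooth hM hL hzeta.
have Ltp := changed_posdef hM hL hD hzeta.
have flt := changed_flat hM hL hD hzeta.
have lD := cartan_linear hD; have rD := cartan_regular hD.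
have lDt := cartan_linear hDt; have rDt := cartan_regular hDt.
have sA := slit_atlas hM.
have HC X Y Z u (sX : vfield (slit_tangent A) X) (sY : vfield (slit_tangent A) Y) (sZ : pi_vfield A Z)
    (Cu : carrier (slit_tangent A) u) : curvature A Ds X Y Z u = curvature A D X Y Z u.
  exact: (hashiguchi_curvature hM sL Lp hD fl sX sY sZ Cu).
have HCt X Y Z u (sX : vfield (slit_tangent A) X) (sY : vfield (slit_tangent A) Y) (sZ : pi_vfield A Z)
    (Cu : carrier (slit_tangent A) u) : curvature A Dts X Y Z u = curvature A Dt X Y Z u.
  exact: (hashiguchi_curvature hM sLt Ltp hDt flt sX sY sZ Cu).
have main X Y Z u (sX : vfield (slit_tangent A) X) (sY : vfield (slit_tangent A) Y) (sZ : pi_vfield A Z)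
    (Cu : carrier (slit_tangent A) u) : curvature A Dts X Y Z u = curvature A Ds X Y Z u
       + H_star L zeta (rho_field X) (rho_field Y) Z u.
  rewrite (HC _ _ _ _ sX sY sZ Cu) (HCt _ _ _ _ sX sY sZ Cu).
  exact: (changed_curvature hM hL hD hzeta hDt sX sY sZ Cu).
(* The torsion is 0, and so is the term that contains it. *)
split=> [X Y Z u sX sY sZ Cu|X Y Z u sX sY sZ Cu].
  rewrite (flat_torsion hM sL Lp hD fl sX sY Cu).
  have -> : g u 0 (Z u) = 0 := metric0l hM sL Cu (sZ.1 u Cu).
  rewrite mul0r scale0r addr0; exact: main.
have gX := gamma_field_vfield hM sX; have gY := gamma_field_vfield hM sY.
have V0 W Y' : vfield (slit_tangent A) W -> pi_vfield A Y' ->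
    curvature A Ds W (gamma_field Y') Z u = 0.
  move=> sW sY'; have gY' := gamma_field_vfield hM sY'.
  rewrite (HC _ _ _ _ sW gY' sZ Cu).
  exact: (vertical_curvature hM sL Lp hD fl sW sY' sZ Cu).
have V0t W Y' : vfield (slit_tangent A) W -> pi_vfield A Y' ->
    curvature A Dts W (gamma_field Y') Z u = 0.
  move=> sW sY'; have gY' := gamma_field_vfield hM sY'.
  rewrite (HCt _ _ _ _ sW gY' sZ Cu).
  exact: (vertical_curvature hM sLt Ltp hDt flt sW sY' sZ Cu).
(* [L] and its change have different horizontal maps, whose values have the
   same image under [rho]. *)
have hor W : pi_vfield A W -> vfield (slit_tangent A) (horizontal A Ds W).
  move=> sW; apply: (vfield_congr hM) (horizontal_vfield hM lD rD sW) => a Ca.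
  exact: esym (hashiguchi_horizontal hM sL Lp hD fl W Ca).
have hort W : pi_vfield A W -> vfield (slit_tangent A) (horizontal A Dts W).
  move=> sW; apply: (vfield_congr hM) (horizontal_vfield hM lDt rDt sW) => a Ca.
  exact: esym (hashiguchi_horizontal hM sLt Ltp hDt flt W Ca).
have rhor W a (sW : pi_vfield A W) (Ca : carrier (slit_tangent A) a) :
    rho (horizontal A Ds W a) = W a.
  rewrite (hashiguchi_horizontal hM sL Lp hD fl W Ca).
  exact: (rho_horizontal hM lD rD sW Ca).
have rhort W a (sW : pi_vfield A W) (Ca : carrier (slit_tangent A) a) :
    rho (horizontal A Dts W a) = W a.
  rewrite (hashiguchi_horizontal hM sLt Ltp hDt flt W Ca).
  exact: (rho_horizontal hM lDt rDt sW Ca).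
have rr W (sW : pi_vfield A W) a (Ca : carrier (slit_tangent A) a) :
    rho (horizontal A Dts W a) = rho (horizontal A Ds W a).
  by rewrite rhort // rhor.
split.
(* The curvatures are 0 as soon as one argument is vertical. *)
- by apply: etrans (V0t _ _ gX sY) (esym (V0 _ _ gX sY)).
- rewrite (flat_hv_torsion hM sL Lp hD fl sY sX Cu).
  have -> : g u 0 (Z u) = 0 := metric0l hM sL Cu (sZ.1 u Cu).
  rewrite mul0r scale0r subr0.
  exact: etrans (V0t _ _ (hort _ sX) sY) (esym (V0 _ _ (hor _ sX) sY)).
(* The general formula holds for the new horizontal lifts; they can be replaced
   by the old ones in the old curvature, which only sees horizontal parts. *)
apply: etrans (main _ _ _ _ (hort _ sX) (hort _ sY) sZ Cu) _.
have hs W : pi_vfield A W -> rho_field (horizontal A Dts W) u = W u.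
  by move=> sW; exact: rhort.
have -> : H_star L zeta (rho_field (horizontal A Dts X))
    (rho_field (horizontal A Dts Y)) Z u = H_star L zeta X Y Z u.
  by rewrite /H_star /alternate (hs _ sX) (hs _ sY).
apply: (congr2 (fun p q : I -> 'rV[R]_n => p + q) _ erefl).
have part := curvature_horizontal_part hM sL Lp hD fl.
rewrite /h_curvature (HC _ _ _ _ (hort _ sX) (hort _ sY) sZ Cu).
rewrite (HC _ _ _ _ (hor _ sX) (hor _ sY) sZ Cu).
rewrite (part _ _ _ _ _ (hort _ sX) (hor _ sX) (hort _ sY) sZ Cu (rr _ sX)).
rewrite (curvatureC hM lD (hor _ sX) (hort _ sY) sZ Cu).
rewrite (part _ _ _ _ _ (hort _ sY) (hor _ sY) (hor _ sX) sZ Cu (rr _ sY)).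
exact: esym (curvatureC hM lD (hor _ sX) (hor _ sY) sZ Cu).
Qed.
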